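(* Let $d$ be a cardinal with $2\le d\le\omega$, $T_d$ a tree on $d^d$ with suitable levels, $1\le\xi<\omega_1$, $(X_i)_{i\in d}$ a sequence of Polish spaces, and $A_0,A_1$ disjoint analytic subsets of $\prod_{i\in d}X_i$. (1) Let $S\in\Sigma^0_\xi([T_d])$. Then (a) $A_0$ is separable from $A_1$ by a $\mathrm{pot}(\Pi^0_\xi)$ set, or (b) $((d^\omega)_{i\in d},S,[T_d]\setminus S)\le((X_i)_{i\in d},A_0,A_1)$. If moreover $S$ is not separable from $[T_d]\setminus S$ by a $\mathrm{pot}(\Pi^0_\xi)$ set, then exactly one of (a), (b) holds. (2) Let $S^0,S^1\in\Sigma^0_\xi([T_d])$ be disjoint. Then (a) $A_0$ is separable from $A_1$ by a $\mathrm{pot}(\Delta^0_\xi)$ set, or (b) $((d^\omega)_{i\in d},S^0,S^1)\le((X_i)_{i\in d},A_0,A_1)$. If moreover $S^0$ is not separable from $S^1$ by a $\mathrm{pot}(\Delta^0_\xi)$ set, then exactly one of (a), (b) holds.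
   Context: $d$ is identified with $\{0,\dots,d-1\}$ (or $\omega$) with the discrete topology; $(d^d)^l$ is identified with $(d^l)^d$ via $\vec\alpha\mapsto((\alpha_i(j))_{i\in d})_{j\in l}$. A tree on $d^d$ is a subset of $(d^d)^{<\omega}$ closed under initial segments, with body $[T]\subseteq(d^\omega)^d$. For $\mathcal T\subseteq\mathcal X^d$, $G^{\mathcal T}$ is the graph on $\mathcal T$ whose edges join distinct elements sharing some coordinate; $\mathcal T$ is one-sided if distinct elements share at most one coordinate; almost acyclic if every $G^{\mathcal T}$-cycle $(\vec x^n)_{n\le L}$ admits $i\in d$, $k<m<n<L$ with $x^k_i=x^m_i=x^n_i$. $T$ has suitable levels if each level $T\cap(d^d)^l$ is finite, one-sided and almost acyclic. For a class $\Lambda$, a Borel $B\subseteq\prod X_i$ is $\mathrm{pot}(\Lambda)$ if there are finer 0-dimensional Polish topologies $\tau_i$ on $X_i$ with $B\in\Lambda(\prod(X_i,\tau_i))$; ''$A$ separable from $B$ by a $\mathrm{pot}(\Lambda)$ set'' means some $\mathrm{pot}(\Lambda)$ set contains $A$ and is disjoint from $B$. $((Z_i)_{i\in d},S_0,S_1)\le((X_i)_{i\in d},A_0,A_1)$ means there are continuous $f_i:Z_i\to X_i$ ($i\in d$) with $S_\varepsilon\subseteq(\prod_i f_i)^{-1}(A_\varepsilon)$ for $\varepsilon\in\{0,1\}$. *)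

(* Defs.v *)
From HB Require Import structures.
From mathcomp Require Import all_boot all_order all_algebra.
From mathcomp Require Import all_classical all_reals all_analysis.
From mathcomp Require Import Rstruct.

Set Implicit Arguments.
Unset Strict Implicit.
Unset Printing Implicit Defensive.

Local Open Scope classical_set_scope.

Definition complete_metric (M : metricType Rdefinitions.R) : Prop :=
  forall F : set_system M, ProperFilter F -> cauchy F ->
  exists x : M, F --> x.

(* [Metric.axioms_ R T] is the type of metric structures on the carrier [T];
   the topology it packs is unrelated to that of [T] until it is required to
   have the same open sets. The empty space is Polish. *)
Definition polish (T : topologicalType) : Prop :=
  (exists2 D : set T, countable D & dense D) /\
  exists m : Metric.axioms_ Rdefinitions.R T,
    let M : metricType Rdefinitions.R := Metric.Pack m in
    (forall U : set T, @open M U <-> @open T U) /\ complete_metric M.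

(* A basis of clopen sets; the library's [zero_dimensional] only asks that
   points be separated by clopen sets, which is weaker for non-compact
   spaces. *)
Definition clopen_basis (T : topologicalType) : Prop := basis (@clopen T).

Definition analytic (T : topologicalType) (A : set T) : Prop :=
  exists (Z : topologicalType) (f : Z -> T),
    [/\ polish Z, continuous f & range f = A].

Definition borel (T : topologicalType) : set (set T) := <<s @open T >>.

Definition pointclass := forall T : topologicalType, set (set T).

(* Ordinals are elements of a well-ordered type [W]: [xi : W] stands for the
   order type of its set of predecessors. *)
Section borel_classes.
Context {disp : Order.disp_t} {W : orderType disp}.
Implicit Type xi : W.

Definition ge1 xi : Prop := exists eta : W, (eta < xi)%O.

Definition eq1 xi : Prop :=
  ge1 xi /\ forall eta : W, (eta < xi)%O -> ~ ge1 eta.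

Definition countable_ordinal xi : Prop :=
  countable [set eta : W | (eta < xi)%O].

Inductive is_Sigma0 (T : topologicalType) : W -> set T -> Prop :=
| is_Sigma0_open xi (A : set T) : eq1 xi -> open A -> is_Sigma0 xi A
| is_Sigma0_bigcup xi (eta : nat -> W) (A : nat -> set T) :
    (forall n, ge1 (eta n) /\ (eta n < xi)%O) ->
    (forall n, is_Sigma0 (eta n) (~` A n)) ->
    is_Sigma0 xi (\bigcup_n A n).

Definition Sigma0 xi : pointclass := fun T A => @is_Sigma0 T xi A.
Definition Pi0 xi : pointclass := fun T A => Sigma0 xi (~` A).
Definition Delta0 xi : pointclass := fun T A => Sigma0 xi A /\ Pi0 xi A.

End borel_classes.

Section potential.
Context {I : choiceType} (X : I -> topologicalType).

Definition pot (L : pointclass) (B : set (prod_topology X)) : Prop :=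
  borel B /\
  exists tau : forall i, Topological.axioms_ (X i),
    let Y i : topologicalType := Topological.Pack (tau i) in
    [/\ forall i (U : set (X i)), @open (X i) U -> @open (Y i) U,
        forall i, clopen_basis (Y i),
        forall i, polish (Y i)
      & L (prod_topology Y) B].

Definition pot_separable (L : pointclass) (A B : set (prod_topology X)) : Prop :=
  exists2 C : set (prod_topology X), pot L C & A `<=` C /\ C `&` B = set0.

End potential.

Definition reduces {I : choiceType}
    (Z : I -> topologicalType) (S0 S1 : set (prod_topology Z))
    (X : I -> topologicalType) (A0 A1 : set (prod_topology X)) : Prop :=
  exists f : forall i, Z i -> X i,
    let F (z : prod_topology Z) : prod_topology X := fun i => f i (z i) in
    [/\ forall i, continuous (f i), S0 `<=` F @^-1` A0 & S1 `<=` F @^-1` A1].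

Section graph.
Context {I X : Type} (T : set (I -> X)).

Definition edge (x y : I -> X) : Prop :=
  [/\ T x, T y, x <> y & exists i, x i = y i].

Definition is_cycle (L : nat) (x : nat -> I -> X) : Prop :=
  [/\ 3 <= L, x L = x 0,
      forall m n, m < L -> n < L -> x m = x n -> m = n
    & forall n, n < L -> edge (x n) (x n.+1)].

Definition one_sided : Prop :=
  forall x y, T x -> T y -> x <> y ->
  forall i j, x i = y i -> x j = y j -> i = j.

Definition almost_acyclic : Prop :=
  forall L x, is_cycle L x ->
  exists i k m n, [/\ k < m, m < n, n < L, x k i = x m i & x m i = x n i].

End graph.

Variant dcard := Fin of nat | Omega.

Definition ix (d : dcard) : choiceType :=
  match d with Fin n => 'I_n | Omega => nat end.

Definition dcard_ge2 (d : dcard) : Prop :=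
  match d with Fin n => 2 <= n | Omega => True end.

Section trees.
Context {d : dcard}.

Definition is_tree (T : set (seq (ix d -> ix d))) : Prop :=
  forall s t, T (s ++ t) -> T s.

(* The identification of [(d^d)^l] with [(d^l)^d]. *)
Definition coords (s : seq (ix d -> ix d)) : ix d -> seq (ix d) :=
  fun i => [seq a i | a <- s].

Definition level (T : set (seq (ix d -> ix d))) (l : nat) :
    set (ix d -> seq (ix d)) :=
  coords @` [set s | T s /\ size s = l].

Definition suitable_levels (T : set (seq (ix d -> ix d))) : Prop :=
  forall l, [/\ finite_set (level T l), one_sided (level T l)
              & almost_acyclic (level T l)].

End trees.

Definition dpow_omega (d : dcard) : topologicalType :=
  prod_topology (fun _ : nat => discrete_topology (ix d)).

Definition dpows (d : dcard) : ix d -> topologicalType := fun=> dpow_omega d.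

Definition body (d : dcard) (T : set (seq (ix d -> ix d))) :
    set (prod_topology (@dpows d)) :=
  [set alpha | forall l, T (mkseq (fun j i => alpha i j) l)].

Definition class_in (L : pointclass) (X : topologicalType) (E S : set X) : Prop :=
  S `<=` E /\ L (set_type E) (set_val @^-1` S).

Definition exactly_one (P Q : Prop) : Prop := (P /\ ~ Q) \/ (~ P /\ Q).

(* Main.v *)
Require Import Defs.
From HB Require Import structures.
From mathcomp Require Import all_boot all_order all_algebra.
From mathcomp Require Import all_classical all_reals all_analysis.
From mathcomp Require wochoice.
From mathcomp Require Import Rstruct zify lra.

(** Write [P] for the product of the [X i]. For a sigma-ideal [J] of subsets of [P]
    let [cl_x J] be the ideal generated by the members of [J] that are potentially
    Sigma^0_x. These closures play the role of closures in the Gandy-Harrington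
    topologies: if [y > x], [cl_y J <= M] and [H] is a potentially Sigma^0_x member
    of [M], then the complement of [H] is potentially Sigma^0_y, hence cannot belong
    to [J] unless [M] is improper. So a point of the closure of [J] can be moved
    into [J] while every coarser closure condition is kept.

    If (a) fails, the sets missing [A1] and the closure [cl_xi] of the sets missing
    [A0] generate a proper ideal. Starting from it, one attaches to every node of the
    tree a proper ideal, level by level. Nodes of one level that share a coordinate
    must agree on which Borel sets of that coordinate are small; since the levels are
    acyclic, enlarging the ideal of one node can be propagated to all the others.
    The nodes are compared by true-stage relations [s <=_x t], which say that at [t]
    the guesses made at [s] about Sigma^0_y facts, [y <= x], still look right; the ideal of
    [t] contains [cl_x] of the ideal of [s], and the guess made at [t] about
    membership in [S] decides whether the ideal of [t] is concentrated on [A0] or on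
    [A1]. Along a branch the true stages guess right and their ideals shrink to a
    point of [A0] or [A1], whose [i]-th coordinate depends on the [i]-th coordinate
    of the branch only. *)

Set Implicit Arguments.
Unset Strict Implicit.
Unset Printing Implicit Defensive.
Import Order.TTheory GRing.Theory Num.Theory.
Local Open Scope classical_set_scope.

(** * True stages *)

Section prefixes.
Context {A : Type}.
Implicit Types (s t u : seq A) (r : set (seq A)).

(** The obstacle is that a node cannot meet infinitely many closure demands at once: a swap at level
    y only keeps a set that is potentially Sigma^0 of some level below y, and infinitely many levels
    below y need not have a maximum there. Queries are therefore numbered and a node of length l
    looks only at those below l; a stage cannot be injured at a level of which it knows no query, so
    finitely many levels are active at each node. For the same reason the coordinatewise information
    carried through the swaps concerns finitely many coordinates: it is then a finite union of Borel
    cylinders, a set of level 0. One-sidedness makes finitely many coordinates enough even for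
    infinite d.

    Acyclicity enters through one fact: a node outside a connected set of nodes shares at most one
    coordinate with it, so ideals are amalgamated over one marginal at a time.

    One reduction with three labels serves both parts: branches in neither set are sent to A1 in (1)
    and left unconstrained in (2). That (a) and (b) exclude each other under the extra hypothesis is
    a separate matter: potential classes pull back along continuous maps. *)

Definition pre s t : Prop := exists v, t = s ++ v.

Lemma pre_refl s : pre s s. Proof. by exists [::]; rewrite cats0. Qed.

Lemma pre_nil s : pre [::] s. Proof. by exists s. Qed.

Lemma pre_trans s t u : pre s t -> pre t u -> pre s u.
Proof. by move=> [v ->] [w ->]; exists (v ++ w); rewrite catA. Qed.

Lemma pre_size s t : pre s t -> size s <= size t.
Proof. by move=> [v ->]; rewrite size_cat leq_addr. Qed.

Lemma pre_take s t : pre s t -> s = take (size s) t.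
Proof. by move=> [v ->]; rewrite take_size_cat. Qed.

Lemma take_pre k t : pre (take k t) t.
Proof. by exists (drop k t); rewrite cat_take_drop. Qed.

Lemma pre_size_eq s t : pre s t -> size t <= size s -> s = t.
Proof. by move=> st h; rewrite (pre_take st) take_oversize. Qed.

Lemma pre_ltsize s t : pre s t -> s <> t -> size s < size t.
Proof.
move=> st ne; rewrite ltnNge; apply/negP => h; apply: ne.
exact: pre_size_eq st h.
Qed.

Lemma pre_total s t u : pre s u -> pre t u -> size s <= size t -> pre s t.
Proof.
move=> su tu h; rewrite (pre_take su) (pre_take tu).
by rewrite -(take_takel u h); exact: take_pre.
Qed.

End prefixes.

Section true_stages.
Context {A : Type} {disp : Order.disp_t} {W : orderType disp}.
Hypothesis wfW : well_founded (fun x y : W => (x < y)%O).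
Variables (lv : nat -> W) (ch : nat -> nat -> nat) (base : nat -> seq A -> Prop).
Hypothesis base_mono : forall n s t, pre s t -> base n s -> base n t.
Implicit Types (s t u : seq A) (r : set (seq A)) (x y : W).

Definition emb t : set (seq A) := [set s | pre s t].

Definition is_chain r : Prop :=
  (forall s t, pre s t -> r t -> r s) /\
  (forall s t, r s -> r t -> size s <= size t -> pre s t).

Lemma emb_chain t : is_chain (emb t).
Proof.
split=> [s u su ut|s u su ut h]; first exact: pre_trans su ut.
exact: pre_total su ut h.
Qed.

Record stage_data := StageData {
  sdU : nat -> seq A -> Prop;
  sdle : seq A -> set (seq A) -> Prop;
  sdinj : seq A -> nat -> Prop }.

Definition safe_of (inj : seq A -> nat -> Prop) s k : Prop :=
  k < size s /\ forall n, inj s n -> k < n.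

(** Belief, truth, freshness, injury and the relation at level [x] are built in this order, each
    from lower levels and the preceding items, so one well-founded recursion yields them together.
    [sdinj] accumulates the fresh queries of all levels up to [x]. *)
Definition stage_step x (rec : forall y, (y < x)%O -> stage_data) : stage_data :=
  let tlt s r := r s /\ forall y (h : (y < x)%O), sdle (rec y h) s r in
  let bel n s := n < size s /\ (base n s \/
    exists m (h : (lv (ch n m) < x)%O),
      safe_of (sdinj (rec _ h)) s (ch n m) /\ ~ sdU (rec _ h) (ch n m) s) in
  let fresh n s := bel n s /\ forall s', s' <> s -> tlt s' (emb s) -> ~ bel n s' in
  let inj s n := (lv n = x /\ fresh n s) \/ exists y (h : (y < x)%O), sdinj (rec y h) s n in
  StageData bel
    (fun s r => tlt s r /\ forall u, tlt s (emb u) -> tlt u r ->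
       forall k, safe_of inj s k -> safe_of inj u k)
    inj.

Definition stage : W -> stage_data := Fix wfW (fun=> stage_data) stage_step.

Lemma stageE x : stage x = stage_step (fun y (_ : (y < x)%O) => stage y).
Proof.
rewrite /stage Fix_eq// => z f g fg; congr stage_step.
by apply: functional_extensionality_dep => y; apply: functional_extensionality_dep.
Qed.

(* Query [n] asks whether a branch lies in a Sigma^0_(lv n) set, the union over [m] of
   the complements of the sets of the queries [ch n m]; [base n s] says that [s] forces
   a positive answer to an open query. At the stage [s] the answer to a query may be
   believed to be positive ([bel]), and newly so ([fresh]) compared with the stages
   that look true at [s]; [s] protects the queries [k] with [safe x s k]. As in Dekker's
   true stages, [s] keeps looking true at level [x] along [r], the set of initial
   segments of a node or of a branch, until some query below one that it protects
   becomes fresh. *)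
Definition tle x s r : Prop := sdle (stage x) s r.
Definition tlt x s r : Prop := r s /\ forall y, (y < x)%O -> tle y s r.
Definition bel n s : Prop := sdU (stage (lv n)) n s.
Definition fresh n s : Prop := bel n s /\ forall s', s' <> s -> tlt (lv n) s' (emb s) -> ~ bel n s'.
Definition safe x s k : Prop :=
  k < size s /\ forall n, (lv n <= x)%O -> fresh n s -> k < n.

Lemma injE x s n : sdinj (stage x) s n <-> (lv n <= x)%O /\ fresh n s.
Proof.
elim/(well_founded_ind wfW): x => x IH; rewrite stageE /=; split.
  case=> [[nx]|[y [h /(IH _ h)[ny ?]]]]; last by split=> //; exact/ltW/(le_lt_trans ny).
  by rewrite /fresh /bel /tlt /tle nx lexx stageE.
case; rewrite le_eqVlt => /orP[/eqP e|lx] nw; last first.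
  by right; exists (lv n), lx; apply/(IH _ lx); rewrite lexx.
by left; split=> //; move: nw; rewrite /fresh /bel /tlt /tle e stageE.
Qed.

Lemma safeE x s k : safe_of (sdinj (stage x)) s k <-> safe x s k.
Proof.
rewrite /safe_of /safe; split=> -[-> h]; split=> // n.
  by move=> nx nn; apply: h; apply/injE.
by move=> /injE[]; exact: h.
Qed.

Lemma tleE x s r : tle x s r <-> tlt x s r /\
  forall u, tlt x s (emb u) -> tlt x u r -> forall k, safe x s k -> safe x u k.
Proof.
have e : tle x s r <-> tlt x s r /\ forall u, tlt x s (emb u) -> tlt x u r ->
    forall k, safe_of (sdinj (stage x)) s k -> safe_of (sdinj (stage x)) u k.
  by rewrite /tle stageE.
rewrite e; split=> -[? h]; split=> // u su ur k; first by move=> /safeE /h/safeE; exact.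
by move=> /safeE sk; apply/safeE; exact: h sk.
Qed.

Lemma belE n s : bel n s <-> n < size s /\ (base n s \/
  exists m, [/\ (lv (ch n m) < lv n)%O, safe (lv (ch n m)) s (ch n m) & ~ bel (ch n m) s]).
Proof.
rewrite /bel {1}stageE /=; split=> -[-> [?|[m h]]]; split=> //; try by left.
  by case: h => h [/safeE]; right; exists m.
by case: h => h /safeE ? ?; right; exists m, h.
Qed.

Lemma tlt_pre x s t : tlt x s (emb t) -> pre s t. Proof. by case. Qed.

Lemma tle_tlt x s r : tle x s r -> tlt x s r. Proof. by move=> /tleE[]. Qed.

Lemma tlt_refl x s : tlt x s (emb s).
Proof.
elim/(well_founded_ind wfW): x => x IH; split=> [|y yx]; first exact: pre_refl.
apply/tleE; split; first exact: IH.
move=> u su us; have -> // : u = s.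
by apply: pre_size_eq; [exact: tlt_pre us|exact: pre_size (tlt_pre su)].
Qed.

(** Restriction and transitivity are proved together, since each of them at level [x] uses both
    below [x]. *)
Let P12 x : (forall s t r, is_chain r -> tlt x s r -> tlt x t r -> pre s t -> tlt x s (emb t)) /\
  (forall s t r, is_chain r -> tlt x s (emb t) -> tlt x t r -> tlt x s r).
Proof.
elim/(well_founded_ind wfW): x => x IH; split=> s t r cr.
  move=> [rs sr] [rt tr] st; split=> // y yx; apply/tleE.
  have [P1 P2] := IH _ yx.
  have [sy sk] := (tleE y s r).1 (sr _ yx); have [ty _] := (tleE y t r).1 (tr _ yx).
  split; first exact: P1 cr sy ty st.
  by move=> u su ut; apply: sk => //; exact: P2 ut ty.
move=> [st sr] [rt tr]; split; first exact: cr.1 rt.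
move=> y yx; apply/tleE; have [P1 P2] := IH _ yx.
have [sy ssk] := (tleE y s _).1 (sr _ yx); have [ty tk] := (tleE y t r).1 (tr _ yx).
split; first exact: P2 sy ty.
move=> u su ur k kk; have [ut|/ltnW tu] := leqP (size u) (size t).
  by apply: (ssk u su) => //; apply: (P1 _ _ _ cr ur ty); exact: cr.2 ur.1 rt ut.
apply: (tk u) => //; first by apply: (P1 _ _ _ cr ty ur); exact: cr.2 rt ur.1 tu.
exact: ssk sy (tlt_refl _ _) _ kk.
Qed.

Lemma tlt_restrict x s t r : is_chain r -> tlt x s r -> tlt x t r -> pre s t -> tlt x s (emb t).
Proof. exact: (P12 x).1. Qed.

Lemma tlt_trans_emb x s t r : is_chain r -> tlt x s (emb t) -> tlt x t r -> tlt x s r.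
Proof. exact: (P12 x).2. Qed.

(** It is enough that [t] be true strictly below level [x]: a stage true below [t] is then true
    along [r], so the protection granted along [r] applies to it. *)
Lemma tle_restrict x s t r : is_chain r -> tle x s r -> tlt x t r -> pre s t -> tle x s (emb t).
Proof.
move=> cr /tleE[sr sk] tr st; apply/tleE; split; first exact: tlt_restrict cr sr tr st.
by move=> u su ut; apply: sk => //; exact: tlt_trans_emb cr ut tr.
Qed.

Lemma tle_trans_emb x s t r : is_chain r -> tle x s (emb t) -> tle x t r -> tle x s r.
Proof.
move=> cr /tleE[sr ssk] /tleE[tr tk]; apply/tleE; split; first exact: tlt_trans_emb cr sr tr.
move=> u su ur k kk; have [ut|/ltnW tu] := leqP (size u) (size t).
  apply: (ssk u su) => //; apply: (tlt_restrict cr ur tr).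
  exact: cr.2 ur.1 tr.1 ut.
apply: (tk u) => //; first by apply: (tlt_restrict cr tr ur); exact: cr.2 tr.1 ur.1 tu.
exact: ssk sr (tlt_refl _ _) _ kk.
Qed.

Lemma tle_nil x r : r [::] -> tle x [::] r.
Proof.
elim/(well_founded_ind wfW): x => x IH r0; apply/tleE; split; first by split=> // y /IH; exact.
by move=> u _ _ k [].
Qed.

Lemma tlt_anti x y s r : (y <= x)%O -> tlt x s r -> tlt y s r.
Proof. by move=> yx [rs h]; split=> // z zy; apply: h; exact: lt_le_trans yx. Qed.

Lemma safe_anti x y s k : (y <= x)%O -> safe x s k -> safe y s k.
Proof. by move=> yx [? h]; split=> // n ny; apply: h; exact: le_trans yx. Qed.

(* A query [c] that is not believed at [s] although [s] protects it cannot become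
   believed as long as [s] looks true: the first stage at which it would be
   believed injures [s]. *)
Let unbelieved_persists c (mono : forall s t, tlt (lv c) s (emb t) -> bel c s -> bel c t) s r u :
  is_chain r -> tle (lv c) s r -> safe (lv c) s c -> ~ bel c s ->
  tlt (lv c) u r -> pre s u -> ~ bel c u.
Proof.
move=> cr sr sc nU; have [k] := ubnP (size u); elim: k u => // k IH u uk ur su Uu.
have [sr0 hu] := (tleE _ _ _).1 sr; have {hu} hu := hu u.
have su0 : tlt (lv c) s (emb u) by exact: tlt_restrict cr sr0 ur su.
have [_ /(_ c (lexx _))] := hu su0 ur _ sc; rewrite ltnn => absurd.
suff : false by []. apply: absurd; split=> // s' s'u s's Us'.
have s'r := tlt_trans_emb cr s's ur.
have [|/ltnW] := leqP (size s) (size s') => ss'.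
  apply: (IH s') => //; last exact: cr.2 sr0.1 s'r.1 ss'.
  exact: leq_trans (pre_ltsize s's.1 s'u) _.
apply: nU; apply: (mono s') => //.
by apply: (tlt_restrict cr s'r sr0); exact: cr.2 s'r.1 sr0.1 ss'.
Qed.

(** A belief rests on [base], which is monotone, or on the disbelief of a protected query of lower
    level, which persists while the stage looks true at that level. *)
Let bel_mono_lv x : forall n s t, lv n = x -> tlt x s (emb t) -> bel n s -> bel n t.
Proof.
elim/(well_founded_ind wfW): x => x IH n s t nx st /belE[ns h]; apply/belE.
split; first exact: leq_trans ns (pre_size st.1).
case: h => [b|[m [mn sm nU]]]; first by left; exact: base_mono st.1 b.
right; exists m; split=> //; rewrite nx in mn.
  have /tleE[stm h] := st.2 _ mn.
  by apply: h sm => //; exact: tlt_refl.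
apply: (unbelieved_persists _ (emb_chain t) (st.2 _ mn) sm nU (tlt_refl _ _) st.1).
by move=> s' t'; exact: (IH _ mn).
Qed.

Lemma bel_mono n s t : tlt (lv n) s (emb t) -> bel n s -> bel n t.
Proof. exact: bel_mono_lv. Qed.

Lemma unbelieved_mono c s r u :
  is_chain r -> tle (lv c) s r -> safe (lv c) s c -> ~ bel c s ->
  tlt (lv c) u r -> pre s u -> ~ bel c u.
Proof. by apply: unbelieved_persists => ? ?; exact: bel_mono. Qed.

(* A stage is only injured at a level that is the level of a query it already knows. *)
Lemma injury_level x v r : is_chain r -> tlt x v r -> ~ tle x v r ->
  exists2 n, n < size v & lv n = x.
Proof.
move=> cr vr nle; apply: contrapT => no; apply: nle; apply/tleE; split=> // u vu ur k sk.
split=> [|n nx nw]; first exact: leq_trans sk.1 (pre_size vu.1).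
rewrite ltnNge; apply/negP => nk.
have nv : n < size v by exact: leq_ltn_trans nk sk.1.
have {}nx : (lv n < x)%O.
  by rewrite lt_neqAle nx andbT; apply/negP => /eqP e; apply: no; exists n.
have [_ h] := (tleE _ _ _).1 (vr.2 _ nx).
have := h u (tlt_anti (ltW nx) vu) (tlt_anti (ltW nx) ur) k (safe_anti (ltW nx) sk).
by case=> _ /(_ n (lexx _) nw); rewrite ltnNge nk.
Qed.

(** * Correctness of the guesses along a branch *)

Section branch.
Variables (B : set (nat -> A)) (C : nat -> set (nat -> A)).
Hypothesis base_sound : forall n a l, B a -> base n (mkseq a l) -> C n a.
Hypothesis ch_sound : forall n m a, B a -> (lv (ch n m) < lv n)%O -> ~ C (ch n m) a -> C n a.
Hypothesis complete : forall n a, B a -> C n a ->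
  (exists l, base n (mkseq a l)) \/ exists m, (lv (ch n m) < lv n)%O /\ ~ C (ch n m) a.
Variable a : nat -> A.
Hypothesis Ba : B a.

Definition segs : set (seq A) := [set s | s = mkseq a (size s)].

Lemma segs_mkseq l : segs (mkseq a l). Proof. by rewrite /segs /= size_mkseq. Qed.

Lemma take_mkseq k l : k <= l -> take k (mkseq a l) = mkseq a k.
Proof. by move=> kl; rewrite /mkseq -map_take take_iota (minn_idPl kl). Qed.

Lemma segs_chain : is_chain segs.
Proof.
split=> [s t st tt|s t ss tt st].
  rewrite /segs /= {1}(pre_take st) tt; set k := size s.
  by rewrite take_mkseq// /k pre_size.
by rewrite ss tt -(take_mkseq st); exact: take_pre.
Qed.

Local Notation tr x s := (tlt x s segs).

(** The earlier of two such stages looks true at the later one and believes [n] already, so [n] is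
    not fresh at the later one. *)
Lemma fresh_once n u u' : tr (lv n) u -> tr (lv n) u' -> fresh n u -> fresh n u' -> u = u'.
Proof.
wlog uu' : u u' / size u <= size u'.
  by move=> wl tu tu' nu nu'; have [h|/ltnW h] := leqP (size u) (size u');
    [exact: wl|apply/esym/wl].
move=> tu tu' nu nu'; apply: contrapT => ne; apply: (nu'.2 _ ne) nu.1.
by apply: (tlt_restrict segs_chain tu tu'); exact: segs_chain.2 tu.1 tu'.1 uu'.
Qed.

(** Among the stages beyond [L] having a fresh query of level below [x], take one whose fresh query
    has least index: a later injury would need a query of smaller index. If there is no such stage,
    the segment of length [L] itself is never injured. *)
Lemma infinitely_many_true x L : exists s, L <= size s /\ tr x s.
Proof.
pose E n := `[< exists u, [/\ L <= size u, (lv n < x)%O, tr (lv n) u & fresh n u] >].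
have [exE|noE] := pselect (exists n, E n); last first.
  exists (mkseq a L); rewrite size_mkseq; split=> //; split; first exact: segs_mkseq.
  elim/(well_founded_ind wfW) => y IH yx; apply/tleE; split.
    by split=> [|z zy]; [exact: segs_mkseq|apply: (IH _ zy); exact: lt_trans zy yx].
  move=> u su ur k sk; split; first exact: leq_trans sk.1 (pre_size su.1).
  move=> n ny nw; exfalso; apply: noE; exists n; apply/asboolP; exists u; split=> //.
  - by have := pre_size su.1; rewrite size_mkseq.
  - by apply: le_lt_trans yx.
  - by apply: tlt_anti ur.
case: (ex_minnP exE) => n /asboolP[u [Lu nx un nw]] min; exists u; split=> //.
split; first exact: un.1.
elim/(well_founded_ind wfW) => y IH yx; apply/tleE; split.
  by split=> [|z zy]; [exact: un.1|apply: (IH _ zy); exact: lt_trans zy yx].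
have [ny|yn] := leP (lv n) y; last by move=> v; have /tleE[_] := un.2 _ yn; exact.
move=> v uv vr k sk; split; first exact: leq_trans sk.1 (pre_size uv.1).
move=> n' n'y nw'; apply: leq_trans (sk.2 _ ny nw) (min _ _); apply/asboolP; exists v.
split=> //.
- exact: leq_trans (pre_size uv.1).
- by apply: le_lt_trans yx.
- by apply: tlt_anti vr.
Qed.

Lemma eventually_not_fresh c : exists L, forall s n, L <= size s -> n <= c ->
  tr (lv n) s -> ~ fresh n s.
Proof.
elim: c.+1 {-2}c (ltnSn c) => // c' IH {}c cc.
have [L hL] : exists L, forall s n, L <= size s -> n < c -> tr (lv n) s -> ~ fresh n s.
  case: c cc => [|c] cc; first by exists 0.
  by have [L hL] := IH c cc; exists L.
have [[u [tu nu]]|no] := pselect (exists u, tr (lv c) u /\ fresh c u); last first.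
  exists L => s n Ls; rewrite leq_eqVlt => /orP[/eqP ->|nc]; last exact: hL.
  by move=> ts ns; apply: no; exists s.
exists (maxn L (size u).+1) => s n; rewrite geq_max => /andP[Ls us].
rewrite leq_eqVlt => /orP[/eqP ->|nc]; last exact: hL.
by move=> ts ns; move: us; rewrite (fresh_once tu ts nu ns) ltnn.
Qed.

(** Protection makes negative guesses reliable: if a protected and disbelieved query were correct,
    it would be believed at a later true stage, against [unbelieved_mono]. Conversely every query is
    protected at all sufficiently late true stages, because each smaller one is fresh at most
    once. *)
Lemma query_correct n : (forall s, tr (lv n) s -> bel n s -> C n a) /\
  (C n a -> exists L, forall s, L <= size s -> tr (lv n) s -> bel n s).
Proof.
move: {2}(lv n) (erefl (lv n)) => x; elim/(well_founded_ind wfW): x n => x IH n nx.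
split=> [s ts /belE[ns [b|[m [mn sm nU]]]]|].
- by move: b; rewrite ts.1; exact: base_sound.
- apply: (ch_sound Ba mn) => Cm; rewrite nx in mn.
  have [_ /(_ Cm)[L hL]] := IH _ mn _ erefl.
  have [u [Lu tu]] := infinitely_many_true (lv (ch n m)) (maxn L (size s)).
  move: Lu; rewrite geq_max => /andP[Lu su]; have ts' := ts.2; rewrite nx in ts'.
  apply: (unbelieved_mono segs_chain (ts' _ mn) sm nU tu); last exact: hL.
  exact: segs_chain.2 ts.1 tu.1 su.
move=> /(complete Ba)[[l bl]|[m [mn nCm]]].
  exists (maxn n.+1 l) => s; rewrite geq_max => /andP[ns ls] ts; apply/belE; split=> //.
  left; apply: base_mono bl; rewrite ts.1 -(take_mkseq ls); exact: take_pre.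
rewrite nx in mn; have [h _] := IH _ mn _ erefl.
have [L hL] := eventually_not_fresh (ch n m).
exists (maxn (maxn n.+1 (ch n m).+1) L) => s; rewrite !geq_max => /andP[/andP[ns cs] Ls] ts.
apply/belE; split=> //; right; exists m; rewrite -nx in mn; split=> //.
  split=> // k km nk; rewrite ltnNge; apply/negP => kc; apply: hL nk => //.
  by apply: tlt_anti ts; exact/ltW/(le_lt_trans km).
by move=> Um; apply: nCm; apply: h Um; exact: tlt_anti (ltW mn) ts.
Qed.

End branch.
End true_stages.

(** * Sigma-ideals and potential classes *)

Section sigma_ideals.
Context {P : Type}.
Implicit Types (I J : set (set P)) (A B E : set P).

Record sideal I : Prop := SIdeal {
  sideal0 : I set0;
  sideal_sub : forall A B, A `<=` B -> I B -> I A;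
  sideal_bigcup : forall F : nat -> set P, (forall n, I (F n)) -> I (\bigcup_n F n) }.

Definition avoid A : set (set P) := [set E | E `<=` ~` A].

Definition ijoin I J : set (set P) := [set E | exists A B, [/\ I A, J B & E `<=` A `|` B]].

Definition iclose (S I : set (set P)) : set (set P) :=
  [set E | exists C, [/\ S C, I C & E `<=` C]].

Lemma sidealU I A B : sideal I -> I A -> I B -> I (A `|` B).
Proof.
move=> sI IA IB; apply: (sideal_sub sI) (sideal_bigcup sI (F := fun n => if n is 0 then A else B) _).
  by move=> x [Ax|Bx]; [exists 0|exists 1].
by case.
Qed.

Lemma sideal_avoid A : sideal (avoid A).
Proof. by split=> [x []|B C BC h x /BC /h|F h x [n _ /h]]. Qed.

Lemma sideal_join I J : sideal I -> sideal J -> sideal (ijoin I J).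
Proof.
move=> sI sJ; split.
- by exists set0, set0; split; [exact: sideal0|exact: sideal0|].
- by move=> A B AB [C [D [? ? h]]]; exists C, D; split=> //; exact: subset_trans h.
- move=> F /(_ _)/cid h; pose C n := projT1 (h n).
  have /(_ _)/cid h2 n := projT2 (h n); pose D n := projT1 (h2 n).
  have hD n : [/\ I (C n), J (D n) & F n `<=` C n `|` D n] := projT2 (h2 n).
  exists (\bigcup_n C n), (\bigcup_n D n); split.
  + by apply: sideal_bigcup => // n; have [] := hD n.
  + by apply: sideal_bigcup => // n; have [] := hD n.
  + by move=> x [n _ Fx]; have [_ _ /(_ _ Fx) h'] := hD n; case: h' => ?; [left|right]; exists n.
Qed.

Lemma ijoinl I J : sideal J -> I `<=` ijoin I J.
Proof. by move=> sJ A IA; exists A, set0; split; [by []|exact: sideal0|by left]. Qed.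

Lemma ijoinr I J : sideal I -> J `<=` ijoin I J.
Proof. by move=> sI A JA; exists set0, A; split; [exact: sideal0|by []|by right]. Qed.

Lemma sideal_iclose (S I : set (set P)) : sideal I -> S set0 ->
  (forall F : nat -> set P, (forall n, S (F n)) -> S (\bigcup_n F n)) -> sideal (iclose S I).
Proof.
move=> sI S0 SU; split.
- by exists set0; split=> //; exact: sideal0.
- by move=> A B AB [C [? ? h]]; exists C; split=> //; exact: subset_trans h.
- move=> F /(_ _)/cid h; pose C n := projT1 (h n).
  have hC n : [/\ S (C n), I (C n) & F n `<=` C n] := projT2 (h n).
  exists (\bigcup_n C n); split.
  + by apply: SU => n; have [] := hC n.
  + by apply: sideal_bigcup => // n; have [] := hC n.
  + by move=> x [n _ Fx]; have [_ _ /(_ _ Fx)] := hC n; exists n.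
Qed.

Lemma iclose_sub (S I : set (set P)) : sideal I -> iclose S I `<=` I.
Proof. by move=> sI E [C [_ IC EC]]; exact: sideal_sub IC. Qed.

(** Joining [I] with the sets missing [V n] is improper only if [V n] is in [I], and not all [V n]
    can be. This is the way an ideal gets concentrated on a piece of a Souslin scheme or on a set of
    small diameter. *)
Lemma sideal_split I (V : nat -> set P) : sideal I -> ~ I setT -> I (~` \bigcup_n V n) ->
  exists n, ~ ijoin I [set E | E `<=` ~` V n] setT.
Proof.
move=> sI pI IV; apply: contrapT => no; apply: pI.
have h n : I (V n).
  apply: contrapT => nV; apply: no; exists n => -[A [B [IA BV h]]]; apply: nV.
  by apply: (sideal_sub sI) IA => x Vx; have [//|/BV] := h x Logic.I.
apply: (sideal_sub sI) (sidealU sI IV (sideal_bigcup sI h)) => x _.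
by have [|] := pselect ((\bigcup_n V n) x); [right|left].
Qed.

End sigma_ideals.

(** * The potential Borel hierarchy *)

Section potential_classes.
Context {I : Type} {X : I -> Type} (bor : forall i, set (set (X i))).
Hypothesis borC : forall i (D : set (X i)), bor D -> bor (~` D).
Hypothesis borU : forall i (F : nat -> set (X i)), (forall n, bor (F n)) -> bor (\bigcup_n F n).
Hypothesis bor0 : forall i, bor (set0 : set (X i)).
Local Notation P := (forall i, X i).

Definition cyl i (D : set (X i)) : set P := [set x | D (x i)].

Inductive box_algebra : set P -> Prop :=
| box_cyl i (D : set (X i)) : bor D -> box_algebra (cyl D)
| box_setC C : box_algebra C -> box_algebra (~` C)
| box_setU C D : box_algebra C -> box_algebra D -> box_algebra (C `|` D)
| box_set0 : box_algebra set0.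

Context {disp : Order.disp_t} {W : orderType disp}.
Hypothesis wfW : well_founded (fun x y : W => (x < y)%O).
Implicit Types x y : W.

(* The sets of [pS x] are the potentially Sigma^0_x ones: level 0 consists of
   the finite combinations of Borel cylinders. *)
Inductive pS : W -> set P -> Prop :=
| pS_box x C : (forall y, ~ (y < x)%O) -> box_algebra C -> pS x C
| pS_bigcup x (eta : nat -> W) (F : nat -> set P) : (forall n, (eta n < x)%O) ->
    (forall n, pS (eta n) (~` F n)) -> pS x (\bigcup_n F n).

Lemma pS_inv x C : pS x C ->
  ((forall y, ~ (y < x)%O) /\ box_algebra C) \/
  exists (eta : nat -> W) (F : nat -> set P), [/\ C = \bigcup_n F n,
    forall n, (eta n < x)%O & forall n, pS (eta n) (~` F n)].
Proof. by case=> [y D ? ?|y eta F ? ?]; [left|right; exists eta, F]. Qed.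

Lemma pS_setC x y C : (x < y)%O -> pS x C -> pS y (~` C).
Proof.
move=> xy SC; rewrite (_ : ~` C = \bigcup_(n in [set: nat]) ~` C); last first.
  by rewrite bigcup_const//; exists 0.
by apply: (pS_bigcup (eta := fun=> x)) => // n; rewrite setCK.
Qed.

Lemma pS_le x y C : (x <= y)%O -> pS x C -> pS y C.
Proof.
rewrite le_eqVlt => /orP[/eqP-> //|xy] /pS_inv[[x0 bC]|[eta [F [-> h1 h2]]]].
  by rewrite -[C]setCK; apply: (pS_setC xy); apply: pS_box => //; exact: box_setC.
by apply: pS_bigcup h2 => n; exact: lt_trans xy.
Qed.

Lemma pS_bigcup_same x (F : nat -> set P) : (exists y, (y < x)%O) ->
  (forall n, pS x (F n)) -> pS x (\bigcup_n F n).
Proof.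
move=> [y yx] h.
have /(_ _)/cid h2 n : exists g : (nat -> W) * (nat -> set P),
    [/\ F n = \bigcup_m g.2 m, forall m, (g.1 m < x)%O & forall m, pS (g.1 m) (~` g.2 m)].
  have [[/(_ y)//]|[eta [G [? ? ?]]]] := pS_inv (h n); by exists (eta, G).
pose G n := projT1 (h2 n).
have hG n : [/\ F n = \bigcup_m (G n).2 m, forall m, ((G n).1 m < x)%O &
    forall m, pS ((G n).1 m) (~` (G n).2 m)] := projT2 (h2 n).
pose dec k : nat * nat := odflt (0, 0) (unpickle k).
rewrite (_ : \bigcup_n F n = \bigcup_k (G (dec k).1).2 (dec k).2); last first.
  apply/seteqP; split=> z.
    move=> [n _]; have [-> _ _] := hG n; move=> [m _ Gz].
    by exists (pickle (n, m)) => //; rewrite /dec pickleK.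
  by move=> [k _ Gz]; exists (dec k).1 => //; have [-> _ _] := hG (dec k).1; exists (dec k).2.
apply: (pS_bigcup (eta := fun k => (G (dec k).1).1 (dec k).2)) => k.
  by have [_ h' _] := hG (dec k).1.
by have [_ _ h'] := hG (dec k).1.
Qed.

Lemma pS_setU x C D : pS x C -> pS x D -> pS x (C `|` D).
Proof.
move=> SC SD; have [[y yx]|no] := pselect (exists y, (y < x)%O).
  rewrite (_ : C `|` D = \bigcup_n (if n is 0 then C else D)); last first.
    apply/seteqP; split=> z; first by case=> ?; [exists 0|exists 1].
    by move=> [[|n] _ ?]; [left|right].
  by apply: pS_bigcup_same; [exists y|case].
have no' y : ~ (y < x)%O by move=> yx; apply: no; exists y.
apply: pS_box => //; apply: box_setU.
  by have [[]|[eta [F [_ /(_ 0)/no']]]] := pS_inv SC.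
by have [[]|[eta [F [_ /(_ 0)/no']]]] := pS_inv SD.
Qed.

Lemma pS_set0 x : pS x set0.
Proof.
elim/(well_founded_ind wfW): x => x IH; have [[y yx]|no] := pselect (exists y, (y < x)%O).
  exact: pS_le (ltW yx) (IH _ yx).
by apply: pS_box; [move=> y yx; apply: no; exists y|exact: box_set0].
Qed.

Lemma pS_setI x C D : pS x C -> pS x D -> pS x (C `&` D).
Proof.
move=> /pS_inv[[x0 bC]|[eta [F [-> h1 h2]]]] /pS_inv[[x0' bD]|[ta [G [-> g1 g2]]]].
- apply: pS_box => //; rewrite -[C]setCK -[D]setCK -setCU.
  by apply: box_setC; apply: box_setU; exact: box_setC.
- by case: (x0 _ (g1 0)).
- by case: (x0' _ (h1 0)).
rewrite setI_bigcupl; apply: pS_bigcup_same => [|n]; first by exists (eta 0).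
rewrite setI_bigcupr; pose z m := Order.max (eta n) (ta m).
apply: (pS_bigcup (eta := z)) => m; first by rewrite /z gt_max h1 g1.
by rewrite setCI; apply: pS_setU; [apply: pS_le (h2 n)|apply: pS_le (g2 m)];
  rewrite /z le_max lexx ?orbT.
Qed.

Lemma pS_setI_n x (F : nat -> set P) n : (exists y, (y < x)%O) ->
  (forall m, pS x (F m)) -> pS x [set z | forall m, m < n -> F m z].
Proof.
move=> [y yx] h; elim: n => [|n IH].
  rewrite (_ : [set _ | _] = ~` set0); first exact: pS_setC yx (pS_set0 _).
  by apply/seteqP; split=> // z _ m.
rewrite (_ : [set _ | _] = [set z | forall m, m < n -> F m z] `&` F n); first exact: pS_setI.
apply/seteqP; split=> z /=; first by move=> h'; split=> [m mn|]; apply: h' => //; exact: ltnW.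
by move=> [h1 h2] m; rewrite ltnS leq_eqVlt => /orP[/eqP->|/h1].
Qed.

(** The reduction argument: a point goes to the side whose enumeration catches it first, ties going
    to [C]. Both parts are Sigma^0_x and they partition the space, so each is potentially
    Delta^0_x. *)
Lemma pS_reduction x C D : (exists y, (y < x)%O) -> pS x C -> pS x D -> C `|` D = setT ->
  exists E, [/\ pS x E, pS x (~` E), ~` D `<=` E & E `<=` C].
Proof.
move=> [y yx] /pS_inv[[/(_ y)//]|[eta [F [-> h1 h2]]]] /pS_inv[[/(_ y)//]|[ta [G [-> g1 g2]]]] CD.
pose E0 := \bigcup_n (F n `&` [set z | forall m, m < n -> (~` G m) z]).
pose E1 := \bigcup_n (G n `&` [set z | forall m, m < n.+1 -> (~` F m) z]).
have E01 : ~` E0 = E1.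
  apply/seteqP; split=> z.
    move=> nE0; have exQ : exists n, `[< F n z \/ G n z >].
      have : (\bigcup_n F n `|` \bigcup_n G n) z by rewrite CD.
      by move=> [[n _ ?]|[n _ ?]]; exists n; apply/asboolP; [left|right].
    case: (ex_minnP exQ) => n /asboolP nz min.
    have mn m : m < n -> ~ F m z /\ ~ G m z.
      by move=> mn; split=> ?; have := min m; rewrite leqNgt mn => /(_ _)/negP h;
        apply: h => //; apply/asboolP; [left|right].
    have nF : ~ F n z by move=> Fz; apply: nE0; exists n => //; split=> // m /mn[].
    case: nz => // Gz; exists n => //; split=> // m.
    by rewrite ltnS leq_eqVlt => /orP[/eqP->//|/mn[]].
  move=> [n _ [Gn nF]] [m _ [Fm nG]].
  by have [nm|mn] := ltnP n m; [exact: nG nm Gn|exact: nF mn Fm].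
have yE : exists y, (y < x)%O by exists y.
have SF n : pS x (F n) by rewrite -[F n]setCK; exact: pS_setC (h1 n) (h2 n).
have SG n : pS x (G n) by rewrite -[G n]setCK; exact: pS_setC (g1 n) (g2 n).
have SF' n : pS x (~` F n) by exact: pS_le (ltW (h1 n)) (h2 n).
have SG' n : pS x (~` G n) by exact: pS_le (ltW (g1 n)) (g2 n).
exists E0; split.
- by apply: pS_bigcup_same => // n; apply: pS_setI => //; exact: pS_setI_n.
- by rewrite E01; apply: pS_bigcup_same => // n; apply: pS_setI => //; exact: pS_setI_n.
- rewrite -[E0]setCK E01; apply: subsetC => z [n _ [Gz _]].
  by exists n.
- by move=> z [n _ [Fz _]]; exists n.
Qed.

Lemma sideal_cl x (J : set (set P)) : (exists y, (y < x)%O) -> sideal J -> sideal (iclose (pS x) J).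
Proof.
by move=> xg sJ; apply: sideal_iclose => //; [exact: pS_set0|move=> F; exact: pS_bigcup_same].
Qed.

(* The step that moves a point of the closure of [J0] into [J0] itself. *)
Lemma swap_proper x y (J0 J : set (set P)) H E : (x < y)%O -> sideal J0 -> sideal J ->
  iclose (pS y) J0 `<=` J -> pS x H -> J H -> J0 E -> E `|` H = setT -> J setT.
Proof.
move=> xy s0 s clJ SH JH J0E EH; rewrite -(setUv H).
apply: sidealU => //; apply: clJ; exists (~` H); split=> //; first exact: pS_setC xy SH.
apply: (sideal_sub s0) J0E => z nH; have : (E `|` H) z by rewrite EH.
by case.
Qed.

End potential_classes.

(** * Acyclic levels *)

Section acyclic.
Context {I : Type} {K : choiceType} (L : set (I -> K)).
Hypothesis oneL : one_sided L.
Hypothesis acL : almost_acyclic L.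
Local Notation V := (I -> K).
Implicit Types (u v w : V) (x : nat -> V) (D : set V).

Record simple_path D n x : Prop := SimplePath {
  sp_in : forall m, m <= n -> D (x m);
  sp_inj : forall m k, m <= n -> k <= n -> x m = x k -> m = k;
  sp_edge : forall m, m < n -> edge L (x m) (x m.+1) }.

Lemma path_cycle D n x w i j : simple_path D n x -> D `<=` L -> ~ D w -> L w -> 0 < n ->
  x 0 i = w i -> x n j = w j ->
  is_cycle L n.+2 (fun m => if m is m'.+1 then if m' <= n then x m' else w else w).
Proof.
move=> [xD xi xe] DL Dw Lw n0 xi0 xjn; split=> //.
- by rewrite ltnn.
- case=> [|m] [|k]; rewrite ?ltnS//.
  + by move=> _ kn; rewrite kn => e; case: Dw; rewrite e; exact: xD.
  + by move=> mn _; rewrite mn => e; case: Dw; rewrite -e; exact: xD.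
  + by move=> mn kn; rewrite mn kn => /xi ->.
- case=> [_ /=|m mn].
    split=> //; [exact/DL/xD| |by exists i].
    by move=> e; case: Dw; rewrite e; exact: xD.
  rewrite !ltnS in mn; rewrite mn; case: ltnP => mn'; first exact: xe.
  have -> : m = n by lia.
  split=> //; [exact/DL/xD| |by exists j].
  by move=> e; case: Dw; rewrite -e; exact: xD.
Qed.

(** Closing the path through [w] gives a cycle, and the coordinate that almost acyclicity finds
    three times on it allows an induction on the length of the path. *)
Lemma path_unique_coord D n x w i j : D `<=` L -> ~ D w -> L w -> simple_path D n x ->
  x 0 i = w i -> x n j = w j -> i = j.
Proof.
move=> DL Dw Lw; have [N] := ubnP n; elim: N n x i j => // N IH n x i j nN px xi xj.
have [n0|n0] := posnP n.
  subst n; have ne : w <> x 0 by move=> e; case: Dw; rewrite e; exact: (sp_in px).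
  by apply: (oneL Lw (DL _ (sp_in px (leqnn 0))) ne).
(* The cycle starts at [w], so its index 0 is [w] and its index a+1 is [x a]; the case distinctions
   below undo this shift. *)
have [h [k [m [l [km ml lL ekm eml]]]]] := acL (path_cycle px DL Dw Lw n0 xi xj).
have [xD xinj xe] := px.
case: m km ml ekm eml => // m km; case: l lL => // l; rewrite !ltnS => ln ml.
have mn : m <= n by lia.
rewrite mn ln; case: k km => [_ ekm eml|k km].
  (* Here [w] is one of the three vertices. The pieces from [x 0] to [x m] and from [x l] to [x n]
     are both strictly shorter, which is what having a third vertex provides. *)
  have -> : i = h.
    apply: (IH m x) => //; [by lia|split=> [a an|a b an bn|a an]].
    - by apply: xD; lia.
    - by apply: xinj; lia.
    - by apply: xe; lia.
  apply: (IH (n - l) (fun a => x (a + l))) => //; rewrite ?add0n ?subnK//; first by lia.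
  - split=> [a an|a b an bn|a an].
    + by apply: xD; lia.
    + by move/xinj => e; have := e; lia.
    + by rewrite addSn; apply: xe; lia.
  - by rewrite -eml -ekm.
have -> : k <= n by lia.
move=> ekm eml.
(* [x k] and [x l] are adjacent through [h], so the vertices strictly between them are cut out;
   [x m] is among them, so the path becomes shorter. *)
apply: (IH (n - (l - k.+1)) (fun a => if a <= k then x a else x (a + (l - k.+1)))) => //.
- by lia.
- split=> [a an|a b an bn|a an].
  + by case: ifP => ak; apply: xD; lia.
  + by case: ifP => ak; case: ifP => bk /xinj e; have := e; lia.
  + have [ak|ak] := leqP a k; last by rewrite ifF; [rewrite addSn; apply: xe; lia|lia].
    case: ltnP => ak'; first by apply: xe; lia.
    have e1 : a = k by lia.
    have -> : a.+1 + (l - k.+1) = l by lia.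
    rewrite e1; split; [by apply/DL/xD; lia|by apply/DL/xD; lia| |].
    * by move=> /xinj e; have := e; lia.
    * by exists h; rewrite ekm.
- rewrite ifF; last by lia.
  by have -> : n - (l - k.+1) + (l - k.+1) = n by lia.
Qed.

Definition path_connected D : Prop := forall u v, D u -> D v ->
  exists n x, [/\ simple_path D n x, x 0 = u & x n = v].

Lemma path_connected1 u : path_connected [set u].
Proof.
by move=> v w -> ->; exists 0, (fun=> u); split=> //; split=> // m k; rewrite !leqn0 => /eqP-> /eqP->.
Qed.

Lemma edge_sym u v : edge L u v -> edge L v u.
Proof. by move=> [Lu Lv uv [i e]]; split=> //; [exact/nesym|exists i]. Qed.

Lemma simple_pathS D D' n x : D `<=` D' -> simple_path D n x -> simple_path D' n x.
Proof. by move=> DD [h1 h2 h3]; split=> // m mn; exact/DD/h1. Qed.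

Lemma simple_path_rev D n x : simple_path D n x -> simple_path D n (fun m => x (n - m)).
Proof.
move=> [h1 h2 h3]; split=> [m mn|m k mn kn|m mn]; first by apply: h1; lia.
- by move/h2 => e; have := e; lia.
- have -> : n - m = (n - m.+1).+1 by lia.
  by apply/edge_sym/h3; lia.
Qed.

Lemma path_connectedU1 D u w : path_connected D -> D u -> ~ D w -> edge L w u ->
  path_connected (w |` D).
Proof.
move=> cD Du Dw wu.
have from_w v : D v -> exists n x, [/\ simple_path (w |` D) n x, x 0 = w & x n = v].
  move=> Dv; have [n [x [px x0 xn]]] := cD u v Du Dv.
  exists n.+1, (fun m => if m is m'.+1 then x m' else w); split=> //.
  have [h1 h2 h3] := px; split=> [[|m] mn|[|m] [|k] mn kn|[|m] mn] //.
  - by left.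
  - by right; exact: h1.
  - by move=> e; case: Dw; rewrite e; exact: h1.
  - by move=> e; case: Dw; rewrite -e; exact: h1.
  - by move/h2 => ->.
  - by rewrite x0.
  - exact: h3.
move=> v v' [->|Dv] [->|Dv'].
- exists 0, (fun=> w); split=> //; split=> // [m _|m k]; first by left.
  by rewrite !leqn0 => /eqP-> /eqP->.
- exact: from_w.
- have [n [x [px x0 xn]]] := from_w v Dv; exists n, (fun m => x (n - m)).
  by rewrite subn0 subnn; split=> //; exact: simple_path_rev.
- have [n [x [px x0 xn]]] := cD v v' Dv Dv'; exists n, x; split=> //.
  by apply: simple_pathS px => z; right.
Qed.

Lemma connected_unique_coord D u v w i j : D `<=` L -> path_connected D -> D u -> D v ->
  ~ D w -> L w -> u i = w i -> v j = w j -> i = j.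
Proof.
move=> DL cD Du Dv Dw Lw; have [n [x [px <- <-]]] := cD u v Du Dv.
exact: path_unique_coord px.
Qed.

(** * Amalgamating ideals along an acyclic level *)

Section propagation.
Context {X : I -> Type} (bor : forall i, set (set (X i))).
Hypothesis borC : forall i (D : set (X i)), bor D -> bor (~` D).
Hypothesis borU : forall i (F : nat -> set (X i)), (forall n, bor (F n)) -> bor (\bigcup_n F n).
Hypothesis bor0 : forall i, bor (set0 : set (X i)).
Local Notation P := (forall i, X i).
Implicit Types (J : V -> set (set P)) (M : set (set P)).

Definition calibrated D J : Prop := forall u v, D u -> D v -> forall i, u i = v i ->
  forall B : set (X i), bor B -> J u (cyl B) -> J v (cyl B).

Definition marginal i M : set (set P) :=
  [set E | exists B : set (X i), [/\ bor B, M (cyl B) & E `<=` cyl B]].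

Lemma sideal_marginal i M : sideal M -> sideal (marginal i M).
Proof.
move=> sM; split.
- by exists set0; split=> //; exact: sideal0.
- by move=> A B AB [C [? ? h]]; exists C; split=> //; exact: subset_trans h.
- move=> F /(_ _)/cid h; pose C n := projT1 (h n).
  have hC n : [/\ bor (C n), M (cyl (C n)) & F n `<=` cyl (C n)] := projT2 (h n).
  exists (\bigcup_n C n); split.
  + by apply: borU => n; have [] := hC n.
  + apply: (sideal_sub sM) (sideal_bigcup sM (F := fun n => cyl (C n)) _).
      by move=> z [n _ ?]; exists n.
    by move=> n; have [] := hC n.
  + by move=> x [n _ Fx]; have [_ _ /(_ _ Fx) ?] := hC n; exists n.
Qed.

(** If a cylinder over [B] is covered by a set of [M] and a cylinder over [C] small for [N], then
    the cylinder over the Borel set [B] minus [C] is in [M], hence in [N]. So joining with the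
    marginal of [N] makes the two marginals equal without making anything improper. *)
Lemma ijoin_marginal_cyl i M N (B : set (X i)) : sideal M -> sideal N ->
  (forall C : set (X i), bor C -> M (cyl C) -> N (cyl C)) -> bor B ->
  ijoin M (marginal i N) (cyl B) -> N (cyl B).
Proof.
move=> sM sN MN bB [E [F [ME [C [bC NC FC]] BEF]]].
have bBC : bor (B `\` C).
  rewrite setDE -[B]setCK -setCU; apply: borC.
  rewrite (_ : _ `|` _ = \bigcup_n (if n is 0 then ~` B else C)); last first.
    apply/seteqP; split=> z; first by case=> ?; [exists 0|exists 1].
    by move=> [[|n] _ ?]; [left|right].
  by apply: borU => -[]//; exact: borC.
have : N (cyl (B `\` C)).
  apply: MN => //; apply: (sideal_sub sM) ME => z [Bz nCz].
  by have [//|/FC] := BEF z Bz.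
move=> h; apply: (sideal_sub sN) (sidealU sN h NC) => z Bz.
by have [|] := pselect (C (z i)); [right|left].
Qed.

(** A connected set [D] of updated nodes grows from [v0], one adjacent node at a time. The invariant
    is that a node outside [D] has no small cylinder, on a coordinate shared with a node of [D],
    that is not small there as well. When no neighbour is left, nothing links [D] to the untouched
    nodes. *)
Lemma propagate J v0 M : finite_set L -> L v0 ->
  (forall v, L v -> sideal (J v) /\ ~ J v setT) -> calibrated L J ->
  sideal M -> ~ M setT ->
  (forall v i, L v -> v0 <> v -> v i = v0 i -> forall B : set (X i), bor B -> J v0 (cyl B) -> M (cyl B)) ->
  exists J', [/\ J' v0 = M, forall v, L v -> sideal (J' v) /\ ~ J' v setT, calibrated L J' &
    forall v, v <> v0 -> J v `<=` J' v].
Proof.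
move=> finL Lv0 hJ cJ sM pM MJ.
have [enumL LE] := (finite_seqP L).1 finL.
suff main N D J1 : count (fun v => `[< ~ D v >]) enumL < N -> D `<=` L -> D v0 -> path_connected D ->
    J1 v0 = M -> (forall v, L v -> sideal (J1 v) /\ ~ J1 v setT) -> calibrated D J1 ->
    (forall v, v <> v0 -> J v `<=` J1 v) -> (forall v, ~ D v -> J1 v = J v) ->
    (forall u w i, D u -> L w -> ~ D w -> u i = w i ->
      forall B : set (X i), bor B -> J w (cyl B) -> J1 u (cyl B)) ->
    exists J', [/\ J' v0 = M, forall v, L v -> sideal (J' v) /\ ~ J' v setT, calibrated L J' &
      forall v, v <> v0 -> J v `<=` J' v].
  apply: (main _ [set v0] (fun v => if pselect (v = v0) then M else J v) (ltnSn _)) => //.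
  - by move=> v ->.
  - exact: path_connected1.
  - by case: pselect.
  - by move=> v Lv; case: pselect => vv0; [split|exact: hJ].
  - by move=> u v -> ->.
  - by move=> v vv0; case: pselect => [//|?]; exact: subset_refl.
  - by move=> v vv0; case: pselect.
  - move=> u w i -> Lw wv0 e B bB Jw; case: pselect => // ?.
    have v0w : v0 <> w by move=> v0w; apply: wv0.
    exact: (MJ w i Lw v0w (esym e) B bB (cJ w v0 Lw Lv0 i (esym e) B bB Jw)).
elim: N D J1 => // N IH D J1 cD DL Dv0 conD J1v0 J1s calD JJ1 J1out J1ge.
have [[u [w [i [Du Lw nDw uw]]]]|no] := pselect (exists u w i, [/\ D u, L w, ~ D w & u i = w i]); last first.
  exists J1; split=> // u v Lu Lv i uv B bB.
  have [Du|nDu] := pselect (D u); have [Dv|nDv] := pselect (D v).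
  - exact: calD.
  - by exfalso; apply: no; exists u, v, i.
  - by exfalso; apply: no; exists v, u, i.
  - by rewrite !J1out//; exact: cJ.
have [su pu] := J1s u (DL _ Du); have [sw pw] := hJ w Lw.
(* The least enlargement of the ideal of [w] that agrees with [u] on the shared coordinate. It is
   proper because the whole space is a cylinder, and not a small one for [u]. *)
pose Mw := ijoin (J w) (marginal i (J1 u)).
have sMw : sideal Mw by apply: sideal_join => //; exact: sideal_marginal.
have wproj (B : set (X i)) : bor B -> Mw (cyl B) <-> J1 u (cyl B).
  move=> bB; split; last by move=> h; apply: ijoinr => //; exists B; split.
  by apply: ijoin_marginal_cyl => // C bC; exact: J1ge.
have bT : bor (setT : set (X i)) by rewrite -setC0; exact: borC.
have pMw : ~ Mw setT.
  by rewrite (_ : setT = cyl (setT : set (X i)))// => /(wproj _ bT).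
have v0w : v0 <> w by move=> e; apply: nDw; rewrite -e.
have wuE : edge L w u.
  split=> //; [exact: DL| |by exists i].
  by move=> e; apply: nDw; rewrite e.
apply: (IH (w |` D) (fun v => if pselect (v = w) then Mw else J1 v)) => //.
- rewrite ltnS in cD; apply: leq_trans cD.
  have wL : w \in enumL by move: Lw; rewrite LE.
  elim: enumL wL {LE IH} => // z l IHl; rewrite inE => /orP[/eqP <-|wl] /=.
    rewrite (_ : `[< ~ (w |` D) w >] = false); last by apply/asboolPn => h; apply: h; left.
    rewrite (_ : `[< ~ D w >] = true) ?add0n ?add1n ?ltnS; last exact/asboolP.
    by apply: sub_count => v /= /asboolP h; apply/asboolP => Dv; apply: h; right.
  rewrite -addnS; apply: leq_add (IHl wl).
  by case: asboolP => // h; case: asboolP => // h'; exfalso; apply: h' => Dv; apply: h; right.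
- by move=> v [->//|]; exact: DL.
- by right.
- exact: (path_connectedU1 conD Du).
- by case: pselect.
- by move=> v Lv; case: pselect => // ?; exact: J1s.
(* Acyclicity: [i] is the only coordinate on which [w] can meet any node of [D], so calibrating with
   [u] on [i] calibrates with all of [D]. *)
- have uniqc v k : D v -> v k = w k -> k = i.
    by move=> Dv vk; exact: (connected_unique_coord DL conD Dv Du nDw Lw vk uw).
  move=> v v' Dv Dv' k vv' B bB; case: pselect => vw; case: pselect => v'w.
  + by [].
  + have {}Dv' : D v' by case: Dv'.
    have e : k = i by apply: (uniqc v') => //; rewrite -vv' vw.
    subst k; move=> /(wproj _ bB); apply: (calD u v' Du Dv' i _ B bB).
    by rewrite -vv' vw.
  + have {}Dv : D v by case: Dv.
    have e : k = i by apply: (uniqc v) => //; rewrite vv' v'w.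
    subst k; move=> h; apply/(wproj _ bB); move: h; apply: (calD v u Dv Du i _ B bB).
    by rewrite vv' v'w uw.
  + by apply: calD => //; [case: Dv|case: Dv'].
- move=> v vv0; case: pselect => [e|?]; [subst v|exact: JJ1].
  by apply: ijoinl; exact: sideal_marginal.
- move=> v nv; case: pselect => [e|?]; first by case: nv; left.
  by apply: J1out => Dv; apply: nv; right.
- move=> v z k Dv Lz nz e B bB Jz; have nDz : ~ D z by move=> ?; apply: nz; right.
  case: pselect => [vw|vw]; last by apply: (J1ge v z) => //; case: Dv.
  subst v; apply: ijoinl; first exact: sideal_marginal.
  by apply: (cJ z) => //.
Qed.

End propagation.
End acyclic.

(** * The ideals attached to the nodes *)

Section construction.
Context {I : choiceType} {K : choiceType} {X : I -> Type} (bor : forall i, set (set (X i))).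
Hypothesis borC : forall i (D : set (X i)), bor D -> bor (~` D).
Hypothesis borU : forall i (F : nat -> set (X i)), (forall n, bor (F n)) -> bor (\bigcup_n F n).
Hypothesis bor0 : forall i, bor (set0 : set (X i)).
Local Notation P := (forall i, X i).
Local Notation node := (seq (I -> K)).
Context {disp : Order.disp_t} {W : orderType disp}.
Hypothesis wfW : well_founded (fun x y : W => (x < y)%O).
Variables (lv : nat -> W) (ch : nat -> nat -> nat) (base : nat -> node -> Prop).
Hypothesis base_mono : forall n s t, pre s t -> base n s -> base n t.
Local Notation tle := (tle wfW lv ch base).
Local Notation tlt := (tlt wfW lv ch base).
Local Notation bel := (bel wfW lv ch base).
Variables (xi : W) (q0 q1 : nat).
Hypothesis lv1 : forall n, exists y, (y < lv n)%O.
Hypothesis lv_q0 : lv q0 = xi.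
Hypothesis lv_q1 : lv q1 = xi.
Variable V : option bool -> seq nat -> set P.
Hypothesis V_split : forall l u, V l u `<=` \bigcup_n V l (rcons u n).
Variable Istar : set (set P).
Hypothesis Istar_ideal : sideal Istar.
Hypothesis Istar_proper : ~ Istar setT.
Hypothesis Istar_None : avoid (V None [::]) `<=` Istar.
Hypothesis Istar_Some : forall b,
  iclose (pS bor xi) (avoid (V (Some b) [::])) `<=` Istar.
Implicit Types (s t v : node) (x y : W) (J : node -> set (set P)) (M : set (set P)).

(* The first of the two queries to be believed along the stages below [t] wins. *)
Definition lab t : option bool :=
  if `[< exists s, [/\ tlt xi s (emb t), bel q0 s &
         forall s', tlt xi s' (emb t) -> size s' < size s -> ~ bel q1 s'] >]
  then Some false else if `[< bel q1 t >] then Some true else None.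

(** The stages true below level [xi] at [s] are exactly those true at [t] that are segments of [s],
    so the same query wins. Hence along true stages a label changes at most once, from [None] to a
    definite value. *)
Lemma lab_sticky s t b : tlt xi s (emb t) -> lab s = Some b -> lab t = Some b.
Proof.
move=> st; rewrite /lab; case: asboolP => [[s0 [s0s bs0 no]]|noE].
  move=> <-; case: asboolP => // -[]; exists s0; split=> //.
    exact: (tlt_trans_emb (emb_chain t) s0s st).
  move=> s' s't ss'; apply: no => //; apply: (tlt_restrict (emb_chain t) s't st).
  by apply: pre_total s't.1 st.1 _; rewrite (leq_trans (ltnW ss'))// (pre_size s0s.1).
case: asboolP => // b1s <-; case: asboolP => [[s0 [s0t bs0 no]]|_].
  have [s0s|ss0] := leqP (size s0) (size s); last by case: (no s st ss0).
  have s0s' : tlt xi s0 (emb s).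
    by apply: (tlt_restrict (emb_chain t) s0t st); exact: pre_total s0t.1 st.1 s0s.
  case: noE; exists s0; split=> // s' s's; apply: no.
  exact: (tlt_trans_emb (emb_chain t) s's st).
case: asboolP => // -[]; apply: (bel_mono base_mono _ b1s); by rewrite lv_q1.
Qed.

Definition qry (b : bool) := if b then q1 else q0.

Lemma lab_sound t b : lab t = Some b -> exists2 s, tlt xi s (emb t) & bel (qry b) s.
Proof.
rewrite /lab; case: asboolP => [[s0 [? ? _]] [<-]|_]; first by exists s0.
by case: asboolP => // ? [<-]; exists t => //; exact: tlt_refl.
Qed.

Lemma lab_complete t b : bel (qry b) t -> lab t <> None.
Proof.
rewrite /lab => bt; case: asboolP => // noE; case: asboolP => // nb1.
case: b bt => //= bt; case: noE; exists t; split=> //; first exact: tlt_refl.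
move=> s' s't _ bs'; apply: nb1; apply: (bel_mono base_mono _ bs'); by rewrite lv_q1.
Qed.

Definition longest (Q : node -> Prop) t s : Prop :=
  [/\ Q s, s <> t & forall v, Q v -> v <> t -> size v <= size s].

Definition ltpred x t s : Prop := longest (fun v => tlt x v (emb t)) t s.
Definition lepred x t s : Prop := longest (fun v => tle x v (emb t)) t s.

Lemma longest_exists (Q : node -> Prop) t : (forall v, Q v -> pre v t) -> Q [::] -> t <> [::] ->
  exists s, longest Q t s.
Proof.
move=> Qt Q0 t0; pose R k := `[< exists v, [/\ Q v, v <> t & size v = k] >].
have exR : exists k, R k by exists 0; apply/asboolP; exists [::]; split=> //; exact/nesym.
have Rb k : R k -> k <= size t by move=> /asboolP[v [/Qt/pre_size ? _ <-]].
case: (ex_maxnP exR Rb) => k /asboolP[s [Qs st sk]] max; exists s; split=> // v Qv vt.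
by rewrite sk; apply: max; apply/asboolP; exists v.
Qed.

Lemma tlt_nil x t : tlt x [::] (emb t).
Proof. by apply: tle_tlt; apply: tle_nil; exact: pre_nil. Qed.

Lemma ltpred_exists x t : t <> [::] -> exists s, ltpred x t s.
Proof. by apply: longest_exists => [v []//|]; exact: tlt_nil. Qed.

Lemma lepred_exists x t : t <> [::] -> exists s, lepred x t s.
Proof.
by apply: longest_exists => [v /tle_tlt[]//|]; apply: tle_nil; exact: pre_nil.
Qed.

Lemma longest_unique (Q : node -> Prop) t s s' : (forall v, Q v -> pre v t) ->
  longest Q t s -> longest Q t s' -> s = s'.
Proof.
move=> Qt [Qs st ms] [Qs' s't ms'].
apply: pre_size_eq; last exact: ms.
by apply: (pre_total (Qt _ Qs) (Qt _ Qs')); exact: ms'.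
Qed.

(* The closure demands made on the ideal of [t] by the ideals of its true predecessors;
   only the levels of the finitely many queries below [size t] matter. *)
Definition demands J t M : Prop :=
  (forall n s, n < size t -> (lv n < xi)%O -> lepred (lv n) t s ->
     iclose (pS bor (lv n)) (J s) `<=` M) /\
  (forall s, ltpred xi t s -> lab s = lab t -> J s `<=` M).

(** * Properness of the ideal of a new node *)

Section chain.
Variables (J : node -> set (set P)) (t : node) (M0 : set (set P)) (Phi : set I).
Hypothesis t0 : t <> [::].
Hypothesis finPhi : finite_set Phi.
Hypothesis J_ideal : forall s, pre s t -> s <> t -> sideal (J s).
Hypothesis J_dem : forall s, pre s t -> s <> t -> s <> [::] -> demands J s (J s).
Hypothesis M0_ideal : sideal M0.
Hypothesis M0_proper : ~ M0 setT.
Hypothesis M0_pred : J (take (size t).-1 t) `<=` M0.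

Definition coord_ideal : set (set P) := [set E | exists D : forall i, set (X i),
  (forall i, Phi i -> bor (D i) /\ M0 (cyl (D i))) /\
  E `<=` [set z | exists2 i, Phi i & D i (z i)]].

Lemma coord_ideal_sideal : sideal coord_ideal.
Proof.
split.
- exists (fun=> set0); split=> // i _; split=> //; exact: sideal0.
- by move=> A B AB [D [? h]]; exists D; split=> //; exact: subset_trans h.
- move=> F /(_ _)/cid h; pose D n := projT1 (h n).
  have hD n : (forall i, Phi i -> bor (D n i) /\ M0 (cyl (D n i))) /\
     F n `<=` [set z | exists2 i, Phi i & D n i (z i)] := projT2 (h n).
  exists (fun i => \bigcup_n D n i); split.
    move=> i Pi; split; first by apply: borU => n; have [/(_ _ Pi)[]] := hD n.
    apply: (sideal_sub M0_ideal) (sideal_bigcup M0_ideal (F := fun n => cyl (D n i)) _).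
      by move=> z [n _ ?]; exists n.
    by move=> n; have [/(_ _ Pi)[]] := hD n.
  by move=> z [n _ /(hD n).2[i Pi Dz]]; exists i => //; exists n.
Qed.

(** Finiteness of [Phi] is used here: a finite union of Borel cylinders has level 0, so it survives
    the swaps at all levels. *)
Lemma coord_ideal_box E : coord_ideal E ->
  exists H, [/\ E `<=` H, box_algebra bor H, coord_ideal H & M0 H].
Proof.
move=> [D [hD ED]]; exists [set z | exists2 i, Phi i & D i (z i)].
suff [bH MH] : box_algebra bor [set z | exists2 i, Phi i & D i (z i)] /\
    M0 [set z | exists2 i, Phi i & D i (z i)] by split=> //; exists D; split.
have [r Pr] := (finite_seqP Phi).1 finPhi.
have {}hD i : i \in r -> bor (D i) /\ M0 (cyl (D i)) by move=> ir; apply: hD; rewrite Pr.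
rewrite Pr; elim: r hD {Pr} => [|i r IH] hD.
  rewrite (_ : [set _ | _] = set0); first by split; [exact: box_set0|exact: sideal0].
  by apply/seteqP; split=> // z [].
have [|bH MH] := IH; first by move=> j jr; apply: hD; rewrite inE jr orbT.
have [bi Mi] := hD i (mem_head _ _).
rewrite (_ : [set _ | _] = cyl (D i) `|` [set z | exists2 j, [set` r] j & D j (z j)]).
  by split; [apply: box_setU => //; exact: box_cyl|exact: sidealU].
apply/seteqP; split=> z.
  by move=> [j /=]; rewrite inE => /orP[/eqP->|jr]; [left|right; exists j].
by case=> [?|[j /= jr ?]]; [exists i => //=; rewrite mem_head|exists j => //=; rewrite inE jr orbT].
Qed.

Definition chain_ideal x : set (set P) := [set E | exists h0 (h : nat -> set P),
  [/\ coord_ideal h0,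
      forall n, n < size t -> (lv n < x)%O -> pS bor (lv n) (h n) /\
        forall s, lepred (lv n) t s -> J s (h n)
    & E `<=` h0 `|` [set z | exists n, [/\ n < size t, (lv n < x)%O & h n z]]]].

Lemma lepred_ideal x s : lepred x t s -> sideal (J s).
Proof. by move=> [/tle_tlt/tlt_pre ps ? _]; exact: J_ideal. Qed.

Lemma ltpred_ideal x s : ltpred x t s -> sideal (J s).
Proof. by move=> [/tlt_pre ps ? _]; exact: J_ideal. Qed.

Lemma chain_ideal_sideal x : sideal (chain_ideal x).
Proof.
split.
- exists set0, (fun=> set0); split=> //; first exact: sideal0 coord_ideal_sideal.
  by move=> n _ _; split=> [|s /lepred_ideal /sideal0//]; exact: pS_set0.
- by move=> A B AB [h0 [h [? ? Bh]]]; exists h0, h; split=> //; exact: subset_trans Bh.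
- move=> F /(_ _)/cid h; pose h0 n := projT1 (h n).
  have /(_ _)/cid h2 n := projT2 (h n); pose h1 n := projT1 (h2 n).
  have hD k : [/\ coord_ideal (h0 k),
      forall n, n < size t -> (lv n < x)%O -> pS bor (lv n) (h1 k n) /\
        forall s, lepred (lv n) t s -> J s (h1 k n)
    & F k `<=` h0 k `|` [set z | exists n, [/\ n < size t, (lv n < x)%O & h1 k n z]]]
    := projT2 (h2 k).
  exists (\bigcup_k h0 k), (fun n => \bigcup_k h1 k n); split.
  + by apply: (sideal_bigcup coord_ideal_sideal) => k; have [] := hD k.
  + move=> n nt nx; split.
      by apply: pS_bigcup_same => // k; have [_ /(_ _ nt nx)[]] := hD k.
    move=> s ls; apply: (sideal_bigcup (lepred_ideal ls)) => k.
    by have [_ /(_ _ nt nx)[_ /(_ _ ls)]] := hD k.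
  + move=> z [k _ Fz]; have [_ _ /(_ _ Fz)] := hD k; case=> [?|[n [nt nx ?]]].
      by left; exists k.
    by right; exists n; split=> //; exists k.
Qed.

(** Only the queries below [size t] contribute, so the levels involved have a maximum, still below
    [x]. This permits keeping all these demands during a swap at level [x]. *)
Lemma chain_ideal_small x E : (exists y, (y < x)%O) -> chain_ideal x E ->
  exists H y, [/\ (y < x)%O, pS bor y H, chain_ideal x H & E `<=` H].
Proof.
move=> [y0 y0x] [h0 [h [/coord_ideal_box[H0 [hH0 bH0 cH0 _]] hh Eh]]].
have [z0 z00 z0x] : exists2 z, (forall y, ~ (y < z)%O) & (z < x)%O.
  elim/(well_founded_ind wfW): y0 y0x => y IH yx.
  have [[z zy]|no] := pselect (exists z, (z < y)%O); first exact: (IH z zy (lt_trans zy yx)).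
  by exists y => // z zy; apply: no; exists z.
pose HN N := H0 `|` [set z | exists n, [/\ n < N, (lv n < x)%O & h n z]].
have sm N : N <= size t -> exists2 y, (y < x)%O & pS bor y (HN N).
  elim: N => [_|N IH Nt].
    exists z0 => //; rewrite (_ : HN 0 = H0); first exact: pS_box.
    by apply/seteqP; split=> z; [case=> // -[n []]|left].
  have [y yx Sy] := IH (ltnW Nt); have [Nx|xN] := ltP (lv N) x.
    exists (Order.max y (lv N)); first by rewrite gt_max yx.
    rewrite (_ : HN N.+1 = HN N `|` h N).
      apply: pS_setU; [apply: pS_le Sy|apply: pS_le (hh N Nt Nx).1];
        by rewrite le_max lexx ?orbT.
    apply/seteqP; split=> z.
      move=> [?|[n [nN nx hz]]]; first by left; left.
      move: nN; rewrite ltnS leq_eqVlt => /orP[/eqP <-|nN]; first by right.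
      by left; right; exists n.
    move=> [[?|[n [nN nx hz]]]|hz]; first by left.
      by right; exists n; split=> //; exact: ltnW.
    by right; exists N.
  exists y => //; rewrite (_ : HN N.+1 = HN N)//; apply/seteqP; split=> z.
    move=> [?|[n [nN nx hz]]]; [by left|right; exists n; split=> //].
    move: nN; rewrite ltnS leq_eqVlt => /orP[/eqP nN|//].
    by move: nx; rewrite nN ltNge xN.
  by move=> [?|[n [nN nx hz]]]; [left|right; exists n; split=> //; exact: ltnW].
have [y yx Sy] := sm (size t) (leqnn _); exists (HN (size t)), y; split=> //.
  by exists H0, h; split.
by move=> z /Eh[/hH0|]; [left|right].
Qed.

(* If [s] is the last stage true at level [x] and [s2] the last one true below [x],
   every link between them was recorded because it knows a query of level [x]. *)
Lemma chain_link x s s2 : (x < xi)%O -> lepred x t s -> ltpred x t s2 -> s <> s2 ->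
  iclose (pS bor x) (J s) `<=` J s2.
Proof.
move=> xxi [st sT smax] [s2t s2T s2max] ss2.
have et := emb_chain t.
have ss2p : pre s s2.
  apply: (pre_total (tle_tlt st).1 s2t.1); apply: s2max => //; exact: tle_tlt.
suff main k v : size v < k -> tle x v (emb s2) -> pre s v -> iclose (pS bor x) (J s) `<=` J v.
  apply: (main _ s2 (ltnSn _)) ss2p; apply/tleE; split; first exact: tlt_refl.
  move=> u su us; have -> // : u = s2.
  by apply: pre_size_eq us.1 (pre_size su.1).
elim: k v => // k IH v vk vs2 sv.
have vlt : tlt x v (emb t) by apply: (tlt_trans_emb et (tle_tlt vs2) s2t).
have vT : v <> t.
  move=> e; have := pre_size (tle_tlt vs2).1; rewrite e.
  by have := pre_ltsize s2t.1 s2T; rewrite ltnNge => /negP.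
have [<-|svne] := pselect (s = v).
  by apply: iclose_sub; apply: J_ideal => //; exact: (tle_tlt st).1.
have nle : ~ tle x v (emb t).
  by move=> /smax/(_ vT); rewrite leqNgt (pre_ltsize sv svne).
have [n nv nx] := injury_level et vlt nle.
have v0 : v <> [::].
  by move=> e; move: (pre_ltsize sv svne); rewrite e.
have [v' lv'] := lepred_exists x v0; have [v'v v'ne v'max] := lv'.
have sv' : tle x s (emb v) by exact: (tle_restrict et st vlt).
have sv'p : pre s v'.
  by apply: (pre_total sv (tle_tlt v'v).1); apply: v'max.
have h : iclose (pS bor x) (J s) `<=` J v'.
  apply: IH => //.
    by rewrite -ltnS; apply: leq_trans vk; rewrite ltnS; exact: pre_ltsize (tle_tlt v'v).1 v'ne.
  exact: (tle_trans_emb (emb_chain s2) v'v vs2).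
have [d1 _] := J_dem vlt.1 vT v0.
move=> E [C [SC JC EC]]; apply: (d1 n v') => //; rewrite nx//.
by exists C; split=> //; apply: h; exists C; split.
Qed.

(** Induction on [x] from the immediate predecessor, where [M0] witnesses properness. Passing an
    active level [th] replaces the last stage true below [th] by the last one true at [th]; the
    ideal of the former contains the closure of the ideal of the latter, and [swap_proper] keeps the
    demands of lower levels. *)
Lemma chain_proper x s : (x <= xi)%O -> ltpred x t s -> ~ ijoin (J s) (chain_ideal x) setT.
Proof.
have et := emb_chain t.
elim/(well_founded_ind wfW): x s => x IH s xxi ls.
have [ex|no] := pselect (exists n, n < size t /\ (lv n < x)%O); last first.
  (* With no active query of level below [x], no injury below [x] is possible, so the immediate
     predecessor looks true. *)
  have -> : s = take (size t).-1 t.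
    apply: (longest_unique _ ls); first by move=> v [].
    have tn : 0 < size t by case: (t) t0.
    have sz : size (take (size t).-1 t) = (size t).-1 by rewrite size_takel// leq_pred.
    split.
    - split=> [|y]; first exact: take_pre.
      elim/(well_founded_ind wfW): y => y IHy yx; apply: contrapT => nle.
      have [|n nt ny] := injury_level et _ nle.
        by split=> [|z zy]; [exact: take_pre|apply: IHy => //; exact: lt_trans yx].
      by apply: no; exists n; rewrite ny; split=> //; move: nt; rewrite sz; lia.
    - by move=> /(congr1 size); rewrite sz; lia.
    - by move=> v [vt _] vT; rewrite sz; have := pre_ltsize vt vT; lia.
  move=> [A [B [JA [h0 [h [c0 _ Bh]]] AB]]]; apply: M0_proper.
  have [H0 [hH _ _ MH]] := coord_ideal_box c0.
  apply: (sideal_sub M0_ideal) (sidealU M0_ideal (M0_pred JA) MH) => z _.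
  have [|/Bh[/hH|[n [nt nx _]]]] := AB z Logic.I; [by left|by right|].
  by exfalso; apply: no; exists n.
have [n [nt nx max]] : exists n, [/\ n < size t, (lv n < x)%O &
    forall m, m < size t -> (lv m < x)%O -> (lv m <= lv n)%O].
  elim: (size t) ex => [[n []//]|N IHN [n [nN nx]]].
  have [/IHN[k [kN kx mk]]|no] := pselect (exists n, n < N /\ (lv n < x)%O); last first.
    have nn m : m < N.+1 -> (lv m < x)%O -> m = N.
      rewrite ltnS leq_eqVlt => /orP[/eqP//|mN] mx; by case: no; exists m.
    by exists n; split=> // m mN mx; rewrite (nn m)// (nn n).
  have [Nx|xN] := ltP (lv N) x; last first.
    exists k; split=> // [|m]; first exact: ltnW.
    rewrite ltnS leq_eqVlt => /orP[/eqP->|mN]; last exact: mk.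
    by rewrite ltNge xN.
  have [kN'|/ltW Nk] := leP (lv k) (lv N).
    exists N; split=> // m; rewrite ltnS leq_eqVlt => /orP[/eqP-> //|mN mx].
    exact: le_trans (mk _ mN mx) kN'.
  exists k; split=> // [|m]; first exact: ltnW.
  by rewrite ltnS leq_eqVlt => /orP[/eqP-> //|mN mx]; exact: mk.
set th := lv n in nx max *.
(* No active query has a level strictly between [th] and [x], so looking true below [x] is the same
   as looking true up to [th]. *)
have ls' : lepred th t s.
  have [s' ls'] := lepred_exists th t0; suff -> : s = s' by [].
  have [st sT smax] := ls; have [s't s'T s'max] := ls'.
  have s'x : tlt x s' (emb t).
    split=> [|y]; first exact: (tle_tlt s't).1.
    elim/(well_founded_ind wfW): y => y IHy yx; apply: contrapT => nle.
    have [|m mt my] := injury_level et _ nle.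
      by split=> [|z zy]; [exact: (tle_tlt s't).1|apply: IHy => //; exact: lt_trans yx].
    have : (lv m <= th)%O.
      by apply: max; rewrite ?my//; apply: leq_trans mt (pre_size (tle_tlt s't).1).
    rewrite my le_eqVlt => /orP[/eqP yth|yth]; apply: nle; first by rewrite yth.
    exact: (tle_tlt s't).2.
  apply: pre_size_eq; last exact: smax.
  apply: (pre_total st.1 s'x.1); apply: s'max => //; exact: st.2.
have [s2 ls2] := ltpred_exists th t0.
have thxi : (th < xi)%O by exact: lt_le_trans xxi.
have sI := lepred_ideal ls'; have s2I := ltpred_ideal ls2.
move=> [A [B [JA [h0 [h [c0 hh Bh]]] AB]]].
(* The demands of level exactly [th] all come from [s], so their sets are already in [J s]. *)
pose H2 := [set z | exists m, [/\ m < size t, lv m = th & h m z]].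
have JH2 : J s H2.
  have e : H2 `<=` \bigcup_m (if `[< m < size t /\ lv m = th >] then h m else set0).
    by move=> z [m [mt mth hz]]; exists m => //; case: asboolP => // -[].
  apply: (sideal_sub sI e); apply: (sideal_bigcup sI) => m.
  case: asboolP => [[mt mth]|_]; last exact: sideal0.
  by have [_] := hh m mt (eq_ind_r (fun z => (z < x)%O) nx mth); apply; rewrite mth.
pose H1 := h0 `|` [set z | exists m, [/\ m < size t, (lv m < th)%O & h m z]].
have cH1 : chain_ideal th H1.
  exists h0, h; split=> // m mt mth; apply: hh => //; exact: lt_trans nx.
have AB' : (A `|` H2) `|` H1 = setT.
  rewrite -subTset => z _; have [|/Bh[|[m [mt mx hz]]]] := AB z Logic.I.
  - by left; left.
  - by right; left.
  - have := max m mt mx; rewrite le_eqVlt => /orP[/eqP mth|mth].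
      by left; right; exists m.
    by right; right; exists m.
have IHth := IH _ nx s2 (ltW thxi) ls2; apply: IHth.
have cI := chain_ideal_sideal th.
have [ss2|ss2] := pselect (s = s2).
  by rewrite -ss2; exists (A `|` H2), H1; split=> //; [exact: sidealU|rewrite AB'].
have [H [y [yth Sy cH HH]]] := chain_ideal_small (lv1 n) cH1.
apply: (swap_proper yth sI _ _ Sy _ (E := A `|` H2)).
- exact: sideal_join.
- by apply: subset_trans (chain_link thxi ls' ls2 ss2) _; exact: ijoinl.
- exact: ijoinr.
- exact: sidealU.
- rewrite -subTset => z _; have z12 : ((A `|` H2) `|` H1) z by rewrite AB'.
  by case: z12 => [|/HH]; [left|right].
Qed.

Lemma chain_ideal_coord i (B : set (X i)) : Phi i -> bor B -> M0 (cyl B) -> chain_ideal xi (cyl B).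
Proof.
move=> Pi bB MB; exists (cyl B), (fun=> set0); split; last by left.
  exists (fun j => if pselect (j = i) is left e then eq_rect_r (fun k => set (X k)) B e else set0).
  split=> [j Pj|z Bz]; last first.
    exists i => //; case: pselect => // e.
    by rewrite (Prop_irrelevance e erefl).
  case: pselect => [e|_]; last by split=> //; exact: sideal0.
  by subst j.
by move=> n _ _; split=> [|s /lepred_ideal /sideal0//]; exact: pS_set0.
Qed.

(** If the label is unchanged, the ideal of the last true stage is joined with the demands. If it
    changes, it changes from [None], and the old ideal contains [Istar], hence the closure at level
    [xi] of the sets missing the new target; one more swap, at level [xi], then moves to the new
    target while keeping all demands. *)
Lemma node_ideal (Istar_le : forall s, ltpred xi t s -> lab s = None -> Istar `<=` J s) s0 :
  ltpred xi t s0 ->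
  exists N, [/\ sideal N, ~ N setT, demands J t N,
    (lab s0 <> lab t -> avoid (V (lab t) [::]) `<=` N) &
    forall i (B : set (X i)), Phi i -> bor B -> M0 (cyl B) -> N (cyl B)].
Proof.
move=> ls0; have cI := chain_ideal_sideal xi; have s0I := ltpred_ideal ls0.
have dem1 n s : n < size t -> (lv n < xi)%O -> lepred (lv n) t s ->
    iclose (pS bor (lv n)) (J s) `<=` chain_ideal xi.
  move=> nt nxi ls E [C [SC JC EC]]; exists set0, (fun m => if m == n then C else set0).
  split; first exact: sideal0 coord_ideal_sideal.
    move=> m mt mxi; case: eqP => [->|_].
      split=> // s' ls'; rewrite (_ : s' = s)//.
      by apply: (longest_unique _ ls' ls) => v /tle_tlt[].
    by split=> [|s' /lepred_ideal /sideal0//]; exact: pS_set0.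
  by move=> z /EC Cz; right; exists n; rewrite eqxx.
have [same|diff] := pselect (lab s0 = lab t).
  exists (ijoin (J s0) (chain_ideal xi)); split=> //.
  - exact: sideal_join.
  - exact: chain_proper.
  - split=> [n s nt nxi ls|s ls _]; first by apply: subset_trans (dem1 _ _ nt nxi ls) _; exact: ijoinr.
    rewrite (_ : s = s0); first exact: ijoinl.
    by apply: (longest_unique _ ls ls0) => v [].
  - by move=> i B Pi bB MB; apply: ijoinr => //; exact: chain_ideal_coord.
have aI : sideal (avoid (V (lab t) [::])) := sideal_avoid _.
exists (ijoin (avoid (V (lab t) [::])) (chain_ideal xi)); split=> //.
- exact: sideal_join.
- have ls0N : lab s0 = None.
    by case e : (lab s0) => [b|//]; case: diff; rewrite e; apply/esym/(lab_sticky _ e); have [] := ls0.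
  have [b tb] : exists b, lab t = Some b.
    by move: diff; rewrite ls0N; case: (lab t) => // b _; exists b.
  move=> [A [B [JA cB AB]]].
  have xi1 : exists y, (y < xi)%O by rewrite -lv_q0.
  have [H [y [yxi Sy cH HH]]] := chain_ideal_small xi1 cB.
  apply: (chain_proper (lexx _) ls0); apply: (swap_proper yxi aI _ _ Sy _ (E := A)) => //.
  + exact: sideal_join.
  + by rewrite tb => E /Istar_Some /(Istar_le _ ls0 ls0N); exact: ijoinl.
  + exact: ijoinr.
  + by rewrite -subTset => z _; have [|/HH] := AB z Logic.I; [left|right].
- split=> [n s nt nxi ls|s ls e]; first by apply: subset_trans (dem1 _ _ nt nxi ls) _; exact: ijoinr.
  case: diff; rewrite -e; congr lab.
  by apply: (longest_unique _ ls0 ls) => v [].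
- by move=> _; exact: ijoinl.
- by move=> i B Pi bB MB; apply: ijoinr => //; exact: chain_ideal_coord.
Qed.

End chain.

Lemma lab_nil : lab [::] = None.
Proof.
case e : (lab [::]) => [b|//]; have [s [s0 _] bs] := lab_sound e.
have e0 : s = [::] by case: s s0 {bs} => // a s [].
by move: bs; rewrite e0 => /belE[].
Qed.

Variables (T : set node) (code : I -> nat) (G : forall i, nat -> nat -> set (X i)).
Hypothesis T_tree : forall s t, pre s t -> T t -> T s.
Hypothesis code_inj : injective code.
Hypothesis G_bor : forall i k n, bor (@G i k n).
Hypothesis G_cover : forall i k, \bigcup_n @G i k n = setT.

Definition crd (s : node) : I -> seq K := fun i => [seq a i | a <- s].

Definition lvl l : set (I -> seq K) := crd @` [set s | T s /\ size s = l].

Hypothesis lvl_finite : forall l, finite_set (lvl l).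
Hypothesis lvl_one_sided : forall l, one_sided (lvl l).
Hypothesis lvl_acyclic : forall l, almost_acyclic (lvl l).

Lemma crd_inj s t : size s = size t -> crd s = crd t -> s = t.
Proof.
elim: s t => [|a s IH] [|b t] //= [st] e.
have h i : a i :: [seq c i | c <- s] = b i :: [seq c i | c <- t] by exact: (congr1 (@^~ i) e).
congr cons; first by apply/funext => i; case: (h i).
by apply: IH => //; apply/funext => i; case: (h i).
Qed.

Lemma crd_take l s i : crd (take l s) i = take l (crd s i).
Proof. by rewrite /crd map_take. Qed.

(* The coordinates on which positivity has to be tracked at level [l]. *)
Definition live l : set I := [set i | code i < l] `|`
  [set i | exists u w : I -> seq K, [/\ lvl l u, lvl l w, u <> w & u i = w i]].

Lemma code_finite l : finite_set [set i | code i < l].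
Proof.
apply: (@finite_preimage _ _ [set k | k < l] code).
  by move=> x y _ _; exact: code_inj.
exact: finite_II.
Qed.

(** By one-sidedness each pair of distinct nodes of the finite level contributes at most one shared
    coordinate. *)
Lemma live_finite l : finite_set (live l).
Proof.
rewrite finite_setU; split; first exact: code_finite.
rewrite (_ : [set _ | _] = \bigcup_(uv in lvl l `*` lvl l) [set i | uv.1 <> uv.2 /\ uv.1 i = uv.2 i]).
  apply: bigcup_finite; first exact: finite_setX.
  move=> [u v] [/= Lu Lv]; have [[i [uv ui]]|no] := pselect (exists i, u <> v /\ u i = v i).
    apply: (@sub_finite_set _ _ [set i]); last exact: finite_set1.
    by move=> j [_ uj]; exact: (lvl_one_sided Lu Lv uv uj ui).
  by apply: (@sub_finite_set _ _ set0) => // j uv; apply: no; exists j.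
apply/seteqP; split=> i.
  by move=> [u [v [Lu Lv uv e]]]; exists (u, v).
by move=> [[u v] [/= Lu Lv] [uv e]]; exists u, v.
Qed.

(** The index is restarted when the label changes, because it then refers to a different Souslin
    scheme. *)
Definition ext_ind (ind : node -> seq nat) s t : seq nat :=
  if lab s == lab t then ind s else [::].

(** The closure demands and the Souslin index refer to true predecessors, but [gn_coord] refers to
    the immediate one: the approximations of a coordinate must cohere along all initial segments,
    since from the values of one coordinate alone nobody can tell which stages are true. *)
Record good_node J (ind : node -> seq nat) t : Prop := GoodNode {
  gn_ideal : sideal (J t);
  gn_proper : ~ J t setT;
  gn_root : t = [::] -> J t = Istar /\ ind t = [::];
  gn_dem : t <> [::] -> demands J t (J t);
  gn_ind : t <> [::] -> exists s n, ltpred xi t s /\ ind t = rcons (ext_ind ind s t) n;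
  gn_V : J t (~` V (lab t) (ind t));
  gn_G : forall i, code i < size t -> exists n, J t (~` cyl (@G i (size t) n));
  gn_coord : t <> [::] -> forall i (B : set (X i)), code i < size t -> bor B ->
    J (take (size t).-1 t) (cyl B) -> J t (cyl B) }.

Lemma demands_ext J J' t M : (forall s, pre s t -> s <> t -> J s = J' s) ->
  demands J t M -> demands J' t M.
Proof.
move=> JJ [d1 d2]; split=> [n s nt nx ls|s ls].
  by have [/tle_tlt[st _] sT _] := ls; rewrite -JJ//; exact: d1.
by have [[st _] sT _] := ls; rewrite -JJ//; exact: d2.
Qed.

Lemma take_pred_neq t : t <> [::] -> take (size t).-1 t <> t.
Proof. by case: t => // a t _ /(congr1 size); rewrite size_takel//=; lia. Qed.

Lemma good_node_ext J J' (ind ind' : node -> seq nat) t :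
  (forall s, pre s t -> J s = J' s) -> (forall s, pre s t -> ind s = ind' s) ->
  good_node J ind t -> good_node J' ind' t.
Proof.
move=> JJ II [g1 g2 g3 g4 g5 g6 g7 g8].
have tt := pre_refl t; split; rewrite -?JJ -?II//.
- by move=> t0; apply: (demands_ext (J := J)); [move=> s st _; exact: JJ|exact: g4].
- move=> /g5[s [n [ls e]]]; exists s, n; split=> //; rewrite e /ext_ind.
  by rewrite II//; have [[]] := ls.
- exact: take_pre.
Qed.

(** While the label is [None], all true predecessors down to the root have label [None] too, so the
    ideals have only grown from [Istar]. *)
Lemma Istar_le J ind t : (forall s, pre s t -> good_node J ind s) -> lab t = None ->
  Istar `<=` J t.
Proof.
have [k] := ubnP (size t); elim: k t => // k IH t tk gt lt.
have [t0|t0] := pselect (t = [::]).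
  by have [-> _] := gn_root (gt _ (pre_refl t)) t0.
have [s ls] := ltpred_exists xi t0; have [st sT _] := ls.
have ls0 : lab s = None.
  by case e : (lab s) => [b|//]; move: lt; rewrite (lab_sticky st e).
have [_ d2] := gn_dem (gt _ (pre_refl t)) t0.
apply: subset_trans (d2 s ls _); last by rewrite ls0.
apply: IH => //; first by rewrite -ltnS; apply: leq_trans tk; rewrite ltnS; exact: pre_ltsize st.1 sT.
by move=> v vs; apply: gt; exact: pre_trans st.1.
Qed.

Lemma refine_cover M (F : nat -> set P) : sideal M -> ~ M setT -> M (~` \bigcup_n F n) ->
  exists n N, [/\ sideal N, ~ N setT, M `<=` N & N (~` F n)].
Proof.
move=> sM pM MF; have [n pn] := sideal_split sM pM MF; exists n, (ijoin M (avoid (F n))).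
have aI := sideal_avoid (F n).
by split=> //; [exact: sideal_join|exact: ijoinl|apply: ijoinr].
Qed.

Lemma refine_small M k (r : seq I) : sideal M -> ~ M setT ->
  exists N, [/\ sideal N, ~ N setT, M `<=` N &
    forall i, i \in r -> exists n, N (~` cyl (@G i k n))].
Proof.
elim: r M => [|i r IH] M sM pM; first by exists M; split.
have [N [sN pN MN hN]] := IH M sM pM.
have [|n [N' [sN' pN' NN' hN']]] := refine_cover (F := fun n => cyl (@G i k n)) sN pN.
  rewrite (_ : ~` _ = set0); first exact: sideal0.
  rewrite -subset0 => z nz; apply: nz.
  by have : (\bigcup_n @G i k n) (z i) by rewrite G_cover.
exists N'; split=> //; first exact: subset_trans NN'.
move=> j; rewrite inE => /orP[/eqP ->|jr]; first by exists n.
by have [m /NN'] := hN j jr; exists m.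
Qed.

Definition cal_level J l : Prop := forall s t, T s -> T t -> size s = l -> size t = l ->
  forall i, crd s i = crd t i -> forall B : set (X i), bor B -> J s (cyl B) -> J t (cyl B).

(** * One level of the construction *)

Section level_step.
Variables (l : nat) (J : node -> set (set P)) (ind : node -> seq nat).
Hypothesis good_J : forall t, T t -> size t <= l -> good_node J ind t.
Hypothesis cal_J : cal_level J l.

Let nd (c : I -> seq K) : node := xget [::] [set t | [/\ T t, size t = l.+1 & crd t = c]].

Let ndP c : lvl l.+1 c -> [/\ T (nd c), size (nd c) = l.+1 & crd (nd c) = c].
Proof.
move=> [t [Tt st] <-].
by rewrite /nd; case: (xgetP [::] [set t' | [/\ T t', size t' = l.+1 & crd t' = crd t]]) => [_ -> //|/(_ t)[]].
Qed.

Let nd_crd t : T t -> size t = l.+1 -> nd (crd t) = t.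
Proof.
move=> Tt st; have [|_ s1 c1] := @ndP (crd t); first by exists t.
by apply: crd_inj => //; rewrite s1 st.
Qed.

Let gd c M : Prop := [/\ demands J (nd c) M,
  exists s n, ltpred xi (nd c) s /\ M (~` V (lab (nd c)) (rcons (ext_ind ind s (nd c)) n)),
  forall i, code i < l.+1 -> exists n, M (~` cyl (@G i l.+1 n)) &
  forall i (B : set (X i)), code i < l.+1 -> bor B -> J (take l (nd c)) (cyl B) -> M (cyl B)].

(** The requirements on a node are stable under enlarging its ideal, so a node already treated is
    not spoilt when later ones are propagated to it. *)
Let gdS c M N : M `<=` N -> gd c M -> gd c N.
Proof.
move=> MN [[d1 d2] [s [n [ls h]]] hG hB]; split.
- split=> [m v mt mx lvv|v lvv e]; [exact: subset_trans (d1 _ _ mt mx lvv) MN|exact: subset_trans (d2 _ lvv e) MN].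
- by exists s, n; split=> //; exact: MN.
- by move=> i /hG[m /MN]; exists m.
- by move=> i B ci bB /(hB _ _ ci bB)/MN.
Qed.

(** Smallness on the live coordinates is kept because these include the ones on which the other
    nodes of the level must agree, as [propagate] requires. *)
Let node_step c M0 : lvl l.+1 c -> sideal M0 -> ~ M0 setT -> J (take l (nd c)) `<=` M0 ->
  exists N, [/\ sideal N, ~ N setT, gd c N &
    forall i (B : set (X i)), live l.+1 i -> bor B -> M0 (cyl B) -> N (cyl B)].
Proof.
move=> Lc sM pM JM; have [Tt st _] := ndP Lc; set t := nd c in Tt st JM *.
have t0 : t <> [::] by move=> e; move: st; rewrite e.
have gp s : pre s t -> s <> t -> good_node J ind s.
  move=> sT sne; apply: good_J; first exact: T_tree Tt.
  by have := pre_ltsize sT sne; rewrite st ltnS.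
have [s0 ls0] := ltpred_exists xi t0; have [s0t s0T _] := ls0.
have predt : (size t).-1 = l by rewrite st.
have [||||N [sN pN dN aN cN]] := @node_ideal J t M0 (live l.+1) t0 (live_finite _) _ _ sM pM _ _ s0 ls0.
- by move=> s sT sne; exact: gn_ideal (gp s sT sne).
- by move=> s sT sne s00; exact: gn_dem (gp s sT sne) s00.
- by rewrite predt.
- move=> s [sT sne _] lsN; apply: (@Istar_le J ind) => // v vs.
  have [e|vt] := pselect (v = t); last by apply: gp => //; exact: pre_trans sT.1.
  by have := pre_ltsize sT.1 sne; have := pre_size vs; rewrite e; lia.
have [|n [N1 [sN1 pN1 NN1 hN1]]] :=
    refine_cover (F := fun n => V (lab t) (rcons (ext_ind ind s0 t) n)) sN pN.
  apply: (sideal_sub sN (B := ~` V (lab t) (ext_ind ind s0 t))).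
    by apply: subsetC; exact: V_split.
  rewrite /ext_ind; case: eqP => [e|ne].
    by rewrite -e; apply: (dN.2 s0) => //; exact: gn_V (gp s0 s0t.1 s0T).
  by apply: aN.
have [r rE] := (finite_seqP _).1 (code_finite l.+1).
have [N2 [sN2 pN2 NN2 hN2]] := refine_small l.+1 r sN1 pN1.
have NN : N `<=` N2 by exact: subset_trans NN2.
exists N2; split=> //; last by move=> i B Pi bB /(cN _ _ Pi bB)/NN.
split.
- by split=> [m v mt mx lvv|v lvv e]; [exact: subset_trans (dN.1 _ _ mt mx lvv) NN|exact: subset_trans (dN.2 _ lvv e) NN].
- by exists s0, n; split=> //; exact: NN2.
- by move=> i ci; apply: hN2; have : [set i | code i < l.+1] i by []; rewrite rE.
- by move=> i B ci bB /JM MB; apply/NN/cN => //; left.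
Qed.

(** The nodes of the level are treated one after the other, starting from the ideals of the
    immediate predecessors. Each is given a good ideal, which is then propagated; nodes still
    waiting keep at least the ideal of their predecessor. *)
Lemma level_family : exists Jc : (I -> seq K) -> set (set P),
  [/\ forall c, lvl l.+1 c -> sideal (Jc c) /\ ~ Jc c setT,
      calibrated bor (lvl l.+1) Jc & forall c, lvl l.+1 c -> gd c (Jc c)].
Proof.
have [cs csE] := (finite_seqP _).1 (lvl_finite l.+1).
have par c : lvl l.+1 c -> good_node J ind (take l (nd c)).
  move=> /ndP[Tt st _]; apply: good_J; first exact: T_tree (take_pre _ _) Tt.
  by rewrite size_takel// st.
suff [Jc [h1 h2 _ h4]] : exists Jc : (I -> seq K) -> set (set P),
    [/\ forall c, lvl l.+1 c -> sideal (Jc c) /\ ~ Jc c setT, calibrated bor (lvl l.+1) Jc,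
     forall c, lvl l.+1 c -> c \notin cs -> J (take l (nd c)) `<=` Jc c &
     forall c, lvl l.+1 c -> c \in cs -> gd c (Jc c)].
  by exists Jc; split=> // c Lc; apply: h4 => //; move: Lc; rewrite csE.
elim: cs {csE} => [|c0 cs [Jc [h1 h2 h3 h4]]].
  exists (fun c => J (take l (nd c))); split=> //.
    by move=> c Lc; have g := par c Lc; split; [exact: gn_ideal g|exact: gn_proper g].
  (* Nodes sharing a coordinate have predecessors sharing it one level below, so the starting family
     is calibrated. *)
  move=> c c' Lc Lc' i e B bB; have [Tc sc cc] := ndP Lc; have [Tc' sc' cc'] := ndP Lc'.
  have Tp := T_tree (take_pre l _) Tc; have Tp' := T_tree (take_pre l _) Tc'.
  apply: (cal_J Tp Tp') => //.
  - by rewrite size_takel// sc.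
  - by rewrite size_takel// sc'.
  - by rewrite !crd_take cc cc' e.
  by move=> c _ _; exact: subset_refl.
have [[Lc0 c0cs]|triv] := pselect (lvl l.+1 c0 /\ c0 \notin cs); last first.
  exists Jc; split=> // c Lc.
    by rewrite inE negb_or => /andP[_]; exact: h3.
  rewrite inE => /orP[/eqP e|]; last exact: h4.
  apply: h4 => //; apply: contrapT => /negP nc; apply: triv; by rewrite -e.
have [s0 p0] := h1 _ Lc0.
have [N [sN pN gN cN]] := node_step Lc0 s0 p0 (h3 _ Lc0 c0cs).
have [|J' [J'0 J'1 J'2 J'3]] := propagate (lvl_one_sided (l := l.+1)) (lvl_acyclic (l := l.+1)) borC borU bor0
    (lvl_finite l.+1) Lc0 h1 h2 sN pN.
  move=> v i Lv ne e B bB; apply: cN => //; right; exists c0, v; split=> //.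
exists J'; split=> // c Lc.
  rewrite inE negb_or => /andP[/eqP ne nc]; exact: subset_trans (h3 _ Lc nc) (J'3 _ ne).
have [->|ne] := pselect (c = c0); first by rewrite J'0.
by rewrite inE => /orP[/eqP//|cc]; exact: gdS (J'3 _ ne) (h4 _ Lc cc).
Qed.

Lemma level_step : exists J' ind', [/\ forall t, size t <= l -> J' t = J t /\ ind' t = ind t,
  forall t, T t -> size t <= l.+1 -> good_node J' ind' t & cal_level J' l.+1].
Proof.
have [Jc [h1 h2 h3]] := level_family.
have /choice[ind1 ind1P] t : exists u, T t -> size t = l.+1 ->
    exists s n, [/\ ltpred xi t s, u = rcons (ext_ind ind s t) n & Jc (crd t) (~` V (lab t) u)].
  have [[Tt st]|no] := pselect (T t /\ size t = l.+1); last first.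
    by exists [::] => Tt st; case: no.
  have Lc : lvl l.+1 (crd t) by exists t.
  have [_ [s [n [ls h]]] _ _] := h3 _ Lc; rewrite !nd_crd// in ls h.
  by exists (rcons (ext_ind ind s t) n) => _ _; exists s, n.
pose J' t := if size t == l.+1 then Jc (crd t) else J t.
pose ind' t := if size t == l.+1 then ind1 t else ind t.
have agree t : size t <= l -> J' t = J t /\ ind' t = ind t.
  by move=> tl; rewrite /J' /ind' ltn_eqF.
exists J', ind'; split=> //; last first.
  move=> s t Ts Tt ss st i e B bB; rewrite /J' ss st eqxx.
  by apply: h2 => //; [exists s|exists t].
move=> t Tt; rewrite leq_eqVlt => /orP[/eqP st|tl]; last first.
  apply: (@good_node_ext J _ ind); last exact: good_J.
    by move=> s /pre_size sT; have [] := agree s (leq_trans sT tl).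
  by move=> s /pre_size sT; have [] := agree s (leq_trans sT tl).
have Lc : lvl l.+1 (crd t) by exists t.
have [sI pI] := h1 _ Lc; have [d1 _ d3 d4] := h3 _ Lc; rewrite nd_crd// in d1 d4.
have [s [n [ls e hV]]] := ind1P t Tt st.
have proper v : pre v t -> v <> t -> J v = J' v /\ ind v = ind' v.
  move=> vt vne; have := pre_ltsize vt vne; rewrite st ltnS => vl.
  by have [-> ->] := agree v vl.
have J't : J' t = Jc (crd t) by rewrite /J' st eqxx.
have ind't : ind' t = ind1 t by rewrite /ind' st eqxx.
split; rewrite ?J't ?ind't//.
- by move=> t0; move: st; rewrite t0.
- by move=> _; apply: (demands_ext (J := J)) d1 => v vt vne; have [] := proper v vt vne.
- move=> _; exists s, n; split=> //; rewrite e /ext_ind.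
  by have [[sT _] sne _] := ls; have [_ ->] := proper s sT sne.
- by rewrite st.
- move=> t0 i B; rewrite st /= => ci bB; have tn : take l t <> t by have := take_pred_neq t0; rewrite st.
  by have [<- _] := proper _ (take_pre l t) tn; exact: d4.
Qed.

End level_step.

Lemma construction : exists J ind, (forall t, T t -> good_node J ind t) /\ forall l, cal_level J l.
Proof.
pose inv l (p : (node -> set (set P)) * (node -> seq nat)) :=
  (forall t, T t -> size t <= l -> good_node p.1 p.2 t) /\ cal_level p.1 l.
have inv0 : inv 0 (fun=> Istar, fun=> [::]).
  split=> [t Tt|s t _ _ + + i _ B _]; last by [].
  rewrite leqn0 => /nilP ->; split=> //; rewrite lab_nil; exact: Istar_None.
have step l (p : {p | inv l p}) : {q : {q | inv l.+1 q} | forall t, size t <= l ->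
    (sval q).1 t = (sval p).1 t /\ (sval q).2 t = (sval p).2 t}.
  case: p => -[J ind] [/= g c]; apply: cid.
  by have [J' [ind' [h1 h2 h3]]] := level_step g c; exists (exist _ (J', ind') (conj h2 h3)).
pose fix sq l : {p | inv l p} :=
  if l is l'.+1 then sval (step l' (sq l')) else exist _ _ inv0.
have sqS l t : size t <= l -> (sval (sq l.+1)).1 t = (sval (sq l)).1 t /\
    (sval (sq l.+1)).2 t = (sval (sq l)).2 t.
  by move=> tl; have := svalP (step l (sq l)) t tl.
have sqE k t : (sval (sq (size t + k))).1 t = (sval (sq (size t))).1 t /\
    (sval (sq (size t + k))).2 t = (sval (sq (size t))).2 t.
  elim: k => [|k [IH1 IH2]]; first by rewrite addn0.
  by rewrite addnS; have [-> ->] := sqS (size t + k) t (leq_addr _ _).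
(* Later steps leave the data of shorter nodes unchanged, so the data of [t] can be read off at step
   [size t]. *)
exists (fun t => (sval (sq (size t))).1 t), (fun t => (sval (sq (size t))).2 t); split.
  move=> t Tt; have [g _] := svalP (sq (size t)).
  apply: good_node_ext (g t Tt (leqnn _)) => s /pre_size st.
    by have [+ _] := sqE (size t - size s) s; rewrite subnKC.
  by have [_] := sqE (size t - size s) s; rewrite subnKC.
move=> l s t Ts Tt ss st i e B bB /=; rewrite ss st.
by have [_] := svalP (sq l); exact.
Qed.

Hypothesis V_anti : forall l u n, V l (rcons u n) `<=` V l u.
Variable C : nat -> set (nat -> I -> K).
Definition branches : set (nat -> I -> K) := [set a | forall l, T (mkseq a l)].
Hypothesis base_sound : forall n a l, branches a -> base n (mkseq a l) -> C n a.
Hypothesis ch_sound : forall n m a, branches a -> (lv (ch n m) < lv n)%O -> ~ C (ch n m) a -> C n a.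
Hypothesis complete : forall n a, branches a -> C n a ->
  (exists l, base n (mkseq a l)) \/ exists m, (lv (ch n m) < lv n)%O /\ ~ C (ch n m) a.
Hypothesis C_disj : forall a, branches a -> C q0 a -> C q1 a -> False.

Definition branch_label (a : nat -> I -> K) : option bool :=
  if `[< C q0 a >] then Some false else if `[< C q1 a >] then Some true else None.

(** * The limit along a branch *)

Section limit.
Variables (J : node -> set (set P)) (ind : node -> seq nat).
Hypothesis good_J : forall t, T t -> good_node J ind t.
Hypothesis cal_J : forall l, cal_level J l.

Lemma coord_mono s t i (B : set (X i)) : T t -> pre s t -> code i < size s -> bor B ->
  J s (cyl B) -> J t (cyl B).
Proof.
move=> Tt st ci bB Js; have [k] := ubnP (size t); elim: k t Tt st => // k IH t Tt st tk.
have [<-//|ne] := pselect (s = t).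
have t0 : t <> [::].
  by move=> e; apply: ne; rewrite e; move: st; rewrite e; case: (s) => // a s' [].
have sl := pre_ltsize st ne.
have szt : size (take (size t).-1 t) = (size t).-1 by rewrite size_takel// leq_pred.
apply: (gn_coord (good_J Tt)) => //; first exact: ltn_trans sl.
apply: IH; last by rewrite szt; lia.
- exact: T_tree (take_pre _ _) Tt.
- by apply: (pre_total st (take_pre _ _)); rewrite szt; lia.
Qed.

(** Calibration carries smallness from [s] to the segment of [t] with the same [i]-th coordinate,
    and [gn_coord] carries it up to [t]; disjoint sets would make [J t] improper. Only the [i]-th
    coordinates of the nodes are compared, which is why the [i]-th limit function depends on them
    alone. *)
Lemma small_sets : exists g : node -> I -> nat,
  (forall t i, T t -> code i < size t -> J t (~` cyl (@G i (size t) (g t i)))) /\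
  forall s t i, T s -> T t -> code i < size s -> size s <= size t ->
    crd s i = take (size s) (crd t i) ->
    @G i (size s) (g s i) `&` @G i (size t) (g t i) !=set0.
Proof.
have /choice[g0 g0P] (ti : node * I) : exists n, T ti.1 -> code ti.2 < size ti.1 ->
    J ti.1 (~` cyl (@G ti.2 (size ti.1) n)).
  have [[Tt ci]|no] := pselect (T ti.1 /\ code ti.2 < size ti.1).
    by have [n h] := gn_G (good_J Tt) ci; exists n.
  by exists 0 => Tt ci; case: no.
exists (fun t i => g0 (t, i)); split=> [t i|s t i Ts Tt ci st e]; first exact: (g0P (t, i)).
apply/set0P/negP => /eqP disj.
have Js := g0P (s, i) Ts ci; have Jt := g0P (t, i) Tt (leq_trans ci st).
rewrite /= in Js Jt; have gt := good_J Tt.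
apply: (gn_proper gt); have sz : size (take (size s) t) = size s by rewrite size_takel.
have Jts : J t (cyl (~` @G i (size s) (g0 (s, i)))).
  have bB := borC (@G_bor i (size s) (g0 (s, i))).
  apply: (coord_mono Tt (take_pre (size s) t)) => //; first by rewrite sz.
  by apply: (cal_J Ts (T_tree (take_pre _ _) Tt) erefl sz) Js => //; rewrite crd_take.
apply: (sideal_sub (gn_ideal gt)) (sidealU (gn_ideal gt) Jts Jt) => z _.
have [zs|zs] := pselect (@G i (size s) (g0 (s, i)) (z i)); last by left.
by right=> zt; have : (set0 : set (X i)) (z i) by rewrite -disj.
Qed.

Variable a : nat -> I -> K.
Hypothesis Ba : branches a.
Local Notation tr s := (tlt xi s (segs a)).

Lemma tr_T s : tr s -> T s. Proof. by case=> -> _; exact: Ba. Qed.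

(** A label at a true stage is backed by a correct answer, which excludes wrong labels; a correct
    query is eventually believed, which excludes [None]. *)
Lemma lab_eventually : exists s0, tr s0 /\ forall s, tr s -> size s0 <= size s ->
  lab s = branch_label a.
Proof.
have ac := segs_chain a.
have qc := query_correct wfW base_mono base_sound ch_sound complete Ba.
have lvq b : lv (qry b) = xi by case: b.
have sound s b : tr s -> lab s = Some b -> C (qry b) a.
  move=> ts /lab_sound[s' ss' bs']; have [h _] := qc (qry b); apply: h bs'.
  by rewrite lvq; exact: (tlt_trans_emb ac ss' ts).
have compl b : C (qry b) a -> exists L, forall s, L <= size s -> tr s -> lab s <> None.
  move=> Cb; have [_ /(_ Cb)[L hL]] := qc (qry b); exists L => s Ls ts.
  by apply: (@lab_complete _ b); apply: hL => //; rewrite lvq.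
have start L : exists s0, L <= size s0 /\ tr s0 by exact: infinitely_many_true.
rewrite /branch_label; case: asboolP => [C0|nC0].
  have [L hL] := compl false C0; have [s0 [Ls0 ts0]] := start L.
  exists s0; split=> // s ts s0s; case e : (lab s) => [b|]; last first.
    by case: (hL s (leq_trans Ls0 s0s) ts).
  by case: b e => // /(sound _ _ ts)/= C1; case: (C_disj Ba C0 C1).
case: asboolP => [C1|nC1].
  have [L hL] := compl true C1; have [s0 [Ls0 ts0]] := start L.
  exists s0; split=> // s ts s0s; case e : (lab s) => [b|]; last first.
    by case: (hL s (leq_trans Ls0 s0s) ts).
  by case: b e => // /(sound _ _ ts)/=.
have [s0 [_ ts0]] := start 0; exists s0; split=> // s ts _.
by case e : (lab s) => [[]|//]; have := sound _ _ ts e.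
Qed.

(** Past [s0] the labels agree, so every new index extends that of the last true stage by one entry
    and is never restarted. *)
Lemma ind_mono s0 s t : tr s0 -> (forall s, tr s -> size s0 <= size s -> lab s = branch_label a) ->
  tr s -> tr t -> size s0 <= size s -> size s <= size t ->
  pre (ind s) (ind t) /\ (s <> t -> size (ind s) < size (ind t)).
Proof.
have ac := segs_chain a.
move=> ts0 lab0; have [k] := ubnP (size t); elim: k t => // k IH t tk ts tt s0s st.
have [<-|ne] := pselect (s = t); first by split=> //; exact: pre_refl.
have stp : pre s t by exact: ac.2 ts.1 tt.1 st.
have sl := pre_ltsize stp ne.
have t0 : t <> [::] by move=> e; move: sl; rewrite e.
have [p [n [lp ip]]] := gn_ind (good_J (tr_T tt)) t0; have [pt pT pmax] := lp.
have tp : tr p by exact: (tlt_trans_emb ac pt tt).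
have sp : size s <= size p.
  by apply: pmax => //; exact: (tlt_restrict ac ts tt).
have e : lab p == lab t.
  by rewrite !lab0//; [exact: leq_trans st|exact: leq_trans sp].
rewrite ip /ext_ind e size_rcons.
have [|h _] := IH p _ ts tp s0s sp.
  by rewrite -ltnS; apply: leq_trans tk; rewrite ltnS; exact: pre_ltsize pt.1 pT.
split; last by move=> _; rewrite ltnS; exact: pre_size.
by apply: pre_trans h _; exists [:: n]; rewrite cats1.
Qed.

Lemma limit_index : exists y : nat -> nat, forall k N, exists t,
  [/\ tr t, N <= size t & J t (~` V (branch_label a) (mkseq y k))].
Proof.
have ac := segs_chain a.
have [s0 [ts0 lab0]] := lab_eventually.
have unb m : exists t, [/\ tr t, size s0 <= size t, m <= size t & m <= size (ind t)].
  elim: m => [|m [t [tt s0t mt mi]]]; first by exists s0.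
  have [t' [tl tt']] := infinitely_many_true wfW lv ch base a xi (maxn m.+1 (size t).+1).
  move: tl; rewrite geq_max => /andP[mt' tt'l].
  have [_ h] := ind_mono ts0 lab0 tt tt' s0t (ltnW tt'l).
  exists t'; split=> //; first exact: leq_trans (ltnW tt'l).
  apply: leq_ltn_trans mi (h _) => e; by move: tt'l; rewrite e ltnn.
have /choice[u uP] := unb.
(* The index of [u k.+1] has at least k+1 entries, so the default value is never read. *)
pose y k := nth 0 (ind (u k.+1)) k; exists y => k N.
pose t := u (maxn k N); have [tt s0t] := uP (maxn k N).
rewrite !geq_max => /andP[kt Nt] /andP[ki Ni]; exists t; split=> //.
have ty : take k (ind t) = mkseq y k.
  apply: (@eq_from_nth _ 0); first by rewrite size_takel// size_mkseq.
  move=> j; rewrite size_takel// => jk; rewrite nth_take// nth_mkseq// /y.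
  have [tu s0u _ ju] := uP j.+1.
  have [tuj|/ltnW tuj] := leqP (size t) (size (u j.+1)).
    have [[w ->] _] := ind_mono ts0 lab0 tt tu s0t tuj.
    by rewrite nth_cat (leq_trans jk ki).
  have [[w ->] _] := ind_mono ts0 lab0 tu tt s0u tuj.
  by rewrite nth_cat ju.
have gt := good_J (tr_T tt).
apply: (sideal_sub (gn_ideal gt)) (gn_V gt); apply: subsetC.
rewrite lab0// -ty.
have anti l (v w : seq nat) : V l (v ++ w) `<=` V l v.
  elim/last_ind: w => [|w x IHw]; first by rewrite cats0.
  by rewrite -rcons_cat; exact: subset_trans (@V_anti _ _ _) IHw.
by rewrite -{1}(cat_take_drop k (ind t)).
Qed.

(** Properness turns smallness into points: the complement of the Souslin piece and the finitely
    many bad cylinders are all in the ideal of a true stage, so they do not cover the space. *)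
Lemma limit_points g :
  (forall t i, T t -> code i < size t -> J t (~` cyl (@G i (size t) (g t i)))) ->
  exists y : nat -> nat, forall k N, exists l (p : P), [/\ N <= l,
    V (branch_label a) (mkseq y k) p &
    forall i, code i < N -> @G i l (g (mkseq a l) i) (p i)].
Proof.
move=> gP; have [y yP] := limit_index; exists y => k N; have [t [tt Nt JV]] := yP k N.
exists (size t); rewrite -tt.1; have Tt := tr_T tt; have gt := good_J Tt.
have sI := gn_ideal gt.
apply: contrapT => no; apply: (gn_proper gt).
pose F n : set P := [set z | exists i, [/\ code i = n, n < N & ~ @G i (size t) (g t i) (z i)]].
have JF n : J t (F n).
  have [[i [ci nN]]|none] := pselect (exists i, code i = n /\ n < N); last first.
    apply: (sideal_sub sI) (sideal0 sI) => z [i [ci nN _]]; apply: none; by exists i.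
  apply: (sideal_sub sI) (gP t i Tt _); last by rewrite ci; exact: leq_trans Nt.
  by move=> z [j [cj _]]; have -> // : j = i by apply: code_inj; rewrite ci.
apply: (sideal_sub sI) (sidealU sI JV (sideal_bigcup sI JF)) => z _.
have [Vz|] := pselect (V (branch_label a) (mkseq y k) z); last by left.
right; apply: contrapT => nF; apply: no; exists z; split=> // i ciN.
apply: contrapT => nG; apply: nF; exists (code i) => //; exists i; split=> //.
Qed.

End limit.
End construction.

(** * Polish topologies from codings *)

Local Notation RR := Rdefinitions.R.

Lemma cvg_initial {S : choiceType} {T : topologicalType} (f : S -> T) (F : set_system S)
    (s : S) : Filter F -> f @ F --> f s -> F --> (s : initial_topology f).
Proof.
move=> FF h U; rewrite nbhsE => -[_ [[B oB <-] Bs] BU]; apply: filterS BU _.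
by apply: h; exact: open_nbhs_nbhs.
Qed.

Lemma cvg_prod_topology {I : Type} (X : I -> topologicalType) (F : set_system (prod_topology X))
    (x : prod_topology X) : Filter F ->
  (forall i, (fun z : prod_topology X => z i) @ F --> x i) -> F --> x.
Proof. by move=> FF h; apply/cvg_sup => i; apply: cvg_initial; exact: h. Qed.

Lemma continuous_prod_topology {I : Type} (X : I -> topologicalType) (Z : topologicalType)
    (g : Z -> prod_topology X) : (forall i, continuous (fun z => g z i)) -> continuous g.
Proof.
move=> h z; apply: cvg_prod_topology => i; have := h i z.
by rewrite /continuous_at -fmap_comp.
Qed.

Lemma prod_coord_continuous {I : eqType} (X : I -> topologicalType) i :
  continuous (fun z : prod_topology X => z i).
Proof. by have := @proj_continuous I X i. Qed.

Record polish_dist (T : topologicalType) (d : T -> T -> RR) : Prop := PolishDist {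
  pd_refl : forall x, d x x = 0%R;
  pd_eq0 : forall x y, d x y = 0%R -> x = y;
  pd_sym : forall x y, d x y = d y x;
  pd_tri : forall x y z, (d x z <= d x y + d y z)%R;
  pd_open : forall U : set T, open U <->
    forall x, U x -> exists2 e, (0 < e)%R & forall y, (d x y < e)%R -> U y;
  pd_complete : forall x : nat -> T,
    (forall e, (0 < e)%R -> exists N, forall m n, N <= m -> N <= n -> (d (x m) (x n) < e)%R) ->
    exists l, forall e, (0 < e)%R -> exists N, forall n, N <= n -> (d l (x n) < e)%R;
  pd_sep : exists (D : set T) (c : T -> nat), (forall x y, D x -> D y -> c x = c y -> x = y) /\
    forall x e, (0 < e)%R -> exists2 z, D z & (d z x < e)%R }.

Lemma polish_has_dist (T : topologicalType) : polish T -> exists d, polish_dist (T := T) d.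
Proof.
move=> [[D cD dD] [m [oE cM]]]; set M : metricType RR := Metric.Pack m in oE cM.
pose d : M -> M -> RR := mdist.
have openP (U : set M) : @open M U <->
    forall x, U x -> exists2 e, (0 < e)%R & forall y, (d x y < e)%R -> U y.
  rewrite openE; split=> h x Ux.
    have := h x Ux; rewrite /interior => /nbhs_ballP[e /= e0 eU]; exists e => // y dy.
    by apply: eU; rewrite ballEmdist.
  have [e e0 eU] := h x Ux; apply/nbhs_ballP; exists e => //= y; rewrite ballEmdist; exact: eU.
exists d; split.
- by move=> x; exact: (@mdistxx _ M x).
- by move=> x y; exact: (@mdist_positivity _ M x y).
- by move=> x y; exact: (@metric_sym _ M x y).
- by move=> x y z; exact: (@metric_triangle _ M x y z).
- by move=> U; rewrite -openP; split=> /oE.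
- move=> x xC; have [|l hl] := cM (x @ \oo) _.
    apply/cauchy_ballP => e e0; have [N hN] := xC e e0.
    pose Q : set M := [set z | exists2 n, N <= n & z = x n].
    have FQ : (x @ \oo) Q by exists N => // n /= Nn; exists n.
    exists (Q, Q) => // -[_ _] [/= [k Nk ->] [n Nn ->]].
    by rewrite ballEmdist; exact: hN.
  exists l => e e0; have /hl[N _ hN] : nbhs l (ball l e) by exact: nbhsx_ballx.
  by exists N => n Nn; have := hN n Nn; rewrite /= ballEmdist.
- have [c cP] : exists c : T -> nat, {in D &, injective c}.
    have /pcard_leP/unsquash f := cD; exists f => x y; exact: 'inj_f.
  exists D, c; split=> [x y Dx Dy|x e e0]; first by apply: cP; rewrite inE.
  have ne : [set z : T | (d x z < e)%R] !=set0 by exists x; rewrite /= /d (@mdistxx _ M).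
  have op : @open T [set z : T | (d x z < e)%R].
    apply/oE/openP => y /= xy; exists (e - d x y)%R; first by rewrite subr_gt0.
    by move=> z yz; apply: le_lt_trans (@metric_triangle _ M x y z) _; rewrite -ltrBrDl.
  by have [z [zx Dz]] := dD _ ne op; exists z => //; rewrite /d (@metric_sym _ M).
Qed.

Definition ev (Q : nat -> Prop) : Prop := exists N, forall k, N <= k -> Q k.

Lemma ev_and (Q Q' : nat -> Prop) : ev Q -> ev Q' -> ev (fun k => Q k /\ Q' k).
Proof.
move=> [N h] [N' h']; exists (maxn N N') => k; rewrite geq_max => /andP[? ?].
by split; [exact: h|exact: h'].
Qed.

Lemma ev_imp (Q Q' : nat -> Prop) : (forall k, Q k -> Q' k) -> ev Q -> ev Q'.
Proof. by move=> QQ [N h]; exists N => k /h/QQ. Qed.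

Lemma ev_all (Q : nat -> nat -> Prop) N : (forall n, n < N -> ev (Q n)) ->
  ev (fun k => forall n, n < N -> Q n k).
Proof.
elim: N => [_|N IH h]; first by exists 0 => k _ n.
have [|L1 h1] := IH; first by move=> n nN; apply: h; exact: ltnW.
have [L2 h2] := h N (ltnSn N); exists (maxn L1 L2) => k; rewrite geq_max => /andP[k1 k2] n.
by rewrite ltnS leq_eqVlt => /orP[/eqP->|nN]; [exact: h2|exact: h1].
Qed.

Lemma ev_ex (Q : nat -> Prop) : ev Q -> exists k, Q k.
Proof. by move=> [N h]; exists N; exact: h. Qed.

Definition eq_upto {S : Type} (phi : nat -> S -> nat) N (a y : S) : Prop :=
  forall n, n < N -> phi n y = phi n a.

Lemma ev_eq_upto {S : Type} (phi : nat -> S -> nat) (Q : S -> Prop) a :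
  (forall x : nat -> S, (forall n, ev (fun k => phi n (x k) = phi n a)) -> ev (fun k => Q (x k))) ->
  exists N, forall y, eq_upto phi N a y -> Q y.
Proof.
move=> h; apply: contrapT => no.
have /choice[x xP] N : exists y, eq_upto phi N a y /\ ~ Q y.
  apply: contrapT => no'; apply: no; exists N => y ay; apply: contrapT => nQ; apply: no'.
  by exists y.
have [|k Qk] := ev_ex (h x _); last by have [_] := xP k.
by move=> n; exists n.+1 => k nk; have [e _] := xP k; exact: e.
Qed.

Lemma half_pow_lt (e : RR) : (0 < e)%R -> exists N, (2^-1 ^+ N < e)%R.
Proof.
move=> e0; exists (Num.bound e^-1); rewrite exprVn invf_plt ?posrE ?exprn_gt0//.
exact: upper_nthrootP (leqnn _).
Qed.

(* [coded S phi] is [S] with the complete ultrametric topology of [nat -> nat]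
   pulled back along the injection [x |-> (phi n x)_n]. *)
Definition coded (S : choiceType) (phi : nat -> S -> nat)
  (inj : forall x y, (forall n, phi n x = phi n y) -> x = y) : Type := S.

Section coded_metric.
Variables (S : choiceType) (phi : nat -> S -> nat).
Hypothesis inj : forall x y, (forall n, phi n x = phi n y) -> x = y.
Local Notation C := (coded inj).
Local Open Scope ring_scope.

Definition first_diff (x y : C) : nat :=
  xget 0%N [set n | phi n x <> phi n y /\ forall m, (m < n)%N -> phi m x = phi m y].

Lemma first_diffP x y : x <> y -> phi (first_diff x y) x <> phi (first_diff x y) y /\
  forall m, (m < first_diff x y)%N -> phi m x = phi m y.
Proof.
move=> xy; rewrite /first_diff; case: xgetP => [_ ->//|no].
have ex : exists n, phi n x != phi n y.
  apply: contrapT => no'; apply: xy; apply: inj => n; apply: contrapT => /eqP ne.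
  by apply: no'; exists n.
case: (ex_minnP ex) => n /eqP nn min; case: (no n); split=> // m mn.
by apply: contrapT => /eqP/min; rewrite leqNgt mn.
Qed.

Definition cdist (x y : C) : RR := if x == y then 0 else 2^-1 ^+ first_diff x y.

Lemma cdist_lt x y N : (cdist x y < 2^-1 ^+ N) <-> eq_upto phi N.+1 x y.
Proof.
have h0 : (0 < 2^-1 :> RR) by rewrite invr_gt0.
have h1 : (2^-1 < 1 :> RR) by rewrite invf_lt1// ltr1n.
rewrite /cdist; case: eqP => [->|/first_diffP[ne eqs]].
  by split=> // _; rewrite exprn_gt0.
rewrite ltr_iXn2l//; split=> h.
  by move=> n nN; apply/esym/eqs; exact: leq_trans h.
rewrite ltnNge; apply/negP => fN; apply: ne; apply/esym/h; by rewrite ltnS.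
Qed.

Lemma cdist_le x y z : cdist x z <= Num.max (cdist x y) (cdist y z).
Proof.
rewrite leNgt; apply/negP; rewrite gt_max => /andP[]; rewrite {2 4}/cdist.
case: eqP => [_|/first_diffP[ne eqs]].
  by rewrite /cdist; case: ifP => _; rewrite ltNge ?lexx// exprn_ge0// invr_ge0.
move=> /cdist_lt h1 /cdist_lt h2; apply: ne.
by rewrite -(h1 (first_diff x z) (ltnSn _)) (h2 (first_diff x z) (ltnSn _)).
Qed.

Lemma cdist_ge0 x y : 0 <= cdist x y.
Proof. by rewrite /cdist; case: ifP => // _; rewrite exprn_ge0// invr_ge0. Qed.

Let cdistxx x : cdist x x = 0. Proof. by rewrite /cdist eqxx. Qed.

Let cdist_positivity x y : cdist x y = 0 -> x = y.
Proof.
rewrite /cdist; case: eqP => // _ /eqP; rewrite expf_eq0 invr_eq0 pnatr_eq0.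
by rewrite andbF.
Qed.

Let cdist_sym x y : cdist x y = cdist y x.
Proof.
rewrite /cdist eq_sym; case: ifP => // _; congr (_ ^+ _); rewrite /first_diff.
congr xget; apply/seteqP; split=> n [h1 h2]; split; first [exact/nesym|by move=> m /h2].
Qed.

Let cdist_triangle y x z : cdist x z <= cdist x y + cdist y z.
Proof.
apply: le_trans (cdist_le x y z) _; rewrite ge_max lerDl lerDr.
by rewrite !cdist_ge0.
Qed.

HB.instance Definition _ := Choice.on C.
HB.instance Definition _ := @isMetric.Build RR C cdist cdistxx cdist_positivity
  cdist_sym cdist_triangle.

Lemma coded_nbhs (x : C) U : nbhs x U <-> exists N, forall y, eq_upto phi N x y -> U y.
Proof.
split.
  move=> /nbhs_ballP[e /= e0 eU].
  have [N Ne] := half_pow_lt e0.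
  exists N.+1 => y /cdist_lt h; apply: eU; rewrite ballEmdist /=; exact: lt_trans Ne.
move=> [N h]; apply/nbhs_ballP; exists (2^-1 ^+ N); first by rewrite /= exprn_gt0// invr_gt0.
move=> y; rewrite ballEmdist /= => /cdist_lt e; apply: h => n nN; apply: e.
exact: leqW.
Qed.

Lemma coded_open (U : set C) : open U <->
  forall x, U x -> exists N, forall y, eq_upto phi N x y -> U y.
Proof.
rewrite openE; split=> h x Ux; first exact/coded_nbhs/(h x Ux).
by apply/coded_nbhs; exact: h.
Qed.

Lemma coded_clopen_eq (x : C) N : clopen [set y : C | eq_upto phi N x y].
Proof.
split; first by apply/coded_open => y xy; exists N => z yz n nN; rewrite yz// xy.
rewrite -openC; apply/coded_open => y nxy; exists N => z yz xz; apply: nxy => n nN.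
by rewrite -xz// yz.
Qed.

Lemma coded_clopen_basis : clopen_basis C.
Proof.
split=> [U []//|x U /coded_nbhs[N h]].
by exists [set y : C | eq_upto phi N x y] => //; split=> //; exact: coded_clopen_eq.
Qed.

(** The hypothesis says that the image of the coding is closed in the Baire space. *)
Lemma coded_polish :
  (forall (x : nat -> S) y, (forall n, ev (fun k => phi n (x k) = y n)) ->
     exists a, forall n, phi n a = y n) -> polish C.
Proof.
move=> gd; split.
  pose pt (u : seq nat) : set C := [set x | forall n, (n < size u)%N -> phi n x = nth 0%N u n].
  have [[x0 _]|noC] := pselect ([set: C] !=set0); last first.
    exists set0; first exact: countable0.
    by move=> O [x Ox]; case: noC; exists x.
  exists ((fun u => xget x0 (pt u)) @` [set: seq nat]).
    exact: sub_countable (card_image_le _ _) (countableP _).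
  move=> O [x Ox] /coded_open/(_ x Ox)[N h].
  pose u := mkseq (fun n => phi n x) N.
  have xu : pt u x by move=> n; rewrite size_mkseq => nN; rewrite nth_mkseq.
  exists (xget x0 (pt u)); split; last by exists u.
  apply: h => n nN; have : pt u (xget x0 (pt u)) by exact: xgetPex (ex_intro _ x xu).
  by move=> /(_ n); rewrite size_mkseq => /(_ nN) ->; rewrite nth_mkseq.
exists (Metric.class C); split=> // F FF /cauchy_ballP Fc.
have /choice[z zP] n : exists z : C, F [set y | eq_upto phi n.+1 z y].
  have e0 : 0 < 2^-1 ^+ n :> RR by rewrite exprn_gt0// invr_gt0.
  have [[A B] [/= FA FB] AB] := Fc _ e0.
  have [z Az] := filter_ex FA; exists z; apply: filterS FB => y By.
  by have := AB (z, y) (conj Az By); rewrite /= ballEmdist => /cdist_lt.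
have zz n m : (n <= m)%N -> phi n (z m) = phi n (z n).
  move=> nm; have [y [zy zy']] := filter_ex (filterI (zP n) (zP m)).
  by rewrite -zy// ?zy'// ltnS.
have [|a aP] := gd z (fun n => phi n (z n)).
  by move=> n; exists n => k; exact: zz.
exists a => U /coded_nbhs[N h]; apply: filterS (zP N) => y zy; apply: h => n nN.
have nN1 : (n < N.+1)%N by exact: ltnW.
by rewrite (zy n nN1) aP; apply: zz; exact: ltnW.
Qed.

End coded_metric.

(* [lst Q] is one more than the least element of [Q], and [0] if [Q] is empty. *)
Definition lst_spec (Q : nat -> Prop) n : Prop :=
  if n is m.+1 then Q m /\ forall k, k < m -> ~ Q k else forall k, ~ Q k.

Definition lst (Q : nat -> Prop) : nat := xget 0 [set n | lst_spec Q n].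

Lemma lst_unique Q n m : lst_spec Q n -> lst_spec Q m -> n = m.
Proof.
case: n m => [|n] [|m] //=; first by move=> h [/h].
- by move=> [h _] /(_ n).
- move=> [Qn hn] [Qm hm]; have [nm|mn|-> //] := ltngtP n m; first by case: (hm n nm).
  by case: (hn m mn).
Qed.

Lemma lstP Q : lst_spec Q (lst Q).
Proof.
rewrite /lst; case: xgetP => [_ ->//|no].
have [ex|none] := pselect (exists k, `[< Q k >]); last first.
  by case: (no 0) => k Qk; apply: none; exists k; apply/asboolP.
case: (ex_minnP ex) => m /asboolP Qm min; case: (no m.+1); split=> // k km Qk.
by have := min k; rewrite leqNgt km => h; have := h (asboolT Qk).
Qed.

Lemma lstE Q n : lst_spec Q n -> lst Q = n. Proof. exact: lst_unique (lstP Q). Qed.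

Lemma lst_eq0 Q : lst Q = 0 <-> forall k, ~ Q k.
Proof. by split=> [e|h]; [have := lstP Q; rewrite e|exact: lstE]. Qed.

(** * Codings that refine a Polish topology *)

Section codings.
Variable T : topologicalType.

Definition scvg (x : nat -> T) a : Prop := forall U, open U -> U a -> ev (fun k => U (x k)).

(** In topological terms, the image of the coding is closed in the Baire space and convergence of
    codes implies convergence in [T]. *)
Definition good (phi : nat -> T -> nat) : Prop := forall x y,
  (forall n, ev (fun k => phi n (x k) = y n)) ->
  exists a, (forall n, phi n a = y n) /\ scvg x a.

(** Sequential form of being clopen for the topology of the coding. *)
Definition decided (phi : nat -> T -> nat) (B : set T) : Prop := forall x a,
  (forall n, ev (fun k => phi n (x k) = phi n a)) -> ev (fun k => B (x k) <-> B a).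

Lemma decidedC phi B : decided phi B -> decided phi (~` B).
Proof. by move=> h x a /h; apply: ev_imp => k e; split=> nB /e. Qed.

Lemma decided_sub phi phi' B : (forall n, exists m, phi n = phi' m) ->
  decided phi B -> decided phi' B.
Proof. by move=> sub h x a e; apply: h => n; have [m ->] := sub n. Qed.

Lemma good_finer phi U a : (forall a b, (forall n, phi n a = phi n b) -> a = b) ->
  good phi -> open U -> U a -> exists N, forall y, eq_upto phi N a y -> U y.
Proof.
move=> inj g oU Ua; apply: ev_eq_upto => x xa; have [b [bP xb]] := g x _ xa.
by apply: xb => //; rewrite (inj _ _ bP).
Qed.

Definition add_least phi (B : nat -> set T) : nat -> T -> nat :=
  fun n => if n is m.+1 then phi m else fun x => lst (fun k => B k x).

(** The new coordinate has a closed graph: each [B k] is eventually decided along the sequence as at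
    the limit, so the stable value of the least index is also its value at the limit. Thus a
    countable union of clopen sets can be made clopen. *)
Lemma add_least_good phi B : good phi -> (forall k, decided phi (B k)) -> good (add_least phi B).
Proof.
move=> g dB x y h; have [|a [aP xa]] := g x (fun n => y n.+1); first by move=> n; exact: (h n.+1).
exists a; split=> // -[|n]; last exact: aP.
have dec k : ev (fun j => B k (x j) <-> B k a).
  by apply: dB => n; rewrite aP; exact: (h n.+1).
have h0 : ev (fun k => lst (fun j => B j (x k)) = y 0) := h 0.
apply: lstE; case e : (y 0) => [|m].
  move=> k Bk; have [j [h1 h2]] := ev_ex (ev_and h0 (dec k)).
  by move: h1; rewrite e => /lst_eq0/(_ k); apply; apply/h2.
split.
  have [j [h1 h2]] := ev_ex (ev_and h0 (dec m)); apply/h2.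
  by have := lstP (fun i => B i (x j)); rewrite h1 e => -[].
move=> k km Bk; have [j [h1 h2]] := ev_ex (ev_and h0 (dec k)).
by have := lstP (fun i => B i (x j)); rewrite h1 e => -[_ /(_ k km)]; apply; apply/h2.
Qed.

Lemma add_least_decided phi B : decided (add_least phi B) (\bigcup_k B k).
Proof.
move=> x a h; apply: ev_imp (h 0) => k /= e.
have iff z : (\bigcup_k B k) z <-> lst (fun j => B j z) <> 0.
  split; first by move=> [j _ Bj] /lst_eq0/(_ j).
  by move=> ne; apply: contrapT => nB; apply: ne; apply/lst_eq0 => j Bj; apply: nB; exists j.
by rewrite !iff e.
Qed.

Definition join_coding (phis : nat -> nat -> T -> nat) : nat -> T -> nat :=
  fun k => let nm : nat * nat := odflt (0, 0) (unpickle k) in phis nm.1 nm.2.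

Lemma join_codingE phis n m : join_coding phis (pickle (n, m)) = phis n m.
Proof. by rewrite /join_coding pickleK. Qed.

Lemma join_decided phis n B : decided (phis n) B -> decided (join_coding phis) B.
Proof. by apply: decided_sub => m; exists (pickle (n, m)); rewrite join_codingE. Qed.

Variable d : T -> T -> RR.
Hypothesis hd : polish_dist d.
Local Open Scope ring_scope.

Lemma ball_open a e : open [set y | d a y < e].
Proof.
apply/(pd_open hd) => y /= ay; exists (e - d a y); first by rewrite subr_gt0.
by move=> z yz; apply: le_lt_trans (pd_tri hd a y z) _; rewrite -ltrBrDl.
Qed.

Lemma pd_ge0 a b : 0 <= d a b.
Proof.
have := pd_tri hd a b a; rewrite (pd_refl hd) (pd_sym hd b a) -mulr2n.
by rewrite pmulrn_lge0.
Qed.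

Lemma scvg_dist x a e : 0 < e -> scvg x a -> ev (fun k => d a (x k) < e).
Proof. by move=> e0 xa; apply: (xa _ (ball_open a e)); rewrite /= (pd_refl hd). Qed.

Lemma dist_scvg x a : (forall e, 0 < e -> ev (fun k => d a (x k) < e)) -> scvg x a.
Proof.
move=> h U /(pd_open hd) oU Ua; have [e e0 eU] := oU a Ua.
by apply: ev_imp (h e e0) => k; exact: eU.
Qed.

Lemma scvg_unique x a b : scvg x a -> scvg x b -> a = b.
Proof.
move=> xa xb; apply: (pd_eq0 hd); apply/eqP; rewrite eq_le pd_ge0 andbT leNgt.
apply/negP => d0; have e0 : 0 < d a b / 2 by rewrite divr_gt0.
have [k [h1 h2]] := ev_ex (ev_and (scvg_dist e0 xa) (scvg_dist e0 xb)).
have := pd_tri hd a (x k) b; rewrite (pd_sym hd (x k) b).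
lra.
Qed.

(** The sequence alternating between two points with equal codes has stable codes, hence converges,
    and its limit is both points. *)
Lemma good_inj phi : good phi -> forall a b, (forall n, phi n a = phi n b) -> a = b.
Proof.
move=> g a b e; pose x k := if odd k then a else b.
have [|c [_ xc]] := g x (fun n => phi n a).
  by move=> n; exists 0%N => k _; rewrite /x; case: ifP.
have ca z : (forall N, exists2 k, (N <= k)%N & x k = z) -> c = z.
  move=> hz; apply: (@scvg_unique (fun=> z)) => [U oU Uc|U _ Uz]; last by exists 0%N.
  have [N hN] := xc U oU Uc; exists 0%N => _ _; have [k Nk <-] := hz N; exact: hN.
rewrite -(ca a) ?(ca b)//.
  by move=> N; exists N.*2; [lia|rewrite /x odd_double].
by move=> N; exists N.*2.+1; [lia|rewrite /x /= odd_double].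
Qed.

(** The limits provided by the single codings are limits in [T] of one sequence, so they
    coincide. *)
Lemma join_good phis : (forall n, good (phis n)) -> good (join_coding phis).
Proof.
move=> g x y h.
have /choice[a aP] n : exists a, (forall m, phis n m a = y (pickle (n, m))) /\ scvg x a.
  by apply: g => m; have := h (pickle (n, m)); rewrite join_codingE.
exists (a 0%N); split; last exact: (aP 0%N).2.
move=> k; have := h k; rewrite /join_coding; set nm := odflt _ _ => hk.
have e : a 0%N = a nm.1 by apply: scvg_unique (aP _).2 (aP _).2.
have [j [h1 h2]] := ev_ex (ev_and hk (h (pickle nm))).
by rewrite e (aP nm.1).1 -h1 -surjective_pairing -h2 /join_coding pickleK.
Qed.

Section base.
Variables (D : set T) (c : T -> nat).
Hypothesis c_inj : forall x y, D x -> D y -> c x = c y -> x = y.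
Hypothesis D_dense : forall x e, 0 < e -> exists2 z, D z & d z x < e.

(* Closed balls and complements of open balls: each complement is a countable
   union of such sets, so recording the index of the piece decides all of them. *)
Definition bset (p : bool * nat * rat) : set T :=
  let: (b, j, q) := p in
  if b then [set x | exists z, [/\ D z, c z = j & d z x <= ratr q]]
  else [set x | forall z, D z -> c z = j -> ratr q <= d z x].

Definition bpiece (p : bool * nat * rat) (k : nat) : bool * nat * rat :=
  let: (b, j, q) := p in (~~ b, j, if b then q + 2^-1 ^+ k else q - 2^-1 ^+ k).

Let ratr_half k : ratr (2^-1 ^+ k) = 2^-1 ^+ k :> RR.
Proof. by rewrite rmorphXn fmorphV rmorph_nat. Qed.

Lemma bset_compl p : ~` bset p = \bigcup_k bset (bpiece p k).
Proof.
case: p => -[b j] q; apply/seteqP; split=> x; case: b => /=.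
- move=> no; have [[z [Dz cz]]|none] := pselect (exists z, D z /\ c z = j); last first.
    by exists 0%N => //= z Dz cz; case: none; exists z.
  have qz : ratr q < d z x.
    by rewrite ltNge; apply/negP => le; apply: no; exists z.
  have [k hk] := half_pow_lt (eq_ind_r (fun b : bool => b) qz (subr_gt0 _ _)).
  exists k => //= z' Dz' cz'; have -> : z' = z by apply: c_inj => //; rewrite cz.
  by rewrite rmorphD /= ratr_half -lerBrDl ltW.
- move=> no; have [z [Dz cz zq]] : exists z, [/\ D z, c z = j & d z x < ratr q].
    apply: contrapT => none; apply: no => z Dz cz; rewrite leNgt; apply/negP => zq.
    by apply: none; exists z.
  have [k hk] := half_pow_lt (eq_ind_r (fun b : bool => b) zq (subr_gt0 _ _)).
  exists k => //=; exists z; split=> //; rewrite rmorphB /= ratr_half.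
  by rewrite lerBrDl -lerBrDr ltW.
- move=> [k _ /= h] [z [Dz cz zq]]; have := h z Dz cz; rewrite rmorphD /= ratr_half.
  rewrite leNgt => /negP; apply; apply: le_lt_trans zq _.
  by rewrite ltrDl exprn_gt0// invr_gt0.
- move=> [k _ /= [z [Dz cz zq]]] h; have := h z Dz cz; rewrite leNgt => /negP; apply.
  apply: le_lt_trans zq _; rewrite rmorphB /= ratr_half gtrDl oppr_lt0.
  by rewrite exprn_gt0// invr_gt0.
Qed.

Lemma bset_closed p x a : scvg x a -> ev (fun k => bset p (x k)) -> bset p a.
Proof.
case: p => -[[] j] q xa h /=.
  have [k /= [z [Dz cz _]]] := ev_ex h; exists z; split=> //; rewrite leNgt; apply/negP => lt.
  have e0 : 0 < d z a - ratr q by rewrite subr_gt0.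
  have [i [[z' [Dz' cz' zq]] h2]] := ev_ex (ev_and h (scvg_dist e0 xa)).
  have e : z' = z by apply: c_inj => //; rewrite cz.
  have := pd_tri hd z (x i) a; rewrite (pd_sym hd (x i) a) -e; move: h2 zq; rewrite -e; lra.
move=> z Dz cz; rewrite leNgt; apply/negP => lt.
have e0 : 0 < ratr q - d z a by rewrite subr_gt0.
have [i [/= h1 h2]] := ev_ex (ev_and h (scvg_dist e0 xa)).
have := h1 z Dz cz; have := pd_tri hd z a (x i); lra.
Qed.

Definition bcode p (x : T) : nat := lst (fun k => bset (bpiece p k) x).

Lemma bcode_eq0 p x : bcode p x = 0%N <-> bset p x.
Proof.
rewrite /bcode lst_eq0; split=> [h|h k hk].
  by apply: contrapT => nB; have : (~` bset p) x by []; rewrite bset_compl => -[k _]; exact: h.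
by have : (~` bset p) x; [rewrite bset_compl; exists k|apply].
Qed.

(** All pieces are closed, so membership passes to the limit; non-membership passes too, because
    each piece has a code of its own, which vanishes exactly on it. *)
Lemma bcode_limit x a (y : bool * nat * rat -> nat) : scvg x a ->
  (forall p, ev (fun k => bcode p (x k) = y p)) -> forall p, bcode p a = y p.
Proof.
move=> xa h.
have mem p : bset p a <-> y p = 0%N.
  split=> [pa|yp]; last first.
    by apply: (bset_closed xa); apply: ev_imp (h p) => k; rewrite yp => /bcode_eq0.
  case e : (y p) => [//|m]; have : bset (bpiece p m) a.
    apply: (bset_closed xa); apply: ev_imp (h p) => k hk.
    by have := lstP (fun k' => bset (bpiece p k') (x k)); rewrite -/(bcode p (x k)) hk e => -[].
  move=> ha; have : (~` bset p) a by rewrite bset_compl; exists m.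
  by [].
move=> p; apply: lstE; case e : (y p) => [|m].
  move=> k hk; have : (~` bset p) a by rewrite bset_compl; exists k.
  by apply; apply/mem.
have ev_spec k : bcode p (x k) = y p -> lst_spec (fun k' => bset (bpiece p k') (x k)) m.+1.
  by move=> hk; rewrite -e -hk; exact: lstP.
split.
  by apply: (bset_closed xa); apply: ev_imp (h p) => k /ev_spec[].
move=> k km /mem yk; have [i [/ev_spec[_ /(_ k km) nk] h1]] := ev_ex (ev_and (h p) (h (bpiece p k))).
by apply: nk; apply/bcode_eq0; rewrite h1.
Qed.

Definition near_code m (x : T) : nat :=
  lst (fun j => exists z, [/\ D z, c z = j & d z x < 2^-1 ^+ m]).

Definition base_coding (n : nat) : T -> nat :=
  match (unpickle n : option ((bool * nat * rat) + nat)) with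
  | Some (inl p) => bcode p
  | Some (inr m) => near_code m
  | None => fun=> 0%N
  end.

Lemma base_coding_l p : base_coding (pickle (inl p : _ + nat)) = bcode p.
Proof. by rewrite /base_coding pickleK. Qed.

Lemma base_coding_r m : base_coding (pickle (inr m : (bool * nat * rat) + _)) = near_code m.
Proof. by rewrite /base_coding pickleK. Qed.

Let halfp m : 0 < 2^-1 ^+ m :> RR. Proof. by rewrite exprn_gt0// invr_gt0. Qed.

(** A stable [near_code m] puts the tail of the sequence within 2^-m of one dense point, so the
    sequence is Cauchy. The codes of closed pieces then make all coordinates stabilise at their
    values at the limit. *)
Lemma base_good : good base_coding.
Proof.
move=> x y h.
have hp p : ev (fun k => bcode p (x k) = y (pickle (inl p : _ + nat))).
  by have := h (pickle (inl p : _ + nat)); rewrite base_coding_l.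
have hm m : ev (fun k => near_code m (x k) = y (pickle (inr m : (bool * nat * rat) + _))).
  by have := h (pickle (inr m : (bool * nat * rat) + _)); rewrite base_coding_r.
have [|a ha] := pd_complete hd (x := x).
  move=> e e0; have e20 : 0 < e / 2 by rewrite divr_gt0.
  have [m me] := half_pow_lt e20; have [N hN] := hm m; exists N => i k Ni Nk.
  have := lstP (fun j => exists z, [/\ D z, c z = j & d z (x i) < 2^-1 ^+ m]).
  rewrite -/(near_code m (x i)) hN//.
  have := lstP (fun j => exists z, [/\ D z, c z = j & d z (x k) < 2^-1 ^+ m]).
  rewrite -/(near_code m (x k)) hN//; case: (y _) => [/= no|j].
    by have [z Dz zx] := D_dense (x k) (halfp m); case: (no (c z)); exists z.
  move=> [[z [Dz cz zk]] _] [[z' [Dz' cz' zi]] _].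
  have e1 : z' = z by apply: c_inj => //; rewrite cz.
  rewrite e1 in zi; have := pd_tri hd (x i) z (x k); rewrite (pd_sym hd (x i) z); lra.
have xa : scvg x a by apply: dist_scvg => e e0; have [N hN] := ha e e0; exists N.
have bl := bcode_limit xa hp.
have mem p : ev (fun k => bset p (x k) <-> bset p a).
  by apply: ev_imp (hp p) => k hk; rewrite -!bcode_eq0 hk bl.
exists a; split=> // n; have := h n; rewrite /base_coding.
case en : (unpickle n) => [[p|m]|] hn; last by have [k] := ev_ex hn.
  have [k [h1 h2]] := ev_ex (ev_and hn (hp p)); by rewrite bl -h2.
(* An open ball is the complement of a piece, so membership in it is decided by the other
   coordinates. *)
have near j z : (exists w, [/\ D w, c w = j & d w z < 2^-1 ^+ m]) <-> ~ bset (false, j, 2^-1 ^+ m) z.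
  rewrite /= ratr_half; split=> [[w [Dw cw wz]] /(_ w Dw cw)|no].
    by rewrite leNgt wz.
  apply: contrapT => none; apply: no => w Dw cw; rewrite leNgt; apply/negP => wz.
  by apply: none; exists w.
apply: lstE; case e : (y n) => [|j].
  have [k] := ev_ex hn; rewrite e => /lst_eq0 no.
  by have [z Dz zx] := D_dense (x k) (halfp m); case: (no (c z)); exists z.
have spec k : near_code m (x k) = y n ->
    lst_spec (fun j => exists z, [/\ D z, c z = j & d z (x k) < 2^-1 ^+ m]) j.+1.
  by move=> hk; rewrite -e -hk; exact: lstP.
split.
  have [k [/spec[h1 _] h2]] := ev_ex (ev_and hn (mem (false, j, 2^-1 ^+ m))).
  by apply/near => /h2; apply/near.
move=> i ij /near; apply.
have [k [/spec[_ /(_ i ij) h1] h2]] := ev_ex (ev_and hn (mem (false, i, 2^-1 ^+ m))).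
by apply/h2; apply: contrapT => /near.
Qed.

Lemma base_decided p : decided base_coding (bset p).
Proof.
move=> x a h; have := h (pickle (inl p : _ + nat)); rewrite base_coding_l.
by apply: ev_imp => k e; rewrite -!bcode_eq0 e.
Qed.

Lemma open_bset U : open U -> exists B : nat -> bool * nat * rat,
  U = \bigcup_k (bset (B k)) \/ U = set0.
Proof.
move=> oU; have [[x0 Ux0]|no] := pselect (U !=set0); last first.
  by exists (fun=> (true, 0%N, 0)); right; apply/seteqP; split=> // x Ux; case: no; exists x.
have inner x : U x -> exists2 p, bset p x & bset p `<=` U.
  move=> Ux; have [e e0 eU] := (pd_open hd U).1 oU x Ux.
  have e20 : 0 < e / 2 by rewrite divr_gt0.
  have [m me] := half_pow_lt e20; have [z Dz zx] := D_dense x (halfp m).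
  exists (true, c z, 2^-1 ^+ m) => /=; first by exists z; rewrite ratr_half ltW.
  move=> w [z' [Dz' cz' zw]]; apply: eU; have e1 : z' = z by exact: c_inj.
  rewrite e1 ratr_half in zw.
  have := pd_tri hd x z w; rewrite (pd_sym hd x z); lra.
have [p0 _ p0U] := inner x0 Ux0.
pose B k := if unpickle k is Some p then (if `[< bset p `<=` U >] then p else p0) else p0.
exists B; left; apply/seteqP; split=> x.
  move=> Ux; have [p px pU] := inner x Ux; exists (pickle p) => //.
  by rewrite /B pickleK; case: asboolP.
by move=> [k _]; rewrite /B; case: unpickle => [p|] //; [case: asboolP => //|]; [exact|move=> _; exact: p0U|exact: p0U].
Qed.

End base.

Lemma exists_good : exists phi, good phi.
Proof.
have [D [c [c_inj D_dense]]] := pd_sep hd.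
by exists (base_coding D c); exact: base_good.
Qed.

(** The sets decided by some good coding form a sigma-algebra containing the open sets. This is the
    classical theorem that a Borel set becomes clopen in a finer Polish topology. *)
Lemma borel_decided B : borel B -> exists phi, good phi /\ decided phi B.
Proof.
move=> hB; pose S : set (set T) := [set A | exists phi, good phi /\ decided phi A].
apply: (hB S); split.
  have [phi g] := exists_good; split.
  - by exists phi; split=> // x a _; exists 0%N.
  - by move=> A [psi [gp dA]]; exists psi; split=> //; rewrite setTD; exact: decidedC.
  - move=> F /(_ _)/cid h; pose phis n := projT1 (h n).
    have hphi n : good (phis n) /\ decided (phis n) (F n) := projT2 (h n).
    exists (add_least (join_coding phis) F); split; last exact: add_least_decided.
    apply: add_least_good; first by apply: join_good => n; have [] := hphi n.
    by move=> k; apply: (@join_decided phis k); have [] := hphi k.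
move=> U oU; have [D [c [c_inj D_dense]]] := pd_sep hd.
have g := base_good c_inj D_dense.
have [p [->|->]] := open_bset c_inj D_dense oU; last first.
  by exists (base_coding D c); split=> // x a _; exists 0%N.
exists (add_least (base_coding D c) (fun k => bset D c (p k))); split; last exact: add_least_decided.
by apply: add_least_good => // k; exact: base_decided.
Qed.

End codings.

(** * Potential classes and topologies *)

Lemma open_pre (S T : topologicalType) (f : S -> T) (A : set T) : continuous f ->
  open A -> open (f @^-1` A).
Proof. by move=> /continuousP; exact. Qed.

Lemma continuous_prod_map {I : eqType} (Y Y' : I -> topologicalType) (f : forall i, Y i -> Y' i) :
  (forall i, continuous (f i)) ->
  continuous (fun z : prod_topology Y => (fun i => f i (z i)) : prod_topology Y').
Proof.
move=> cf; apply: continuous_prod_topology => i z.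
exact: (@continuous_comp (prod_topology Y) (Y i) (Y' i) (fun z => z i) (f i) z
  (@prod_coord_continuous I Y i z) (cf i _)).
Qed.

Lemma is_Sigma0_preimage {disp : Order.disp_t} {W : orderType disp} (xi : W)
    (T U : topologicalType) (f : T -> U) (A : set U) : continuous f ->
  is_Sigma0 xi A -> is_Sigma0 xi (f @^-1` A).
Proof.
move=> cf; elim=> [{}xi {}A h oA|{}xi eta F h1 h2 IH].
  by apply: is_Sigma0_open => //; exact: open_pre cf oA.
by rewrite preimage_bigcup; apply: is_Sigma0_bigcup h1 _ => n; rewrite preimage_setC.
Qed.

Lemma borel_sigma (T : topologicalType) : sigma_algebra setT (@borel T).
Proof. exact: smallest_sigma_algebra. Qed.

Lemma borelC (T : topologicalType) (A : set T) : borel A -> borel (~` A).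
Proof. by move=> bA; rewrite -setTD; have [_ h _] := borel_sigma T; exact: h. Qed.

Lemma borelU (T : topologicalType) (F : nat -> set T) : (forall n, borel (F n)) ->
  borel (\bigcup_n F n).
Proof. by have [_ _ h] := borel_sigma T; exact: h. Qed.

Lemma borel0 (T : topologicalType) : borel (set0 : set T).
Proof. by have [h _ _] := borel_sigma T. Qed.

Lemma borel_open (T : topologicalType) (U : set T) : open U -> borel U.
Proof. exact: sub_sigma_algebra. Qed.

Lemma borel_preimage (T U : topologicalType) (f : T -> U) (A : set U) : continuous f ->
  borel A -> borel (f @^-1` A).
Proof.
move=> cf bA; apply: (bA [set B | borel (f @^-1` B)]); split.
  split=> [|B bB|F bF] /=.
  - by rewrite preimage_set0; exact: borel0.
  - by rewrite setTD preimage_setC; exact: borelC.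
  - by rewrite preimage_bigcup; exact: borelU.
by move=> B oB; apply: borel_open; exact: open_pre cf oB.
Qed.

Record gcode (T : topologicalType) := GCode {
  gphi : nat -> T -> nat;
  gphi_inj : forall x y, (forall n, gphi n x = gphi n y) -> x = y;
  gphi_good : good gphi }.

Arguments gphi_inj {T} g x y.
Arguments gphi_good {T} g.

Definition ctop (T : topologicalType) (g : gcode T) : topologicalType := coded (gphi_inj g).

Lemma ctop_finer (T : topologicalType) (g : gcode T) (U : set T) : @open T U -> @open (ctop g) U.
Proof.
by move=> oU; apply/coded_open => x Ux; exact: good_finer (gphi_inj g) (gphi_good g) oU Ux.
Qed.

Lemma ctop_basis (T : topologicalType) (g : gcode T) : clopen_basis (ctop g).
Proof. exact: coded_clopen_basis. Qed.

Lemma ctop_polish (T : topologicalType) (g : gcode T) : polish (ctop g).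
Proof. by apply: coded_polish => x y /(gphi_good g)[a [? _]]; exists a. Qed.

Lemma ctop_decided (T : topologicalType) (g : gcode T) (B : set T) : decided (gphi g) B ->
  @clopen (ctop g) B.
Proof.
move=> dB; have op C : decided (gphi g) C -> @open (ctop g) C.
  move=> dC; apply/coded_open => x Cx.
  have [N hN] := ev_eq_upto (Q := fun y => C y <-> C x) (a := x) (fun z => dC z x).
  by exists N => y /hN ->.
by split; [exact: op|rewrite -openC; apply: op; exact: decidedC].
Qed.

Lemma polish_gcode (T : topologicalType) (B : set T) : polish T -> borel B ->
  exists g : gcode T, decided (gphi g) B.
Proof.
move=> /polish_has_dist[d hd] /(borel_decided hd)[phi [gp dp]].
by exists (GCode (good_inj hd gp) gp).
Qed.

Lemma gjoin_exists (T : topologicalType) (gs : nat -> gcode T) : polish T ->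
  exists g : gcode T, gphi g = join_coding (fun n => gphi (gs n)).
Proof.
move=> /polish_has_dist[d hd].
have gd : good (join_coding (fun n => gphi (gs n))) by apply: (join_good hd) => n; exact: gphi_good.
by exists (GCode (good_inj hd gd) gd).
Qed.

Definition gjoin (T : topologicalType) (pT : polish T) (gs : nat -> gcode T) : gcode T :=
  projT1 (cid (gjoin_exists gs pT)).

Lemma gjoinE (T : topologicalType) (pT : polish T) (gs : nat -> gcode T) :
  gphi (gjoin pT gs) = join_coding (fun n => gphi (gs n)).
Proof. exact: projT2 (cid (gjoin_exists gs pT)). Qed.

Lemma ctop_continuous (T : topologicalType) (g g' : gcode T) :
  (forall n, exists m, gphi g n = gphi g' m) ->
  continuous (fun x : ctop g' => (x : ctop g)).
Proof.
move=> sub; apply/continuousP => U /coded_open oU; apply/coded_open => a Ua.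
have [N hN] := oU a Ua; apply: ev_eq_upto => x xa.
apply: ev_imp (ev_all (Q := fun n k => gphi g n (x k) = gphi g n a) (N := N) _) => [k e|n nN].
  exact: hN.
by have [m ->] := sub n.
Qed.

(** * From the abstract potential hierarchy to topologies *)

Section pS_pot.
Context {I : choiceType} {X : I -> topologicalType}.
Hypothesis hX : forall i, polish (X i).
Context {disp : Order.disp_t} {W : orderType disp}.
Hypothesis wfW : well_founded (fun x y : W => (x < y)%O).
Local Notation bor := (fun i => @borel (X i)).
Local Notation P := (forall i, X i).
Implicit Types (G : forall i, gcode (X i)) (C : set P).

Definition ptop G : topologicalType := prod_topology (fun i => ctop (G i)).

Definition jointG (Gs : nat -> forall i, gcode (X i)) i : gcode (X i) :=
  gjoin (hX i) (fun n => Gs n i).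

Lemma jointG_continuous Gs n : continuous (fun x : ptop (jointG Gs) => (x : ptop (Gs n))).
Proof.
apply: (@continuous_prod_map I (fun i => ctop (jointG Gs i)) (fun i => ctop (Gs n i)) (fun i x => x)) => i.
apply: (@ctop_continuous _ (Gs n i) (jointG Gs i)) => m.
by exists (pickle (n, m)); rewrite /jointG gjoinE join_codingE.
Qed.

Lemma clopen_preimage (S T : topologicalType) (f : S -> T) (A : set T) : continuous f ->
  clopen A -> clopen (f @^-1` A).
Proof.
move=> cf [oA cA]; split; first exact: open_pre cf oA.
by rewrite -openC preimage_setC; apply: open_pre cf _; rewrite openC.
Qed.

Lemma jointG_clopen Gs n C : @clopen (ptop (Gs n)) C -> @clopen (ptop (jointG Gs)) C.
Proof.
exact: (@clopen_preimage (ptop (jointG Gs)) (ptop (Gs n)) (fun x => x) C (@jointG_continuous Gs n)).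
Qed.

Lemma jointG_Sigma0 Gs n (x : W) C :
  @is_Sigma0 _ W (ptop (Gs n)) x C -> @is_Sigma0 _ W (ptop (jointG Gs)) x C.
Proof.
exact: (@is_Sigma0_preimage _ W x (ptop (jointG Gs)) (ptop (Gs n)) (fun x => x) C
  (@jointG_continuous Gs n)).
Qed.

Lemma exists_gcodes : exists G : forall i, gcode (X i), True.
Proof.
have /(_ _)/cid h i : exists g : gcode (X i), decided (gphi g) set0.
  by apply: polish_gcode => //; exact: borel0.
by exists (fun i => projT1 (h i)).
Qed.

Lemma box_clopen C : box_algebra (X := X) bor C -> exists G, @clopen (ptop G) C.
Proof.
elim=> {C} [i D bD|C _ [G [oC cC]]|C D _ [G1 hC] _ [G2 hD]|].
- have [G0 _] := exists_gcodes; have [g dg] := polish_gcode (hX i) bD.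
  pose G j : gcode (X j) := if pselect (j = i) is left e then eq_rect_r (fun k => gcode (X k)) g e else G0 j.
  exists G; have Gi : G i = g.
    by rewrite /G; case: pselect => // e; rewrite (Prop_irrelevance e erefl).
  apply: (@clopen_preimage (ptop G) (ctop (G i)) (fun z => z i)).
    exact: (@prod_coord_continuous I (fun i => ctop (G i)) i).
  by rewrite Gi; exact: ctop_decided.
- by exists G; split; [exact: closed_openC|exact: open_closedC].
- pose Gs n := if n is 0 then G1 else G2; exists (jointG Gs).
  have [op1 c1] := @jointG_clopen Gs 0 C hC.
  have [op2 c2] := @jointG_clopen Gs 1 D hD.
  by split; [exact: openU|exact: closedU].
- by have [G _] := exists_gcodes; exists G; split; [exact: open0|exact: closed0].
Qed.

Lemma exists_one (xi : W) : ge1 xi -> eq1 xi \/ exists2 o : W, eq1 o & (o < xi)%O.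
Proof.
elim/(well_founded_ind wfW): xi => xi IH xi1.
have [[eta [etaxi eta1]]|no] := pselect (exists eta : W, (eta < xi)%O /\ ge1 eta); last first.
  by left; split=> // eta etaxi eta1; apply: no; exists eta.
have [e1|[w oe oeta]] := IH _ etaxi eta1; right; first by exists eta.
by exists w => //; exact: lt_trans etaxi.
Qed.

(** The two hierarchies agree from level 1 on; level 0 is strengthened to clopen so that its
    countable unions are open. The countably many topologies met along the way are joined coordinate
    by coordinate. *)
Lemma pS_Sigma0 (x : W) C : pS bor x C ->
  exists G, (~ ge1 x -> @clopen (ptop G) C) /\ (ge1 x -> @is_Sigma0 _ W (ptop G) x C).
Proof.
elim=> {x C} [x C x0 bC|x eta F lt _ IH].
  have [G hG] := box_clopen bC; exists G; split=> // -[y yx]; by case: (x0 y).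
have /choice[Gs hGs] := IH; exists (jointG Gs); split=> [nx|x1].
  by exfalso; apply: nx; exists (eta 0); exact: lt.
have [x1'|[w w1 wx]] := exists_one x1.
  apply: is_Sigma0_open => //; apply: bigcup_open => n _.
  have [h _] := hGs n; have [_ cF] := @jointG_clopen Gs n _ (h (x1'.2 _ (lt n))).
  by rewrite -[F n]setCK; exact: closed_openC.
(* Pieces of level 0 are clopen and are entered at level one, which is [w]. *)
apply: (is_Sigma0_bigcup (eta := fun n => if pselect (ge1 (eta n)) then eta n else w)) => n.
  by case: pselect => e; split=> //; first [exact: lt|exact: w1.1].
have [h h'] := hGs n; case: pselect => e.
  exact: (@jointG_Sigma0 Gs n _ _ (h' e)).
have [oF _] := @jointG_clopen Gs n _ (h e).
exact: is_Sigma0_open w1 oF.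
Qed.

Lemma box_borel C : box_algebra (X := X) bor C -> @borel (prod_topology X) C.
Proof.
elim=> {C} [i D bD|C _ bC|C D _ bC _ bD|].
- exact: (borel_preimage (@prod_coord_continuous I X i)).
- exact: borelC.
- rewrite (_ : C `|` D = \bigcup_n (if n is 0 then C else D)).
    by apply: borelU; case.
  apply/seteqP; split=> z; first by case=> ?; [exists 0|exists 1].
  by move=> [[|n] _ ?]; [left|right].
- exact: borel0.
Qed.

Lemma pS_borel (x : W) C : pS bor x C -> @borel (prod_topology X) C.
Proof.
elim=> {x C} [x C _ /box_borel//|x eta F _ _ IH]; apply: borelU => n.
by rewrite -[F n]setCK; exact: borelC.
Qed.

Lemma ptop_pot (L : pointclass) G C : @borel (prod_topology X) C -> L (ptop G) C -> pot L C.
Proof.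
move=> bC LC; split=> //; exists (fun i => Topological.class (ctop (G i))); split=> //.
- by move=> i U; exact: ctop_finer.
- by move=> i; exact: ctop_basis.
- by move=> i; exact: ctop_polish.
Qed.

Lemma pS_pot_Pi (xi : W) C : ge1 xi -> pS bor xi (~` C) -> pot (Pi0 xi) (C : set (prod_topology X)).
Proof.
move=> xi1 SC; have [G [_ h]] := pS_Sigma0 SC; apply: (@ptop_pot _ G); last exact: h.
by rewrite -[C]setCK; apply: borelC; exact: pS_borel SC.
Qed.

Lemma pS_pot_Delta (xi : W) C : ge1 xi -> pS bor xi C -> pS bor xi (~` C) ->
  pot (Delta0 xi) (C : set (prod_topology X)).
Proof.
move=> xi1 SC SC'; have [G1 [_ h1]] := pS_Sigma0 SC; have [G2 [_ h2]] := pS_Sigma0 SC'.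
pose Gs n := if n is 0 then G1 else G2.
apply: (@ptop_pot _ (jointG Gs)); first exact: pS_borel SC.
by split; [exact: (@jointG_Sigma0 Gs 0 xi _ (h1 xi1))|exact: (@jointG_Sigma0 Gs 1 xi _ (h2 xi1))].
Qed.

End pS_pot.

(** The code of [z] is paired with that of [f z]. If both stabilise along a sequence, continuity of
    [f] for the coarse topology and uniqueness of limits in [X] identify the two limits, so the
    pairing is again good. *)
Lemma pullback_gcode (Z X : topologicalType) (Y : Topological.axioms_ X) (f : Z -> X)
    (gZ : gcode Z) : polish X -> polish (Topological.Pack Y) ->
  (forall U : set X, @open X U -> @open (Topological.Pack Y) U) -> continuous f ->
  exists g : gcode Z, continuous (fun z : ctop g => (f z : Topological.Pack Y)).
Proof.
move=> /polish_has_dist[dX hdX] /polish_has_dist[dY hdY] fin cf.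
have [phi gp] := exists_good hdY.
pose phis n : nat -> Z -> nat := if n is 0 then gphi gZ else fun m z => phi m (f z).
have gd : good (join_coding phis).
  move=> x y h.
  have hZ m : ev (fun k => gphi gZ m (x k) = y (pickle (0, m))).
    by have := h (pickle (0, m)); rewrite join_codingE.
  have hY m : ev (fun k => phi m (f (x k)) = y (pickle (1, m))).
    by have := h (pickle (1, m)); rewrite join_codingE.
  have [a [aP xa]] := gphi_good gZ _ _ hZ; have [b [bP xb]] := gp _ _ hY.
  have fab : f a = b.
    apply: (scvg_unique hdX (x := fun k => f (x k))) => U oU; last exact: xb (fin _ oU).
    by move=> Ufa; apply: (xa (f @^-1` U)) => //; exact: open_pre cf oU.
  exists a; split=> // k; have := h k; rewrite /join_coding; set nm := odflt _ _.
  case e : nm => [[|n] m] /= hk.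
    by have [j [h1 h2]] := ev_ex (ev_and hk (hZ m)); rewrite aP -h2.
  by have [j [h1 h2]] := ev_ex (ev_and hk (hY m)); rewrite fab bP -h2.
have inj a b : (forall n, join_coding phis n a = join_coding phis n b) -> a = b.
  move=> e; apply: (gphi_inj gZ) => n.
  by have := e (pickle (0, n)); rewrite join_codingE.
exists (GCode inj gd); apply/continuousP => U oU; apply/coded_open => a Ufa /=.
have [N hN] := good_finer (good_inj hdY gp) gp oU Ufa.
apply: ev_eq_upto => x xa.
apply: ev_imp (ev_all (Q := fun n k => phi n (f (x k)) = phi n (f a)) (N := N) _) => [k e|n nN].
  exact: hN.
by have := xa (pickle (1, n)); rewrite /= join_codingE.
Qed.

Lemma pot_pullback {I : choiceType} (L : pointclass) (Z X : I -> topologicalType)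
    (gZ : forall i, gcode (Z i)) (f : forall i, Z i -> X i) (C : set (prod_topology X)) :
  (forall (S T : topologicalType) (h : S -> T) A, continuous h -> L T A -> L S (h @^-1` A)) ->
  (forall i, polish (X i)) -> (forall i, continuous (f i)) -> pot L C ->
  pot L ((fun z : prod_topology Z => (fun i => f i (z i)) : prod_topology X) @^-1` C).
Proof.
move=> Lpre hX cf [bC [tau [fin _ pol LC]]].
have /(_ _)/cid h i : exists g : gcode (Z i), continuous (fun z : ctop g => (f i z : Topological.Pack (tau i))).
  exact: pullback_gcode (gZ i) (hX i) (pol i) (fin i) (cf i).
pose G i := projT1 (h i).
have cG i : continuous (fun z : ctop (G i) => (f i z : Topological.Pack (tau i))) := projT2 (h i).
apply: (@ptop_pot I Z L G).
  by apply: borel_preimage bC; exact: continuous_prod_map.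
apply: (Lpre (ptop G) (prod_topology (fun i => Topological.Pack (tau i)))) LC.
exact: (@continuous_prod_map I (fun i => ctop (G i)) (fun i => Topological.Pack (tau i))).
Qed.

(** * The reduction *)

Lemma half_gt0 k : (0 < 2^-1 ^+ k :> RR)%R.
Proof. by rewrite exprn_gt0// invr_gt0. Qed.

Lemma half_le k l : k <= l -> (2^-1 ^+ l <= 2^-1 ^+ k :> RR)%R.
Proof. by move=> kl; apply: ler_wiXn2l => //; rewrite ?invr_ge0// invf_le1// ler1n. Qed.

Lemma scvg_cvg (T : topologicalType) (x : nat -> T) a : scvg x a <-> x @ \oo --> a.
Proof.
split=> [xa U|xa U oU Ua].
  by rewrite nbhsE => -[Q [oQ Qa] QU]; have [N hN] := xa Q oQ Qa; exists N => // k /hN/QU.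
by have [N _ hN] := xa U (open_nbhs_nbhs (conj oU Ua)); exists N.
Qed.

Lemma polish_cover (T : topologicalType) d : polish_dist (T := T) d ->
  exists G : nat -> nat -> set T, [/\ forall k n, open (G k n),
    forall k, \bigcup_n G k n = setT &
    forall k n x y, G k n x -> G k n y -> (d x y < 2 * 2^-1 ^+ k)%R].
Proof.
move=> hd; have [D [c [c_inj D_dense]]] := pd_sep hd.
exists (fun k n => [set x | exists z, [/\ D z, c z = n & (d z x < 2^-1 ^+ k)%R]]); split.
- move=> k n; rewrite (_ : [set _ | _] =
      \bigcup_(z in [set z | D z /\ c z = n]) [set x | (d z x < 2^-1 ^+ k)%R]).
    by apply: bigcup_open => z _; exact: ball_open.
  by apply/seteqP; split=> x; [move=> [z [? ? ?]]; exists z|move=> [z [? ?] ?]; exists z].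
- move=> k; rewrite -subTset => x _; have [z Dz zx] := D_dense x _ (half_gt0 k).
  by exists (c z) => //; exists z.
- move=> k n x y [z [Dz cz zx]] [w [Dw cw wy]].
  have e : w = z by apply: c_inj => //; rewrite cz.
  rewrite e in wy; have := pd_tri hd x z y; rewrite (pd_sym hd x z); lra.
Qed.

Record souslin_scheme {I : Type} {X : I -> topologicalType} (A : set (prod_topology X))
    (V : seq nat -> set (prod_topology X)) : Prop := SouslinScheme {
  ss_nil : V [::] = A;
  ss_split : forall u, V u `<=` \bigcup_n V (rcons u n);
  ss_anti : forall u n, V (rcons u n) `<=` V u;
  ss_limit : forall (y : nat -> nat) (p : nat -> prod_topology X) x,
    (forall k, V (mkseq y k) (p k)) -> (forall i, scvg (fun k => p k i) (x i)) -> A x }.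

(** [V u] is the image of the intersection of covering sets chosen by [u], whose diameters shrink.
    Preimages of points taken along a branch of the scheme are Cauchy, and the image of their limit
    is the coordinatewise limit. *)
Lemma analytic_souslin {I : choiceType} (X : I -> topologicalType) (A : set (prod_topology X)) :
  (forall i, polish (X i)) -> analytic A -> exists V, souslin_scheme A V.
Proof.
move=> hX [Z [f [/polish_has_dist[d hd] cf fA]]].
have [G [oG cG dG]] := polish_cover hd.
pose Zs u : set Z := [set z | forall j, j < size u -> G j (nth 0 u j) z].
have ZsS u n z : Zs (rcons u n) z <-> Zs u z /\ G (size u) n z.
  split=> [h|[h1 h2] j].
    split=> [j ju|]; last by have := h (size u); rewrite size_rcons nth_rcons ltnn eqxx; exact.
    by have := h j; rewrite size_rcons nth_rcons ju; apply; exact: ltnW.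
  rewrite size_rcons nth_rcons ltnS leq_eqVlt => /orP[/eqP->|ju]; first by rewrite ltnn eqxx.
  by rewrite ju; exact: h1.
exists (fun u => f @` Zs u); split.
- by rewrite -fA; apply/seteqP; split=> _ [z _ <-]; exists z.
- move=> u _ [z Zz <-]; have : (\bigcup_n G (size u) n) z by rewrite cG.
  by move=> [n _ Gz]; exists n => //; exists z => //; apply/ZsS.
- by move=> u n _ [z /ZsS[? _] <-]; exists z.
- move=> y p x h px.
  have /choice[z zP] k : exists z, Zs (mkseq y k) z /\ f z = p k.
    by have [w ? ?] := h k; exists w.
  have [|l hl] := pd_complete hd (x := z).
    move=> e e0; have e20 : (0 < e / 2)%R by rewrite divr_gt0.
    have [N Ne] := half_pow_lt e20; exists N.+1 => m n Nm Nn.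
    have h1 k : N < k -> G N (y N) (z k).
      move=> Nk; have [/(_ N)] := zP k; rewrite size_mkseq nth_mkseq//.
      by move=> h1 _; exact: h1.
    have := dG _ _ _ _ (h1 m Nm) (h1 n Nn); lra.
  have zl : scvg z l by apply: (dist_scvg hd) => e e0; have [N hN] := hl e e0; exists N.
  rewrite -fA; exists l => //; apply: functional_extensionality_dep => i.
  have [di hdi] := polish_has_dist (hX i); apply: (scvg_unique hdi (x := fun k => p k i)) => //.
  move=> U oU Ui; pose W := (fun q : prod_topology X => q i) @^-1` U.
  have oW : open W by apply: open_pre oU; exact: prod_coord_continuous.
  have oW' := open_pre cf oW.
  by apply: ev_imp (zl _ oW' Ui) => k; have [_ <-] := zP k.
Qed.

(** * Queries from a Sigma^0 description *)

Section queries.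
Context {d : dcard} {disp : Order.disp_t} {W : orderType disp}.
Variables (T : set (seq (ix d -> ix d))) (xi : W).
Local Notation E := (body T).
Variables S0 S1 : set (set_type E).
Hypothesis hS0 : is_Sigma0 xi S0.
Hypothesis hS1 : is_Sigma0 xi S1.
Implicit Type p : W * set (set_type E).

Lemma is_Sigma0_ge1 (x : W) (U : topologicalType) (A : set U) : is_Sigma0 x A -> ge1 x.
Proof. by case=> [y B []//|y eta F /(_ 0)[_ h] _]; exists (eta 0). Qed.

(** An open set is its own child, so the inequality [lv (ch n m) < lv n] fails for it and holds for
    genuine children only. *)
Let step_exists p : exists g : nat -> W * set (set_type E), is_Sigma0 p.1 p.2 ->
  [/\ eq1 p.1, open p.2 & forall m, g m = p] \/
  (p.2 = \bigcup_m ~` (g m).2 /\ forall m, ((g m).1 < p.1)%O /\ is_Sigma0 (g m).1 (g m).2).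
Proof.
have [h|no] := pselect (is_Sigma0 p.1 p.2); last by exists (fun=> p).
case: p h => x A /= h; case: h => [y B y1 oB|y eta F h1 h2]; first by exists (fun=> (y, B)) => _; left.
exists (fun m => (eta m, ~` F m)) => _; right; split=> [|m] /=.
  by apply: eq_bigcup => // m _; rewrite setCK.
by split=> //; have [] := h1 m.
Qed.

Let step p := projT1 (cid (step_exists p)).
Let stepP p : is_Sigma0 p.1 p.2 ->
  [/\ eq1 p.1, open p.2 & forall m, step p m = p] \/
  (p.2 = \bigcup_m ~` (step p m).2 /\ forall m, ((step p m).1 < p.1)%O /\ is_Sigma0 (step p m).1 (step p m).2).
Proof. exact: projT2 (cid (step_exists p)). Qed.

Let dec n : bool * seq nat := odflt (false, [::]) (unpickle n).
Let qs n := foldl step (xi, if (dec n).1 then S1 else S0) (dec n).2.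
Let lv n := (qs n).1.
Let ch n m := pickle ((dec n).1, rcons (dec n).2 m).
Let base n (s : seq (ix d -> ix d)) : Prop := eq1 (lv n) /\
  forall z : set_type E, mkseq (fun j i => set_val z i j) (size s) = s -> (qs n).2 z.
Let C n : set (nat -> ix d -> ix d) :=
  [set a | exists z : set_type E, set_val z = (fun i j => a j i) /\ (qs n).2 z].

Let qs_ch n m : qs (ch n m) = step (qs n) m.
Proof. by rewrite /qs /ch /dec pickleK /= -cats1 foldl_cat. Qed.

Let qs_valid n : is_Sigma0 (qs n).1 (qs n).2.
Proof.
rewrite /qs; set p0 := (xi, _); have : is_Sigma0 p0.1 p0.2 by rewrite /p0 /=; case: ifP.
elim: (dec n).2 p0 => [//|m l IH] p hp /=; apply: IH.
by have [[_ _ ->]|[_ /(_ m)[]]] := stepP hp.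
Qed.

Let mk (a : nat -> ix d -> ix d) : branches T a -> exists z : set_type E, set_val z = (fun i j => a j i).
Proof.
move=> Ba; have Ea : E (fun i j => a j i) by exact: Ba.
by exists (SigSub (mem_set Ea)).
Qed.

(** A query is a position in the derivation tree of [S0] or [S1], coded by a boolean and a finite
    sequence of choices. The leaves are open sets, and a segment forces one when all branches of the
    body through it lie in it. *)
Lemma query_system : exists (lv : nat -> W) (ch : nat -> nat -> nat)
    (base : nat -> seq (ix d -> ix d) -> Prop) (C : nat -> set (nat -> ix d -> ix d)) (q0 q1 : nat),
  [/\ forall n s t, pre s t -> base n s -> base n t,
      forall n, exists y, (y < lv n)%O,
      lv q0 = xi /\ lv q1 = xi,
      [/\ forall n a l, branches T a -> base n (mkseq a l) -> C n a,
          forall n m a, branches T a -> (lv (ch n m) < lv n)%O -> ~ C (ch n m) a -> C n a &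
          forall n a, branches T a -> C n a -> (exists l, base n (mkseq a l)) \/
            exists m, (lv (ch n m) < lv n)%O /\ ~ C (ch n m) a] &
      forall z : set_type E, let a := fun j i => set_val z i j in
        (C q0 a <-> S0 z) /\ (C q1 a <-> S1 z)].
Proof.
exists lv, ch, base, C, (pickle (false, [::] : seq nat)), (pickle (true, [::] : seq nat)).
have uniqz (z z' : set_type E) : set_val z = set_val z' -> z = z' by move=> /val_inj.
split.
- move=> n s t st [n1 h]; split=> // z zt; apply: h.
  by rewrite {2}(pre_take st) -zt take_mkseq// pre_size.
- by move=> n; have := is_Sigma0_ge1 (qs_valid n).
- by rewrite /lv /qs /dec !pickleK.
- split.
  + move=> n a l Ba [_ h]; have [z za] := mk Ba; exists z; split=> //; apply: h.
    by rewrite size_mkseq za.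
  + move=> n m a Ba lt nC; have [z za] := mk Ba; exists z; split=> //.
    have [[_ _ e]|[-> _]] := stepP (qs_valid n).
      by move: lt; rewrite /lv qs_ch e ltxx.
    by exists m => // hz; apply: nC; exists z; rewrite qs_ch.
  + move=> n a Ba [z [za Cz]]; have [[n1 op _]|[e lt]] := stepP (qs_valid n); last first.
      right; move: Cz; rewrite e => -[m _ nz]; exists m; split.
        by rewrite /lv qs_ch; have [] := lt m.
      move=> [z' [z'a]]; rewrite qs_ch; have -> // : z' = z by apply: uniqz; rewrite z'a.
    left; apply: contrapT => no.
    have /choice[w wP] l : exists w : set_type E,
        mkseq (fun j i => set_val w i j) l = mkseq a l /\ ~ (qs n).2 w.
      apply: contrapT => no'; apply: no; exists l; split=> // w; rewrite size_mkseq => e.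
      by apply: contrapT => nw; apply: no'; exists w.
    have wz : w @ \oo --> z.
      apply: (@cvg_initial _ _ set_val); rewrite -[X in X --> _]fmap_comp.
      apply: cvg_prod_topology => i; rewrite -fmap_comp.
      apply: cvg_prod_topology => j; rewrite -fmap_comp => U /nbhs_singleton Uz.
      exists j.+1 => // l /= jl; have [e _] := wP l.
      have := congr1 (fun s => nth (fun=> a 0 i) s j i) e; rewrite !nth_mkseq// => ->.
      by move: Uz; rewrite za.
    have [N _ hN] := wz _ (open_nbhs_nbhs (conj op Cz)).
    by have [_] := wP N; apply; exact: (hN N (leqnn N)).
- move=> z a; rewrite /C /qs /dec !pickleK /=; split; split.
  + by move=> [z' [e ?]]; have <- : z' = z by apply: uniqz; rewrite e.
  + by exists z.
  + by move=> [z' [e ?]]; have <- : z' = z by apply: uniqz; rewrite e.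
  + by exists z.
Qed.

End queries.

Lemma dpow_nbhs {d : dcard} (b : dpow_omega d) l :
  nbhs b [set c : dpow_omega d | forall j, j < l -> c j = b j].
Proof.
elim: l => [|l IH]; first by apply: filterS filterT => c _ j.
have o1 : nbhs b [set c : dpow_omega d | c l = b l].
  have h : nbhs (b l : discrete_topology (ix d)) [set b l].
    by apply: open_nbhs_nbhs; split=> //; exact: discrete_open.
  exact: (@prod_coord_continuous nat (fun=> discrete_topology (ix d)) l b _ h).
apply: filterS2 IH o1 => c h1 h2 j; rewrite ltnS leq_eqVlt => /orP[/eqP-> //|]; exact: h1.
Qed.

(** * Coordinate functions as limits of approximations *)

Section limit_function.
Context {d : dcard} {X : topologicalType} {dX : X -> X -> RR} (hd : polish_dist dX).
Variables (x0 : X) (cd : nat) (Tr : set (seq (ix d))) (pt : seq (ix d) -> X).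
Hypothesis Tr_take : forall l k, Tr k -> Tr (take l k).
Hypothesis pt_close : forall k k', Tr k -> Tr k' -> k = take (size k) k' -> cd < size k ->
  (dX (pt k) (pt k') <= 4 * 2^-1 ^+ size k)%R.
Local Open Scope ring_scope.

(** Outside [Tr] the last available point is kept, so the limit function is defined and continuous
    on the whole space and not only on the projection of the body. *)
Fixpoint approx (b : nat -> ix d) l : X :=
  if l is l'.+1 then
    if `[< Tr (mkseq b l'.+1) /\ (cd < l'.+1)%N >] then pt (mkseq b l'.+1) else approx b l'
  else x0.

Lemma approx_pt b l : (cd < l)%N -> Tr (mkseq b l) -> approx b l = pt (mkseq b l).
Proof. by case: l => // l cl Tl /=; case: asboolP => // -[]. Qed.

Lemma approx_local b c l : mkseq b l = mkseq c l -> approx b l = approx c l.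
Proof.
elim: l => // l IH e; rewrite /= e IH//.
by have := congr1 (take l) e; rewrite !take_mkseq.
Qed.

Lemma approx_close b l l' : (cd < l)%N -> (l <= l')%N ->
  dX (approx b l) (approx b l') <= 4 * 2^-1 ^+ l.
Proof.
move=> cl; have h0 := half_gt0 l; elim: l' => [|l' IH].
  by rewrite leqn0 => /eqP e; move: cl; rewrite e.
rewrite leq_eqVlt => /orP[/eqP <-|]; first by rewrite (pd_refl hd) mulr_ge0// ltW.
rewrite ltnS => ll'; rewrite {2}/approx -/approx; case: asboolP => [[T' _]|_]; last exact: IH.
have tk : mkseq b l = take l (mkseq b l'.+1) by rewrite take_mkseq// leqW.
have Tl : Tr (mkseq b l) by rewrite tk; exact: Tr_take.
by rewrite approx_pt//; have := pt_close Tl T'; rewrite size_mkseq; apply.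
Qed.

Lemma limit_function : exists f : dpow_omega d -> X, continuous f /\
  forall b l, (cd < l)%N -> Tr (mkseq b l) -> dX (pt (mkseq b l)) (f b) <= 5 * 2^-1 ^+ l.
Proof.
have /choice[f fP] b : exists a, forall e, 0 < e -> exists N, forall n, (N <= n)%N ->
    dX a (approx b n) < e.
  (* Two approximations are each within 4 times 2^-M of the one at [M], and 4 + 4 = 8. *)
  apply: (pd_complete hd) => e e0; have e80 : 0 < e / 8 by rewrite divr_gt0.
  have [N Ne] := half_pow_lt e80; exists (maxn N cd.+1) => m n; rewrite !geq_max.
  move=> /andP[Nm cm] /andP[Nn cn]; pose M := maxn N cd.+1.
  have cM : (cd < M)%N by rewrite /M leq_max leqnn orbT.
  have NM : (N <= M)%N by rewrite /M leq_max leqnn.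
  have h1 := approx_close b cM (_ : (M <= m)%N); have h2 := approx_close b cM (_ : (M <= n)%N).
  have {}h1 : dX (approx b M) (approx b m) <= 4 * 2^-1 ^+ M by apply: h1; rewrite geq_max Nm.
  have {}h2 : dX (approx b M) (approx b n) <= 4 * 2^-1 ^+ M by apply: h2; rewrite geq_max Nn.
  have h3 : 2^-1 ^+ M < e / 8 by exact: le_lt_trans (half_le NM) Ne.
  have := pd_tri hd (approx b m) (approx b M) (approx b n).
  rewrite (pd_sym hd (approx b m) (approx b M)); lra.
(* 5 = 4 + 1: the distance to a later approximation, plus 2^-l from there to the limit. *)
have f_close b l : (cd < l)%N -> dX (approx b l) (f b) <= 5 * 2^-1 ^+ l.
  move=> cl; have [N hN] := fP b _ (half_gt0 l).
  have := hN _ (leq_maxl N l); have := approx_close b cl (leq_maxr N l).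
  have := pd_tri hd (approx b l) (approx b (maxn N l)) (f b).
  rewrite (pd_sym hd (approx b (maxn N l)) (f b)); lra.
exists f; split; last by move=> b l cl Tl; rewrite -approx_pt//; exact: f_close.
move=> b U; rewrite nbhsE => -[Q [oQ Qb] QU].
have [e e0 eQ] := (pd_open hd Q).1 oQ _ Qb.
(* Both values are within 5 times 2^-l of a common approximation, and 5 + 5 < 11. *)
have e100 : 0 < e / 11 by rewrite divr_gt0.
have [N Ne] := half_pow_lt e100; pose l := maxn N cd.+1.
have cl : (cd < l)%N by rewrite /l leq_max leqnn orbT.
have hl : 2^-1 ^+ l < e / 11 by apply: le_lt_trans (half_le _) Ne; rewrite /l leq_max leqnn.
apply: filterS (dpow_nbhs b l) => c cb; apply/QU/eQ.
have e1 : approx c l = approx b l.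
  by apply: approx_local; apply: (@eq_from_nth _ (b 0%N)); rewrite !size_mkseq// => j jl;
    rewrite !nth_mkseq//; exact: cb.
have h1 := f_close b l cl; have := f_close c l cl; rewrite e1.
have := pd_tri hd (f b) (approx b l) (f c); rewrite (pd_sym hd (f b) (approx b l)); lra.
Qed.

End limit_function.

Definition dcode (d : dcard) : ix d -> nat :=
  match d return ix d -> nat with Fin n => fun i : 'I_n => nat_of_ord i | Omega => fun n => n end.

Lemma dcode_inj d : injective (@dcode d).
Proof. by case: d => [n|] x y //=; exact: ord_inj. Qed.

Section reduction.
Context {d : dcard} (T : set (seq (ix d -> ix d))).
Hypothesis hT : is_tree T.
Hypothesis hTs : suitable_levels T.
Context {disp : Order.disp_t} {W : orderType disp}.
Hypothesis wfW : well_founded (fun x y : W => (x < y)%O).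
Variable xi : W.
Context {X : ix d -> topologicalType}.
Hypothesis hX : forall i, polish (X i).
Local Notation bor := (fun i => @borel (X i)).
Variables (A : option bool -> set (prod_topology X)) (V : option bool -> seq nat -> set (prod_topology X)).
Hypothesis AV : forall l, souslin_scheme (A l) (V l).
Variables S0 S1 : set (set_type (body T)).
Hypothesis hS0 : is_Sigma0 xi S0.
Hypothesis hS1 : is_Sigma0 xi S1.
Hypothesis S01 : forall z, S0 z -> S1 z -> False.

Definition start_ideal : set (set (prod_topology X)) :=
  ijoin (avoid (A None)) (ijoin (iclose (pS bor xi) (avoid (A (Some false))))
                                (iclose (pS bor xi) (avoid (A (Some true))))).

(** An improper starting ideal would mean that [A None] is covered by two potentially Sigma^0_xi
    sets missing [A (Some false)] and [A (Some true)] respectively. *)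
Lemma reduction : ~ start_ideal setT ->
  exists f : forall i, dpow_omega d -> X i, (forall i, continuous (f i)) /\
    forall z : set_type (body T), let Fz : prod_topology X := fun i => f i (set_val z i) in
      [/\ S0 z -> A (Some false) Fz, S1 z -> A (Some true) Fz & ~ S0 z -> ~ S1 z -> A None Fz].
Proof.
move=> pI.
have [lv [ch [base [C [q0 [q1 [base_mono lv1 [lvq0 lvq1] [bs cs cpl] Cq]]]]]]] := query_system hS0 hS1.
have borC := fun i => @borelC (X i); have borU := fun i => @borelU (X i).
have bor0 := fun i => @borel0 (X i).
have xi1 : exists y, (y < xi)%O by rewrite -lvq0.
have sc b : sideal (iclose (pS bor xi) (avoid (A (Some b)))).
  by apply: sideal_cl => //; exact: sideal_avoid.
have sj : sideal (ijoin (iclose (pS bor xi) (avoid (A (Some false))))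
                        (iclose (pS bor xi) (avoid (A (Some true))))) by exact: sideal_join.
have sI : sideal start_ideal by apply: sideal_join => //; exact: sideal_avoid.
have IN : avoid (V None [::]) `<=` start_ideal.
  by rewrite (ss_nil (AV None)); exact: ijoinl.
have IS b : iclose (pS bor xi) (avoid (V (Some b) [::])) `<=` start_ideal.
  rewrite (ss_nil (AV (Some b))); apply: subset_trans (ijoinr (sideal_avoid _)).
  by case: b; [exact: ijoinr|exact: ijoinl].
have /(_ _)/cid hd i := polish_has_dist (hX i).
pose dX i := projT1 (hd i); have hdX i : polish_dist (dX i) := projT2 (hd i).
have /(_ _)/cid hG i := polish_cover (hdX i).
pose G i := projT1 (hG i).
have GP i : [/\ forall k n, open (G i k n), forall k, \bigcup_n G i k n = setT &
    forall k n x y, G i k n x -> G i k n y -> (dX i x y < 2 * 2^-1 ^+ k)%R] := projT2 (hG i).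
have T_tree s t : pre s t -> T t -> T s by move=> [v ->]; exact: hT.
have [J [ind [gJ cJ]]] := @construction (ix d) (ix d) X bor borC borU bor0 disp W wfW lv ch base base_mono
  xi q0 q1 lv1 lvq0 lvq1 V (fun l => ss_split (AV l)) start_ideal sI pI IN IS T (@dcode d) G T_tree
  (@dcode_inj d) (fun i k => let: And3 _ h _ := GP i in h k)
  (fun l => let: And3 h _ _ := hTs l in h) (fun l => let: And3 _ h _ := hTs l in h)
  (fun l => let: And3 _ _ h := hTs l in h).
have Gbor i k n : @borel (X i) (G i k n) by apply: borel_open; have [h _ _] := GP i.
have [g [gJ1 gJ2]] := small_sets borC T_tree Gbor gJ cJ.
have [x0 _] : exists x0 : prod_topology X, True.
  apply: contrapT => no; apply: pI; rewrite (_ : setT = set0); first exact: sideal0.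
  by apply/seteqP; split=> // x; case: no; exists x.
pose nd i k : seq (ix d -> ix d) := xget [::] [set t | T t /\ crd t i = k].
have ndP i k : (exists2 t, T t & crd t i = k) -> T (nd i k) /\ crd (nd i k) i = k.
  by move=> [t Tt tk]; rewrite /nd; case: xgetP => [_ -> //|/(_ t)[]].
have crd_size (t : seq (ix d -> ix d)) (i : ix d) : size (crd t i) = size t by rewrite /crd size_map.
have /(_ _ _)/cid hp i t : exists x : X i, T t -> dcode i < size t -> G i (size t) (g t i) x.
  have [[Tt ci]|no] := pselect (T t /\ dcode i < size t); last first.
    by exists (x0 i) => Tt ci; case: no.
  have [|x [Gx _]] := gJ2 t t i Tt Tt ci (leqnn _); last by exists x.
  by rewrite -[size t](crd_size t i) take_size.
(* The point depends on [i] and on the sequence [k] only: [nd i k] is one fixed node with this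
   [i]-th coordinate. *)
pose pt i k : X i := projT1 (hp i (nd i k)).
have ptP i k : (exists2 t, T t & crd t i = k) -> dcode i < size k -> G i (size k) (g (nd i k) i) (pt i k).
  move=> h ck; have [Tn cn] := ndP i k h; have sz : size (nd i k) = size k by rewrite -(crd_size _ i) cn.
  have h2 : dcode i < size (nd i k) -> G i (size (nd i k)) (g (nd i k) i) (pt i k) :=
    projT2 (hp i (nd i k)) Tn.
  by rewrite sz in h2; exact: h2.
pose Tr i : set (seq (ix d)) := [set k | exists2 t, T t & crd t i = k].
have Tr_take i l k : Tr i k -> Tr i (take l k).
  move=> [t Tt <-]; exists (take l t); first exact: T_tree (take_pre _ _) Tt.
  by rewrite /crd map_take.
have diam i k n x y : G i k n x -> G i k n y -> (dX i x y < 2 * 2^-1 ^+ k)%R.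
  by have [_ _ h] := GP i; exact: h.
(* 4 = 2 + 2: the two sets meet, and each has diameter at most 2 times 2^-l, where l is the length
   of the shorter node. *)
have meet i s t x y : T s -> T t -> dcode i < size s -> size s <= size t ->
    crd s i = take (size s) (crd t i) -> G i (size s) (g s i) x -> G i (size t) (g t i) y ->
    (dX i x y <= 4 * 2^-1 ^+ size s)%R.
  move=> Ts Tt ci st e Gx Gy; have [w [Gw Gw']] := gJ2 s t i Ts Tt ci st e.
  have h1 := diam _ _ _ _ _ Gx Gw; have h2 := diam _ _ _ _ _ Gw' Gy.
  have := half_le st; have := pd_tri (hdX i) x w y; lra.
have pt_close i k k' : Tr i k -> Tr i k' -> k = take (size k) k' -> dcode i < size k ->
    (dX i (pt i k) (pt i k') <= 4 * 2^-1 ^+ size k)%R.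
  move=> Tk Tk' e ck; have kk' : size k <= size k' by rewrite e size_take; case: ifP => // /ltnW.
  have [Tn cn] := ndP i k Tk; have [Tn' cn'] := ndP i k' Tk'.
  have sz : size (nd i k) = size k by rewrite -(crd_size _ i) cn.
  have sz' : size (nd i k') = size k' by rewrite -(crd_size _ i) cn'.
  have := @meet i (nd i k) (nd i k') (pt i k) (pt i k') Tn Tn'; rewrite sz sz' cn cn'; apply=> //.
    exact: ptP.
  by apply: ptP => //; exact: leq_trans kk'.
have /(_ _)/cid hf i := limit_function (hdX i) (x0 i) (Tr_take i) (pt_close i).
pose f i := projT1 (hf i).
have fP i : continuous (f i) /\ forall b l, dcode i < l -> Tr i (mkseq b l) ->
    (dX i (pt i (mkseq b l)) (f i b) <= 5 * 2^-1 ^+ l)%R := projT2 (hf i).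
exists f; split=> [i|z Fz]; first by have [] := fP i.
pose a j i := set_val z i j.
have Ba : branches T a by move=> l; have : body T (set_val z) by exact: set_valP.
have Cdis b : branches T b -> C q0 b -> C q1 b -> False.
  move=> Bb; have Eb : body T (fun i j => b j i) by exact: Bb.
  have [h0 h1] := Cq (SigSub (mem_set Eb)).
  by move=> /h0 c0 /h1 c1; exact: S01 c0 c1.
have [y yP] := limit_points base_mono lvq0 lvq1 (@dcode_inj d) (fun l => ss_anti (AV l)) bs cs cpl Cdis gJ Ba gJ1.
have /choice[lp lpP] k : exists lp : nat * prod_topology X, [/\ k <= lp.1,
    V (branch_label q0 q1 C a) (mkseq y k) lp.2 &
    forall i, dcode i < k -> G i lp.1 (g (mkseq a lp.1) i) (lp.2 i)].
  by have [l [p ?]] := yP k k; exists (l, p).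
have main : A (branch_label q0 q1 C a) Fz.
  apply: (ss_limit (AV _)) (fun k => (lp k).2) _ _ _; first by move=> k; have [_ h _] := lpP k; exact: h.
  (* The error is 4 from [p] to the chosen point plus 5 from there to the limit function, and 4 + 5
     < 10. *)
  move=> i; apply: (dist_scvg (hdX i)) => e e0; have e90 : (0 < e / 10)%R by rewrite divr_gt0.
  have [N Ne] := half_pow_lt e90; exists (maxn N (dcode i).+1) => k; rewrite geq_max => /andP[Nk ck].
  have [kl _ /(_ i ck) Gp] := lpP k; set l := (lp k).1 in kl Gp; set p := (lp k).2 in Gp *.
  have cl : dcode i < l by exact: leq_trans kl.
  have crda : crd (mkseq a l) i = mkseq (set_val z i) l by rewrite /crd /mkseq -map_comp.
  have Tk : Tr i (mkseq (set_val z i) l) by exists (mkseq a l) => //; exact: Ba.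
  have [Tn cn] := ndP i _ Tk.
  have sz : size (nd i (mkseq (set_val z i) l)) = l by rewrite -(crd_size _ i) cn size_mkseq.
  have h1 : (dX i (p i) (pt i (mkseq (set_val z i) l)) <= 4 * 2^-1 ^+ l)%R.
    have := @meet i (mkseq a l) (nd i (mkseq (set_val z i) l)) (p i) (pt i (mkseq (set_val z i) l)) (Ba l) Tn.
    rewrite sz size_mkseq; apply=> //.
      by rewrite cn; apply: etrans crda _; rewrite take_oversize// size_mkseq.
    by have := @ptP i _ Tk; rewrite size_mkseq; exact.
  have [_ /(_ (set_val z i) l cl Tk) h2] := fP i.
  have h3 : (2^-1 ^+ l < e / 10)%R by apply: le_lt_trans (half_le _) Ne; exact: leq_trans kl.
  have := pd_tri (hdX i) (p i) (pt i (mkseq (set_val z i) l)) (Fz i).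
  rewrite (pd_sym (hdX i) (Fz i) (p i)); move: h1 h2 h3; rewrite /Fz; lra.
have [h0 h1] := Cq z; move: main; rewrite /branch_label.
case: asboolP => [/h0 z0|n0] => [Az|].
  by split=> // z1; case: (S01 z0 z1).
case: asboolP => [/h1 z1|n1] Az.
  by split=> [/h0| |_ /(_ z1)].
by split=> [/h0|/h1|].
Qed.

End reduction.

Lemma well_order_wf {disp : Order.disp_t} (W : orderType disp) :
  wochoice.well_order (<=%O : rel W) -> well_founded (fun x y : W => (x < y)%O).
Proof.
move=> wo; suff acc x : Acc (fun x y : W => (x < y)%O) x by [].
apply: contrapT => nx; have [|m [[mN mmin] _]] := wo (fun y => `[< ~ Acc (fun x y : W => (x < y)%O) y >]).
  by exists x; exact/asboolP.
have /asboolP := mN; apply; constructor => y ym; apply: contrapT => ny.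
have : y \in (fun y => `[< ~ Acc (fun x y : W => (x < y)%O) y >]) by exact/asboolP.
by move=> /mmin; rewrite leNgt ym.
Qed.

Lemma is_Sigma0_0T {disp : Order.disp_t} {W : orderType disp} (T : topologicalType) (x : W) :
  well_founded (fun x y : W => (x < y)%O) -> ge1 x ->
  is_Sigma0 x (set0 : set T) /\ is_Sigma0 x (setT : set T).
Proof.
move=> wf; elim/(well_founded_ind wf): x => x IH x1.
have [e1|[w w1 wx]] := exists_one wf x1.
  by split; apply: is_Sigma0_open => //; [exact: open0|exact: openT].
have [h0 hT] := IH w wx w1.1.
have cst (B : set T) : B = \bigcup_(n in [set: nat]) B by rewrite bigcup_const//; exists 0.
by split; rewrite [X in is_Sigma0 _ X]cst; apply: (is_Sigma0_bigcup (eta := fun=> w)) => n;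
  rewrite ?setC0 ?setCT//; split=> //; exact: w1.1.
Qed.

Definition dpow_gcode (d : dcard) : gcode (dpow_omega d).
Proof.
apply: (@GCode _ (fun n (x : dpow_omega d) => dcode (x n))) => [x y e|x y h].
  by apply: functional_extensionality_dep => n; apply: dcode_inj.
have /choice[a aP] n : exists v : ix d, dcode v = y n.
  by have [k e] := ev_ex (h n); exists (x k n).
exists a; split=> //; apply/scvg_cvg; apply: cvg_prod_topology => n; rewrite -fmap_comp.
move=> U /nbhs_singleton Ua; have [N hN] := h n; exists N => // k Nk /=.
have -> // : x k n = a n by apply: dcode_inj; rewrite aP; exact: hN.
Qed.

(** The preimage of a separating set separates, and the finer topologies witnessing its potential
    class pull back as well. *)
Lemma reduces_pot_separable {d : dcard} (L : pointclass) (S0 S1 : set (prod_topology (@dpows d)))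
    (X : ix d -> topologicalType) (A0 A1 : set (prod_topology X)) :
  (forall (S T : topologicalType) (h : S -> T) A, continuous h -> L T A -> L S (h @^-1` A)) ->
  (forall i, polish (X i)) -> reduces S0 S1 A0 A1 -> pot_separable L A0 A1 -> pot_separable L S0 S1.
Proof.
move=> Lpre hX [f [cf h0 h1]] [C pC [AC CA]].
exists ((fun z : prod_topology (@dpows d) => (fun i => f i (z i)) : prod_topology X) @^-1` C).
  exact: (pot_pullback (fun=> dpow_gcode d)).
split; first by move=> z /h0 /AC.
rewrite -subset0 => z [Cz /h1 Az]; by have : (C `&` A1) (fun i => f i (z i)); [split|rewrite CA].
Qed.

Lemma Pi0_preimage {disp : Order.disp_t} {W : orderType disp} (xi : W) (S T : topologicalType)
  (h : S -> T) A : continuous h -> Pi0 xi A -> Pi0 xi (h @^-1` A).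
Proof. by move=> ch; exact: (is_Sigma0_preimage ch). Qed.

Lemma Delta0_preimage {disp : Order.disp_t} {W : orderType disp} (xi : W) (S T : topologicalType)
  (h : S -> T) A : continuous h -> Delta0 xi A -> Delta0 xi (h @^-1` A).
Proof. by move=> ch [? ?]; split; [exact: is_Sigma0_preimage|exact: Pi0_preimage]. Qed.

Lemma setT_souslin {I : Type} (X : I -> topologicalType) :
  souslin_scheme (setT : set (prod_topology X)) (fun=> setT).
Proof. by split=> // u x _; exists 0. Qed.

Lemma exactly_oneP (P Q : Prop) : P \/ Q -> ~ (P /\ Q) -> exactly_one P Q.
Proof.
by move=> [p|q] n; [left|right]; split=> // ?; apply: n.
Qed.

(** * The two dichotomies *)

Section dichotomy.
Context {d : dcard} (T : set (seq (ix d -> ix d))).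
Hypothesis hT : is_tree T.
Hypothesis hTs : suitable_levels T.
Context {disp : Order.disp_t} {W : orderType disp}.
Hypothesis wfW : well_founded (fun x y : W => (x < y)%O).
Variable xi : W.
Hypothesis xi1 : ge1 xi.
Context {X : ix d -> topologicalType}.
Hypothesis hX : forall i, polish (X i).
Variables A0 A1 : set (prod_topology X).
Hypotheses (hA0 : analytic A0) (hA1 : analytic A1).

(** Apply [reduction] with [S] and the empty set, the label [None] standing for [A1]. If the
    starting ideal is improper, [A1] is covered by a potentially Sigma^0_xi set missing [A0], and
    its complement separates. *)
Lemma Pi_dichotomy S : class_in (Sigma0 xi) (body T) S ->
  pot_separable (Pi0 xi) A0 A1 \/ reduces S (body T `\` S) A0 A1.
Proof.
move=> [ST hS]; have [sep|nsep] := pselect (pot_separable (Pi0 xi) A0 A1); [by left|right].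
have [V0 hV0] := analytic_souslin hX hA0; have [V1 hV1] := analytic_souslin hX hA1.
have [h0 _] := @is_Sigma0_0T _ W (set_type (body T)) xi wfW xi1.
have AV l : souslin_scheme (if l is Some false then A0 else A1) (if l is Some false then V0 else V1).
  by case: l => [[]|].
have [|f [cf fP]] := @reduction d T hT hTs disp W wfW xi X hX _ _ AV
    (set_val @^-1` S) set0 hS h0 (fun _ _ e => e).
  move=> [B [CB [BA [C0 [C1 [[D0 [SD0 D0A C0D]] [D1 [SD1 D1A C1D]] CC]]] BC]]].
  apply: nsep; exists (~` D0); first by apply: pS_pot_Pi => //; rewrite setCK.
  split; first by move=> x Ax /D0A; exact.
  rewrite -subset0 => x [nD Ax]; have [/BA//|/CC[/C0D//|/C1D/D1A]] := BC x Logic.I.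
  exact.
exists f; split=> // x.
  by move=> Sx; have [h _ _] := fP (SigSub (mem_set (ST x Sx))); exact: h.
move=> [bx nSx]; have [_ _ h] := fP (SigSub (mem_set bx)); exact: h.
Qed.

(** The label [None] imposes nothing, so its target is the whole space. If the starting ideal is
    improper, two potentially Sigma^0_xi sets, missing [A0] and [A1] respectively, cover the space,
    and [pS_reduction] turns them into a separating set. *)
Lemma Delta_dichotomy S0 S1 : class_in (Sigma0 xi) (body T) S0 ->
  class_in (Sigma0 xi) (body T) S1 -> S0 `&` S1 = set0 ->
  pot_separable (Delta0 xi) A0 A1 \/ reduces S0 S1 A0 A1.
Proof.
move=> [ST0 hS0] [ST1 hS1] S01.
have [sep|nsep] := pselect (pot_separable (Delta0 xi) A0 A1); [by left|right].
have [V0 hV0] := analytic_souslin hX hA0; have [V1 hV1] := analytic_souslin hX hA1.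
have dis (z : set_type (body T)) : S0 (set_val z) -> S1 (set_val z) -> False.
  by move=> z0 z1; have : (S0 `&` S1) (set_val z) by []; rewrite S01.
have AV l : souslin_scheme (if l is Some b then if b then A1 else A0 else setT)
    (if l is Some b then if b then V1 else V0 else fun=> setT).
  by case: l => [[]|] //; exact: setT_souslin.
have [|f [cf fP]] := @reduction d T hT hTs disp W wfW xi X hX _ _ AV
    (set_val @^-1` S0) (set_val @^-1` S1) hS0 hS1 dis.
  move=> [B [CB [BA [C0 [C1 [[D0 [SD0 D0A C0D]] [D1 [SD1 D1A C1D]] CC]]] BC]]].
  have D01 : D0 `|` D1 = setT.
    rewrite -subTset => x _; have [/BA nT|/CC[/C0D|/C1D]] := BC x Logic.I; [by case: nT|by left|by right].
  have [E [SE SE' D1E ED0]] := pS_reduction wfW xi1 SD0 SD1 D01.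
  apply: nsep; exists (~` E); first by apply: pS_pot_Delta => //; rewrite setCK.
  split; first by move=> x Ax /ED0/D0A; exact.
  by rewrite -subset0 => x [nE Ax]; apply: nE; apply: D1E => /D1A; exact.
exists f; split=> // x Sx.
  by have [h _ _] := fP (SigSub (mem_set (ST0 x Sx))); exact: h.
by have [_ h _] := fP (SigSub (mem_set (ST1 x Sx))); exact: h.
Qed.

End dichotomy.

Theorem theorem4p1
    (d : dcard) (hd : dcard_ge2 d)
    (T : set (seq (ix d -> ix d))) (hT : is_tree T) (hTs : suitable_levels T)
    (disp : Order.disp_t) (W : orderType disp)
    (hW : wochoice.well_order (<=%O : rel W))
    (xi : W) (hxi : countable_ordinal xi) (hxi1 : ge1 xi)
    (X : ix d -> topologicalType) (hX : forall i, polish (X i))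
    (A0 A1 : set (prod_topology X))
    (hA0 : analytic A0) (hA1 : analytic A1) (hA : A0 `&` A1 = set0) :
  (forall S : set (prod_topology (@dpows d)),
     class_in (Sigma0 xi) (body T) S ->
     let a := pot_separable (Pi0 xi) A0 A1 in
     let b := reduces S (body T `\` S) A0 A1 in
     (a \/ b) /\
     (~ pot_separable (Pi0 xi) S (body T `\` S) -> exactly_one a b))
  /\
  (forall S0 S1 : set (prod_topology (@dpows d)),
     class_in (Sigma0 xi) (body T) S0 ->
     class_in (Sigma0 xi) (body T) S1 ->
     S0 `&` S1 = set0 ->
     let a := pot_separable (Delta0 xi) A0 A1 in
     let b := reduces S0 S1 A0 A1 in
     (a \/ b) /\
     (~ pot_separable (Delta0 xi) S0 S1 -> exactly_one a b)).
Proof.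
have wfW := well_order_wf hW.
split=> [S hS a b|S0 S1 hS0 hS1 S01 a b].
  have ab : a \/ b by exact: (Pi_dichotomy hT hTs wfW hxi1 hX hA0 hA1 hS).
  split=> // nS; apply: exactly_oneP => // -[sep red]; apply: nS.
  by apply: (reduces_pot_separable _ hX red sep) => *; exact: Pi0_preimage.
have ab : a \/ b by exact: (Delta_dichotomy hT hTs wfW hxi1 hX hA0 hA1 hS0 hS1 S01).
split=> // nS; apply: exactly_oneP => // -[sep red]; apply: nS.
by apply: (reduces_pot_separable _ hX red sep) => *; exact: Delta0_preimage.
Qed.
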